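(* Given any initial value $X_0\in\mathfrak{D}(0,\infty)$ (an $\mathscr{F}_0$-measurable random element), there exists a pathwise unique strong solution $(X_t:t\ge 0)$ with infinite lifetime to the stochastic integral equation, for $t\ge 0$ and $x>0$, $$X_{t}(x)= X_{0}(x+t)- X_{0}(t)+\int_{0}^{t} \int_{0}^{\langle X_{s-}, \alpha\rangle} \int_{E} \int_{0}^{p(A_{\alpha}( X_{s-},y), n)} \sum_{i=1}^{n} 1_{\{0<z_{i}-(t-s) \le x\}}\, M(d s, d u, d w, d v),$$ where $w=(y,n,z)\in E$ and $z=(z_1,z_2,\ldots)$.
   Context: Notation. $\mathbb{N}=\{0,1,2,\ldots\}$; ''positive'' means nonnegative. $\mathfrak{M}(0,\infty)$ is the set of finite Borel measures on $(0,\infty)$. $\mathfrak{D}(0,\infty)$ is the set of bounded positive right-continuous increasing functions $f$ on $\mathbb{R}$ with $f(x)=0$ for $x\le 0$; $\nu\in\mathfrak{M}(0,\infty)$ is identified with its distribution function $\nu(x)=\nu((0,x])$ in $\mathfrak{D}(0,\infty)$. $B(0,\infty)$ is the set of bounded Borel functions on $(0,\infty)$; $C^1(0,\infty)$ is the set of bounded continuous functions on $(0,\infty)$ with bounded continuous first derivative; superscript $+$ denotes the positive elements; $\|\cdot\|$ is the supremum norm. Any function on $A\subset\mathbb{R}$ is extended by $0$ to $\mathbb{R}\setminus A$, and $p(\infty,n)=0$. $\langle\nu,f\rangle=\int_{(0,\infty)}f\,d\nu$. $\int_a^b=\int_{(a,b]}$ and $\int_a^\infty=\int_{(a,\infty)}$.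 Parameters. $\alpha\in C^1(0,\infty)^+$. For each $x\in(0,\infty)$, $\{p(x,i):i\in\mathbb{N}\}$ is a probability distribution, $p(\cdot,i)\in C^1(0,\infty)^+$ for every $i$, and $\sup_{x>0}\sum_{i\ge1}i\,p(x,i)<\infty$; put $g(x,z)=\sum_{i\ge0}p(x,i)z^i$ for $z\in[0,1]$, and assume $g(\cdot,z)\in C^1(0,\infty)^+$ for each $z$. $G$ is a continuous probability distribution on $(0,\infty)$. For $\mu\in\mathfrak{D}(0,\infty)$ and $0\le y\le 1$, $A_\alpha(\mu,y)=\inf\{z\ge0:\langle\mu,\alpha1_{(0,z]}\rangle>\langle\mu,\alpha\rangle y\}$ with $\inf\emptyset=\infty$. $(\Omega,\mathscr{F},\mathscr{F}_t,\mathbf{P})$ is a filtered probability space satisfying the usual hypotheses. $E=(0,1]\times\mathbb{N}\times(0,\infty)^\infty$, with generic element $w=(y,n,z)$. $M(dt,du,dw,dv)$ is an $(\mathscr{F}_t)$-Poisson random measure on $(0,\infty)^2\times E\times(0,1]$ with intensity $dt\,du\,K(dw)\,dv$, where $K(dw)=dy\,\pi(dn)\,G^\infty(dz)$, $\pi$ is the counting measure on $\mathbb{N}$ and $G^\infty$ is the infinite product of $G$ on $(0,\infty)^\infty$. $X_{s-}$ denotes the left limit at time $s$ (mass at $0$ being discarded). ''Infinite lifetime'' means that $X_t\in\mathfrak{D}(0,\infty)$ for all $t\ge0$ and that the equation holds almost surely for all $t\ge 0$, i.e. the solution does not explode in finite time. *)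

(* Defs.v *)
From HB Require Import structures.
From mathcomp Require Import all_boot all_order all_algebra.
From mathcomp Require Import all_classical all_reals all_analysis.
From mathcomp Require Import measurable_realfun.

Set Implicit Arguments.
Unset Strict Implicit.
Unset Printing Implicit Defensive.

Import Order.TTheory GRing.Theory Num.Theory.
Import numFieldNormedType.Exports.

Local Open Scope classical_set_scope.
Local Open Scope ring_scope.

Section function_classes.
Context {R : realType}.

(* C^1(0,oo)^+; only the values on (0,oo) matter. *)
Definition C1_pos (f : R -> R) : Prop :=
  [/\ forall x : R, 0 < x -> 0 <= f x,
      exists C : R, forall x : R, 0 < x -> `|f x| <= C,
      forall x : R, 0 < x -> {for x, continuous f},
      forall x : R, 0 < x -> derivable f x 1 &
      (forall x : R, 0 < x -> {for x, continuous (derive1 f)}) /\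
      exists C : R, forall x : R, 0 < x -> `|derive1 f x| <= C].

(* The class D(0,oo). Right-continuity and monotonicity are part of
   [cumulative]. *)
Record dist_fun := DistFun {
  dist_cumulative :> cumulative R R ;
  dist_pos : forall x : R, 0 <= dist_cumulative x ;
  dist_bounded : exists C : R, forall x : R, dist_cumulative x <= C ;
  dist_le0 : forall x : R, x <= 0 -> dist_cumulative x = 0 }.

Definition pairing (mu : dist_fun) (f : R -> R) : R :=
  \int[lebesgue_stieltjes_measure mu]_(x in `]0, +oo[) f x.

Definition A_quantile (alpha : R -> R) (mu : dist_fun) (y : R) : \bar R :=
  ereal_inf [set z%:E | z in [set z : R | 0 <= z /\
    pairing mu alpha * y < pairing mu (fun x => alpha x * \1_(`]0, z]) x)]].

(* Extension by 0 outside (0,oo), with p(oo, n) = 0. *)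
Definition p_ext (p : R -> nat -> R) (a : \bar R) (n : nat) : R :=
  if a is r%:E then (if 0 < r then p r n else 0) else 0.

(* Weak convergence in the finite measures on [0,oo), where a continuous
   function on [0,oo) is represented by a continuous extension to R. The
   left limit is nu + c delta_0, and nu is what remains once the mass c
   at 0 is discarded. *)
Definition left_limit (X : R -> dist_fun) (s : R) (nu : dist_fun) : Prop :=
  exists c : R, 0 <= c /\ forall f : R -> R, continuous f ->
    (exists C : R, forall x : R, `|f x| <= C) ->
    pairing (X t) f @[t --> s^'-] --> pairing nu f + c * f 0.

Definition weak_right_continuous (X : R -> dist_fun) (t : R) : Prop :=
  forall f : R -> R, continuous f -> (exists C : R, forall x : R, `|f x| <= C) ->
    pairing (X r) f @[r --> t^'+] --> pairing (X t) f.

End function_classes.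
Arguments dist_fun : clear implicits.

Section offspring.
Context {R : realType}.

Definition gen_fun (p : R -> nat -> R) (x z : R) : R :=
  limn (series (fun i => p x i * z ^+ i)).

Definition offspring_law (p : R -> nat -> R) : Prop :=
  [/\ forall x : R, 0 < x ->
        (forall i, 0 <= p x i) /\ (\sum_(0 <= i <oo) (p x i)%:E = 1)%E,
      forall i, C1_pos (p ^~ i),
      (ereal_sup [set \sum_(1 <= i <oo) (i%:R * p x i)%:E | x in `]0%R, +oo[]
         < +oo)%E &
      forall z : R, 0 <= z <= 1 -> C1_pos (fun x => gen_fun p x z)].

Definition continuous_law (G : probability R R) : Prop :=
  G `]0, +oo[%classic = 1%E /\ continuous (fun x : R => fine (G `]-oo, x]%classic)).

End offspring.

Section marks.
Variable R : realType.

Definition cylinders : set (set (nat -> R)) :=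
  [set A | exists (i : nat) (B : set R),
    measurable B /\ A = (fun z => z i) @^-1` B].

(* Real sequences with the product sigma-algebra. The sequence
   (z_1, z_2, ...) is indexed from 0. *)
Definition zseq := g_sigma_algebraType cylinders.
HB.instance Definition _ := Measurable.on zseq.

(* Points (s, u, (y, n, z), v). *)
Definition noise_pt : Type := (R * R * (R * nat * zseq) * R)%type.
HB.instance Definition _ := Measurable.on noise_pt.

Definition markE : set (R * nat * zseq) :=
  [set w | 0 < w.1.1 <= 1 /\ forall i, 0 < w.2 i].

(* The random measure lives on (0,oo)^2 x E x (0,1]; [noise_pt] is the ambient
   type. *)
Definition noise_dom : set noise_pt :=
  [set q | let: (s, u, w, v) := q in
    [/\ 0 < s, 0 < u, markE w & 0 < v <= 1]].

Definition past (t : R) : set noise_pt :=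
  noise_dom `&` [set q | q.1.1.1 <= t].

Definition future (t : R) : set noise_pt :=
  noise_dom `&` [set q | t < q.1.1.1].

Definition infinite_product (G : probability R R) (Ginf : probability zseq R) :=
  forall (n : nat) (B : nat -> set R), (forall i, measurable (B i)) ->
    (Ginf [set z | forall i, (i < n)%N -> B i (z i)] =
     \prod_(i < n) G (B i))%E.

(* ds du (dy pi(dn) Ginf(dz)) dv, to be evaluated on subsets of [noise_dom]. *)
Definition intensity (Ginf : probability zseq R) : set noise_pt -> \bar R :=
  ((@lebesgue_measure R \x @lebesgue_measure R)
     \x (@lebesgue_measure R \x @counting nat R \x Ginf)
     \x @lebesgue_measure R)%E.

End marks.

Section noise.
Context {R : realType} {d : measure_display} {Omega : measurableType d}.
Variable P : probability Omega R.

Definition usual_filtration (F : R -> set (set Omega)) : Prop :=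
  [/\ forall t : R, 0 <= t -> sigma_algebra setT (F t) /\ F t `<=` measurable,
      forall s t : R, 0 <= s -> s <= t -> F s `<=` F t,
      forall t : R, 0 <= t -> F t = \bigcap_(s in [set s : R | t < s]) F s &
      forall N, P.-negligible N -> F 0 N].

Definition sigma_indep (F H : set (set Omega)) : Prop :=
  forall A B, F A -> H B -> P (A `&` B) = (P A * P B)%E.

Definition noise_sigma (M : Omega -> {measure set (noise_pt R) -> \bar R})
    (D : set (noise_pt R)) : set (set Omega) :=
  <<s [set A | exists (B : set (noise_pt R)) (C : set (\bar R)),
    [/\ measurable B, B `<=` D, measurable C &
        A = (fun w => M w B) @^-1` C]] >>.

(* (F_t)-Poisson random measure with intensity [lambda] on [noise_dom].
   The library's [poisson_prob] has a spurious extra argument, here 0;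
   [poisson_prob 0] is the Dirac mass at 0, whereas [poisson_pmf 0] is not. *)
Definition poisson_random_measure (F : R -> set (set Omega))
    (lambda : set (noise_pt R) -> \bar R)
    (M : Omega -> {measure set (noise_pt R) -> \bar R}) : Prop :=
  [/\ forall t : R, 0 <= t -> noise_sigma M (past t) `<=` F t,
      forall t : R, 0 <= t -> sigma_indep (F t) (noise_sigma M (future t)),
      forall B : set (noise_pt R), measurable B -> B `<=` noise_dom (R:=R) -> (lambda B < +oo)%E ->
        forall k : nat, P ((fun w => M w B) @^-1` [set (k%:R)%:E]) =
          poisson_prob (fine (lambda B)) 0 [set k] &
      forall (n : nat) (B : 'I_n -> set (noise_pt R)) (C : 'I_n -> set (\bar R)),
        (forall i, measurable (B i) /\ B i `<=` noise_dom (R:=R)) ->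
        trivIset setT B -> (forall i, measurable (C i)) ->
        P [set w | forall i, C i (M w (B i))] =
        (\prod_(i < n) P ((fun w => M w (B i)) @^-1` C i))%E].

(* The sigma-algebra of a random element of D(0,oo) is generated by its
   evaluations, as is the Borel sigma-algebra of the weak topology. *)
Definition init_sigma (X0 : Omega -> dist_fun R) : set (set Omega) :=
  <<s [set A | exists (x : R) (C : set R),
    measurable C /\ A = (fun w => X0 w x) @^-1` C] >>.

(* P-completed filtration generated by the initial value and the noise. *)
Definition natural_filtration (X0 : Omega -> dist_fun R)
    (M : Omega -> {measure set (noise_pt R) -> \bar R}) (t : R) :
    set (set Omega) :=
  <<s init_sigma X0 `|` noise_sigma M (past t) `|` P.-negligible >>.

End noise.

Section equation.
Context {R : realType}.
Variables (alpha : R -> R) (p : R -> nat -> R).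

(* Right-hand integral for one realization [m] of the noise; [Xl s] stands
   for X_{s-}. *)
Definition birth_integral (m : {measure set (noise_pt R) -> \bar R})
    (Xl : R -> dist_fun R) (t x : R) : \bar R :=
  (\int[m]_(q in [set q | let: (s, u, (y, n, z), v) := q in
      [/\ 0 < s <= t, 0 < u <= pairing (Xl s) alpha, markE (y, n, z) &
          0 < v <= p_ext p (A_quantile alpha (Xl s) y) n]%R])
    (let: (s, u, (y, n, z), v) := q in
      \sum_(i < n) ((0 < z i - (t - s) <= x)%R)%:R)%R%:E)%E.

Context {d : measure_display} {Omega : measurableType d}.
Variable P : probability Omega R.

(* Cadlag solution with infinite lifetime, adapted to [F]. *)
Definition solution (F : R -> set (set Omega))
    (M : Omega -> {measure set (noise_pt R) -> \bar R})
    (X0 : Omega -> dist_fun R) (X : R -> Omega -> dist_fun R) : Prop :=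
  (forall t : R, 0 <= t -> init_sigma (X t) `<=` F t) /\
  {ae P, forall w, exists Xl : R -> dist_fun R,
    [/\ forall t : R, 0 <= t -> weak_right_continuous (X ^~ w) t,
        forall s : R, 0 < s -> left_limit (X ^~ w) s (Xl s) &
        forall t x : R, 0 <= t -> 0 < x ->
          (X t w x)%:E =
          ((X0 w (x + t) - X0 w t)%R%:E + birth_integral (M w) Xl t x)%E]}.

End equation.

(* Main.v *)
From HB Require Import structures.
Require Import Defs.
From mathcomp Require Import all_boot all_order all_algebra.
From mathcomp Require Import all_classical all_reals all_analysis.
From mathcomp Require Import measurable_realfun.
From mathcomp Require Import ring lra zify.
Import Order.TTheory GRing.Theory Num.Theory.
Import numFieldNormedType.Exports.
Set Implicit Arguments.
Unset Strict Implicit.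
Unset Printing Implicit Defensive.
Local Open Scope classical_set_scope.
Local Open Scope ring_scope.

(** For one realization of the noise the equation describes a particle system.
    An individual is a pair of times, birth and death; it sits at the distance
    that separates the present from its death, so it moves to the left at unit
    speed and leaves at 0. The right-hand side counts the pairs alive at time t.
    Such a path is weakly right-continuous, and its left limits lose only the
    mass of the particles that die at that very time
    ([particles_right_continuous], [particles_left_limit]).

    Uniqueness ([path_unique]) rests on the integer values of the noise. Two
    solutions that agree before a time tau have the same left limits up to tau,
    hence accept the same atoms up to and including tau. After tau,
    right-continuity of the total mass makes the number of children born in a
    short interval less than 1, hence 0 ([no_birth_right]), so the solutions
    agree slightly beyond tau.

    For existence, the noise is restricted to a box of finite intensity and time
    is cut into cells. The scheme [euler] decides in each cell as if no birth had
    happened since the beginning of the cell. It solves the restricted equation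
    exactly as soon as no cell contains two atoms ([euler_solution]). The
    probability that a cell contains two atoms is at most the square of its
    intensity, so a fine mesh makes the exceptional event as small as wanted
    ([crowded_cell_small]).

    To let the box grow, births must be controlled independently of the box. The
    region of acceptance in a cell is determined by the past, so the mean number
    of children born in the cell is the one computed with the intensity measure
    ([freezing]), and this involves the birth rates only through the bound of
    alpha and the bound of the mean offspring. Summing over the cells gives a
    Gronwall estimate ([mean_accepted]). By Borel-Cantelli
    ([ae_eventually_lt1]), almost surely and for all large j, the scheme of the
    box of size 2^(j+1) uses until a given time only atoms of the box of size
    2^j. It then solves the same equation as the scheme of that box
    ([scheme_next]), and the two coincide by uniqueness ([stabilize]). The
    eventual value solves the full equation ([pathwise_limit]).

    The state of a scheme at time t depends only on the initial value and on the
    noise until t ([measurable_euler_path]). Hence the limit is adapted to the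
    completed natural filtration, which is what makes the solution strong. *)

(** * Distribution functions and their measures *)

Notation LS := lebesgue_stieltjes_measure.

Section bounded_convergence.
Context d (T : measurableType d) (R : realType).
Variables (mu : {measure set T -> \bar R}) (D : set T).
Hypotheses (mD : measurable D) (Dfin : (mu D < +oo)%E).

Lemma bounded_integrable (f : T -> R) (C : R) : measurable_fun D f ->
  (forall x, D x -> `|f x| <= C) -> mu.-integrable D (EFin \o f).
Proof.
move=> mf fC; apply: (@le_integrable _ _ _ mu D mD _ (cst C%:E)).
- exact/measurable_EFinP.
- move=> x Dx /=; rewrite lee_fin (le_trans (fC _ Dx))// ler_norm//.
- apply/integrableP; split; first exact: measurable_cst.
  rewrite integral_cst//= lte_mul_pinfty//.
Qed.

Lemma bounded_cvg (f_ : nat -> T -> R) (f : T -> R) (C : R) :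
  (forall n, measurable_fun D (f_ n)) ->
  (forall n x, D x -> `|f_ n x| <= C) ->
  (forall x, D x -> f_ n x @[n --> \oo] --> f x) ->
  \int[mu]_(x in D) f_ n x @[n --> \oo] --> \int[mu]_(x in D) f x.
Proof.
move=> mf fC ff.
have ic : mu.-integrable D (cst C%:E).
  apply/integrableP; split; first exact: measurable_cst.
  by rewrite integral_cst//= lte_mul_pinfty.
have fC' x : D x -> `|f x| <= C.
  move=> Dx; have h : `|f_ n x| @[n --> \oo] --> `|f x| by apply: cvg_norm; exact: ff.
  by move/cvg_lim : (h) => <- //; apply: limr_le; [exact: cvgP h|apply: nearW => n; exact: fC].
have mf' : measurable_fun D f by apply: (measurable_fun_cvg mf).
have := @dominated_cvg _ _ _ mu D mD (fun n => EFin \o f_ n) (EFin \o f) (cst C%:E).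
move=> /(_ _ _ _ ic) h.
have : (\int[mu]_(x in D) (f_ n x)%:E)%E @[n --> \oo] --> (\int[mu]_(x in D) (f x)%:E)%E.
  apply: h => [n|x Dx|x Dx|n x Dx].
  - exact/measurable_EFinP.
  - by apply: cvg_EFin; [exact: nearW|exact: ff].
  - by [].
  - by rewrite /= lee_fin fC.
move=> h1; apply: fine_cvg; rewrite fineK//.
by apply: integrable_fin_num => //; apply: bounded_integrable fC'.
Qed.

End bounded_convergence.

Section dist_fun_measure.
Context {R : realType}.
Implicit Types mu nu : dist_fun R.

Lemma dist_fun_ext mu nu : (forall x, mu x = nu x) -> mu = nu.
Proof.
case: mu nu => [[f [[a b]]] p1 p2 p3] [[g [[a' b']]] q1 q2 q3] /= h.
have ? : f = g by apply/funext.
subst g.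
have ea : a = a' by exact: Prop_irrelevance.
have eb : b = b' by exact: Prop_irrelevance.
subst a' b'.
have -> : p1 = q1 by exact: Prop_irrelevance.
have -> : p2 = q2 by exact: Prop_irrelevance.
have -> : p3 = q3 by exact: Prop_irrelevance.
by [].
Qed.

Lemma LS_oc mu a b : a <= b -> LS mu `]a, b]%classic = (mu b - mu a)%:E.
Proof.
move=> ab; rewrite /LS /measure_extension measurable_mu_extE/=.
  by rewrite wlength_itv_bnd.
exact: is_ocitv.
Qed.

Lemma LS_le0 mu (A : set R) : measurable A -> A `<=` `]-oo, 0]%classic -> LS mu A = 0%E.
Proof.
move=> mA A0; apply/eqP; rewrite -measure_le0.
have -> : 0%E = LS mu `]-oo, 0%R]%classic.
  rewrite itvNybndEbigcup; apply/esym.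
  have : LS mu `]-n%:R, 0%R]%classic @[n --> \oo] -->
     LS mu (\bigcup_n `]-n%:R, 0]%classic).
    apply: nondecreasing_cvg_mu => //; first exact: bigcup_measurable.
    move=> n m nm; apply/subsetPset => x/=; rewrite !in_itv/= => /andP[+ ->].
    by rewrite andbT; apply: le_lt_trans; rewrite lerN2 ler_nat.
  move/cvg_lim => <- //; apply: lim_near_cst => //; apply: nearW => n.
  by rewrite LS_oc ?oppr_le0// !dist_le0 ?oppr_le0// subrr.
by apply: le_measure; rewrite ?inE.
Qed.

Lemma LS_0x mu x : LS mu `]0, x]%classic = (mu x)%:E.
Proof.
have [x0|x0] := leP 0 x; first by rewrite LS_oc// (@dist_le0 _ mu 0)// subr0.
by rewrite set_itv_ge ?measure0 ?dist_le0// ?ltW// bnd_simp -leNgt ltW.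
Qed.

Lemma LS_0y_cvg mu : (mu n%:R)%:E @[n --> \oo] --> LS mu `]0%R, +oo[%classic.
Proof.
rewrite itv_bndy_bigcup_BRight.
have : LS mu `]0, 0 + n%:R]%classic @[n --> \oo] --> LS mu (\bigcup_n `]0, 0 + n%:R]%classic).
  apply: nondecreasing_cvg_mu => //; first exact: bigcup_measurable.
  move=> n m nm; apply/subsetPset => x/=; rewrite !in_itv/= => /andP[-> /le_trans]/=.
  by apply; rewrite !add0r ler_nat.
by under eq_fun do rewrite LS_0x add0r.
Qed.

Lemma LS_0y_fin mu : (LS mu `]0%R, +oo[%classic < +oo)%E.
Proof.
have [C hC] := dist_bounded mu.
apply: (@le_lt_trans _ _ C%:E); last exact: ltry.
move/cvg_lim : (@LS_0y_cvg mu) => <- //.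
apply: lime_le; first exact: cvgP (@LS_0y_cvg mu).
by apply: nearW => n; rewrite lee_fin.
Qed.

Lemma dist_le_mass mu x : ((mu x)%:E <= LS mu `]0%R, +oo[%classic)%E.
Proof. by rewrite -LS_0x le_measure ?inE//; exact: subset_itvl. Qed.

Lemma LS_finite mu (A : set R) : measurable A -> (LS mu A < +oo)%E.
Proof.
move=> mA; have -> : A = (A `&` `]-oo, 0%R]%classic) `|` (A `&` `]0, +oo[%classic).
  apply/seteqP; split => x/=; last by case=> -[].
  by rewrite !in_itv/= andbT => Ax; case: (leP x 0); [left|right].
apply: (le_lt_trans (measureU2 _ _ _)); rewrite ?measurableI//; try exact: measurableI.
have e : LS mu (A `&` `]-oo, 0%R]%classic) = 0%E by apply: LS_le0; [exact: measurableI|exact: subIsetr].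
rewrite [X in (X + _)%E]e add0e.
by apply: le_lt_trans (LS_0y_fin mu); rewrite le_measure ?inE//; exact: measurableI.
Qed.

Lemma LS_itv0y mu (A : set R) : measurable A -> LS mu A = LS mu (A `&` `]0, +oo[%classic).
Proof.
move=> mA; rewrite [in LHS](_ : A = (A `&` `]-oo, 0%R]%classic) `|` (A `&` `]0, +oo[%classic)).
  have e : LS mu (A `&` `]-oo, 0%R]%classic) = 0%E by apply: LS_le0; [exact: measurableI|exact: subIsetr].
  rewrite measureU; [by rewrite [X in (X + _)%E]e add0e|exact: measurableI|exact: measurableI|].
  by apply/seteqP; split => x//= -[[_] + [_]]; rewrite !in_itv/= andbT leNgt => /negP.
apply/seteqP; split => x/=; last by case=> -[].
by rewrite !in_itv/= andbT => Ax; case: (leP x 0); [left|right].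
Qed.

(** A distribution function vanishes on the negative half-line, so its measure
    is the unique extension of the lengths of half-open intervals; the trace of
    nu on the positive half-line gives them the same lengths. *)
Lemma LS_eq mu (nu : {measure set (measurableTypeR R) -> \bar R}) :
  (forall x, 0 < x -> (mu x)%:E = nu `]0, x]%classic) ->
  forall A : set R, measurable A -> A `<=` `]0, +oo[%classic -> LS mu A = nu A.
Proof.
move=> h A mA A0.
have m0 : measurable (`]0, +oo[%classic : set (measurableTypeR R)) by [].
have := @lebesgue_stieltjes_measure_unique _ mu [the measure _ _ of mrestr nu m0] _ A mA.
move=> ->; first by rewrite /= /mrestr setIidl.
move=> _ [[a b] _ <-]/=; rewrite /mrestr.
have [ba|ab] := leP b a.
  by rewrite set_itv_ge ?set0I ?measure0// bnd_simp -leNgt.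
have [b0|b0] := leP b 0.
  rewrite LS_oc ?(ltW ab)// !dist_le0// ?subrr; last by rewrite (le_trans _ b0)// ltW.
  rewrite (_ : _ `&` _ = set0) ?measure0//; apply/seteqP; split => x//=.
  by rewrite !in_itv/= andbT => -[/andP[_ xb] x0]; move: (le_lt_trans b0 x0); rewrite ltNge xb.
have [a0|a0] := leP a 0.
  rewrite LS_oc ?(ltW ab)// (dist_le0 _ a0) subr0 h//; congr (nu _).
  apply/seteqP; split => x/=; rewrite !in_itv/= ?andbT.
    by move=> /andP[x0 ->]; rewrite (le_lt_trans a0 x0).
  by move=> [/andP[_ ->] ->].
rewrite LS_oc ?(ltW ab)// EFinB !h//.
have -> : `]0, b]%classic = (`]0, a]%classic : set (measurableTypeR R)) `|` `]a, b]%classic.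
  apply/seteqP; split => x/=; rewrite !in_itv/=.
    by move=> /andP[-> ->]; rewrite andbT/=; case: (leP x a); [left|right].
  by move=> [/andP[-> /le_trans->]//|/andP[ax ->]]; rewrite ?(ltW ab)// (lt_trans a0 ax).
have f1 : nu `]0, a]%classic \is a fin_num by rewrite -h.
rewrite measureU//.
  rewrite addeAC subee// add0e; congr (nu _).
  apply/seteqP; split => x/=; rewrite !in_itv/= ?andbT; last by case.
  by move=> /andP[ax ->]; rewrite ax (lt_trans a0 ax).
by apply/seteqP; split => x//=; rewrite !in_itv/= => -[/andP[_ xa] /andP[ax _]]; move: (lt_le_trans ax xa); rewrite ltxx.
Qed.

Lemma dist_fun_of_measure (nu : {measure set (measurableTypeR R) -> \bar R}) :
  (nu `]0%R, +oo[%classic < +oo)%E ->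
  exists mu, forall x, 0 < x -> (mu x)%:E = nu `]0, x]%classic.
Proof.
move=> nufin.
have nf x : nu `]0, x]%classic \is a fin_num.
  rewrite ge0_fin_numE//; apply: le_lt_trans nufin.
  by apply: le_measure; rewrite ?inE//; exact: subset_itvl.
pose F x := fine (nu `]0, x]%classic).
have Fnd : nondecreasing F.
  move=> x y xy; apply: fine_le => //; apply: le_measure; rewrite ?inE//.
  exact: subset_itvl.
have Frc : right_continuous F.
  move=> x; apply/cvg_at_rightP => u [ux uc].
  have h z : F z = \int[nu]_(y in `]0, +oo[%classic) \1_(`]0, z]) y.
    rewrite /F /Rintegral; congr fine; rewrite -/(EFin \o _) integral_indic//.
    congr (nu _); apply/seteqP; split => y/=; rewrite !in_itv/= ?andbT; last by case.
    by move=> /andP[-> ->].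
  have hu : (fun n => F (u n)) = (fun n => \int[nu]_(y in `]0, +oo[%classic) \1_(`]0, u n]) y).
    by apply/funext => n; exact: h.
  change (F (u n) @[n --> \oo] --> F x); rewrite hu h.
  apply: (@bounded_cvg _ _ _ nu _ _ nufin _ _ 1) => //.
  - by move=> n; apply: measurable_indic.
  - by move=> n y _; rewrite indicE ger0_norm// lern1 leq_b1.
  - move=> y; rewrite /= in_itv/= andbT => y0.
    have [yx|xy] := leP y x.
      apply: cvg_near_cst; apply: nearW => n; rewrite !indicE !mem_set//= in_itv/= y0//=.
      by rewrite (le_trans yx)// ltW.
    have : \forall n \near \oo, u n < y by apply: (cvgr_lt x).
    move=> uy; apply: cvg_near_cst; near=> n; rewrite !indicE !memNset//= in_itv/= y0/=.
      by apply/negP; rewrite -ltNge.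
    by apply/negP; rewrite -ltNge; near: n.
have F0 x : x <= 0 -> F x = 0.
  by move=> x0; rewrite /F set_itv_ge ?measure0// bnd_simp -leNgt.
pose G : cumulative R R := HB.pack F (isCumulative.Build R _ R F Fnd Frc).
have Gpos x : 0 <= G x by apply: fine_ge0.
have Gb : exists C : R, forall x, G x <= C.
  exists (fine (nu `]0%R, +oo[%classic)) => x; apply: fine_le => //.
    by rewrite ge0_fin_numE.
  by apply: le_measure; rewrite ?inE//; exact: subset_itvl.
exists (DistFun Gpos Gb F0) => x x0 /=.
by rewrite /F fineK.
Unshelve. all: by end_near. Qed.

End dist_fun_measure.

(** * Left limits in time *)

Section left_limits.
Context {R : realType}.
Implicit Types mu nu : dist_fun R.

Definition clamp (t : R) : R := Num.max 0 (Num.min 1 t).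

Lemma continuous_clamp : continuous clamp.
Proof.
move=> t; apply: (@continuous_max R _ (cst 0 : R -> R^o) (fun t : R => Num.min 1 t : R^o)); first exact: cvg_cst.
apply: (@continuous_min R _ (cst 1 : R -> R^o) (fun t : R => t : R^o)); first exact: cvg_cst.
exact: cvg_id.
Qed.

Lemma clamp_ge0 t : 0 <= clamp t.
Proof. by rewrite /clamp le_max lexx. Qed.

Lemma clamp_le1 t : clamp t <= 1.
Proof. by rewrite /clamp ge_max ler01 ge_min lexx. Qed.

Lemma clamp_eq1 t : 1 <= t -> clamp t = 1.
Proof. by move=> t1; rewrite /clamp min_l// max_r. Qed.

Lemma clamp_eq0 t : t <= 0 -> clamp t = 0.
Proof. by move=> t0; rewrite /clamp min_r ?(le_trans t0)// max_l. Qed.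

(** Continuous approximations of the indicator of the interval from 0 to z;
    they vanish at the origin, so that a mass discarded there is not seen. *)
Definition bump (k : nat) (z x : R) : R :=
  clamp (k%:R * x - 1) * clamp (1 - k%:R * (x - z)).

Lemma continuous_bump k z : continuous (bump k z).
Proof.
have h (f : R -> R) : continuous f -> continuous (fun x => clamp (f x)).
  move=> cf x; exact: (continuous_comp (cf x) (@continuous_clamp (f x))).
have k1 : continuous (fun x : R => k%:R * x - 1 : R).
  move=> x; apply: cvgB; last exact: cvg_cst.
  by apply: cvgM; [exact: cvg_cst|exact: cvg_id].
have k2 : continuous (fun x : R => 1 - k%:R * (x - z) : R).
  move=> x; apply: cvgB; first exact: cvg_cst.
  by apply: cvgM; [exact: cvg_cst|apply: cvgB; [exact: cvg_id|exact: cvg_cst]].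
move=> x; apply: cvgM; [exact: (h _ k1)|exact: (h _ k2)].
Qed.

Lemma bump_ge0 k z x : 0 <= bump k z x.
Proof. by rewrite mulr_ge0 ?clamp_ge0. Qed.

Lemma bump_le1 k z x : bump k z x <= 1.
Proof. by rewrite mulr_ile1 ?clamp_ge0 ?clamp_le1. Qed.

Lemma bump_norm_le1 k z x : `|bump k z x| <= 1.
Proof. by rewrite ger0_norm ?bump_ge0 ?bump_le1. Qed.

Lemma bump_eq0 k z x : k%:R * x <= 1 -> bump k z x = 0.
Proof. by move=> kx; rewrite /bump clamp_eq0 ?mul0r// subr_le0. Qed.

Lemma bump_cvg (z x : R) : 0 < x -> bump k z x @[k --> \oo] --> (\1_(`]0, z]) x : R).
Proof.
move=> x0.
have big (y : R) : 0 < y -> \forall k \near \oo, 2 <= k%:R * y.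
  move=> y0; near=> k; rewrite -ler_pdivrMr//.
  by near: k; exact: nbhs_infty_ger.
apply: cvg_near_cst; have [xz|zx] := leP x z.
  near=> k; rewrite /bump clamp_eq1 ?clamp_eq1 ?mulr1 ?indicE ?mem_set//= ?in_itv/= ?x0//.
    by rewrite -[leLHS]subr0 lerD2l lerN2 mulr_ge0_le0// subr_le0.
  rewrite lerBrDr; near: k; exact: big.
near=> k; rewrite /bump [X in _ * X]clamp_eq0 ?mulr0 ?indicE ?memNset//= ?in_itv/= ?x0/=.
  by apply/negP; rewrite -ltNge.
rewrite subr_le0 (@le_trans _ _ 2)// ?ler1n//; near: k; apply: big.
by rewrite subr_gt0.
Unshelve. all: by end_near. Qed.

Lemma pairing_bump_cvg mu (g : R -> R) (C z : R) :
  measurable_fun (`]0, +oo[%classic : set R) g -> (forall x, 0 < x -> `|g x| <= C) ->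
  pairing mu (fun x => g x * bump k z x) @[k --> \oo] -->
  pairing mu (fun x => g x * \1_(`]0, z]) x).
Proof.
move=> mg gC; apply: (@bounded_cvg _ _ _ (LS mu) _ _ (LS_0y_fin mu) _ _ C) => //.
- move=> n; apply: measurable_funM; first exact: mg.
  apply: measurable_funTS; exact: (continuous_measurable_fun (@continuous_bump n z)).
- move=> n x; rewrite /= in_itv/= andbT => x0; rewrite normrM.
  by rewrite -[leRHS]mulr1 ler_pM ?gC ?bump_norm_le1.
- move=> x; rewrite /= in_itv/= andbT => x0; apply: cvgM; first exact: cvg_cst.
  exact: bump_cvg.
Qed.

Lemma pairing_indic mu z : pairing mu (\1_(`]0, z])) = mu z.
Proof.
transitivity (fine (mu z)%:E) => //; rewrite -LS_0x; congr fine.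
rewrite -/(EFin \o _) integral_indic//; congr (LS mu _).
by apply: setIidl => x /=; rewrite !in_itv/= andbT => /andP[].
Qed.

Lemma pairing_bump_dist mu z : pairing mu (bump k z) @[k --> \oo] --> mu z.
Proof.
rewrite -pairing_indic.
have m1 : measurable_fun (`]0, +oo[%classic : set R) (cst (1 : R)) by exact: measurable_cst.
have := @pairing_bump_cvg mu (cst 1) 1 z m1.
rewrite (_ : (fun x => _ * _) = \1_(`]0, z])); last by apply/funext => x; rewrite mul1r.
rewrite (_ : (fun k => _) = (fun k => pairing mu (bump k z))).
  by apply => x _; rewrite normr1.
by apply/funext => k; congr pairing; apply/funext => x; rewrite mul1r.
Qed.

Lemma left_limit_bump (X : R -> dist_fun R) s nu k z : left_limit X s nu ->
  pairing (X t) (bump k z) @[t --> s^'-] --> pairing nu (bump k z).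
Proof.
move=> [c [_ h]]; have := h _ (@continuous_bump k z).
rewrite bump_eq0 ?mulr0 ?addr0//; apply.
by exists 1 => x; exact: bump_norm_le1.
Qed.

Lemma left_limit_ext (X Y : R -> dist_fun R) r s nu : r < s ->
  (forall t, r < t -> t < s -> X t = Y t) -> left_limit X s nu -> left_limit Y s nu.
Proof.
move=> rs XY [c [c0 h]]; exists c; split; [exact: c0|move=> f cf bf].
apply: cvg_trans (h f cf bf); apply: near_eq_cvg; near=> t.
have rt : r < t by near: t; exact: nbhs_left_gt.
have ts : t < s by near: t; exact: nbhs_left_lt.
by rewrite XY.
Unshelve. all: by end_near. Qed.

(** The test functions [bump] vanish at 0 and determine a distribution
    function, whatever mass the left limit leaves at 0. *)
Lemma left_limit_unique (X Y : R -> dist_fun R) r s nu nu' :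
  r < s -> (forall t, r < t -> t < s -> X t = Y t) ->
  left_limit X s nu -> left_limit Y s nu' -> nu = nu'.
Proof.
move=> rs XY h h'; apply: dist_fun_ext => z.
have e k : pairing nu (bump k z) = pairing nu' (bump k z).
  have h1 := left_limit_bump (k := k) (z := z) (left_limit_ext rs XY h).
  have h2 := left_limit_bump (k := k) (z := z) h'.
  by move/cvg_lim : h1 => <- //; move/cvg_lim : h2 => <-.
have h1 := @pairing_bump_dist nu z; have h2 := @pairing_bump_dist nu' z.
have e1 : limn (fun k => pairing nu (bump k z)) = nu z by exact/cvg_lim.
have e2 : limn (fun k => pairing nu' (bump k z)) = nu' z by exact/cvg_lim.
have ef : (fun k => pairing nu (bump k z)) = (fun k => pairing nu' (bump k z)).
  by apply/funext => k; exact: e.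
by move: e1; rewrite ef => e1; exact: etrans (esym e1) e2.
Qed.

Lemma measurable_fun_discrete d d' (T : measurableType d) (T' : measurableType d')
    (kappa : T -> int) (g : int -> T') (D : set T) :
  (forall k, measurable (D `&` kappa @^-1` [set k])) ->
  measurable_fun D (fun x => g (kappa x)).
Proof.
move=> mk mD B mB.
have -> : D `&` (fun x => g (kappa x)) @^-1` B =
  \bigcup_(k in [set: int]) (if pselect (B (g k)) then D `&` kappa @^-1` [set k] else set0).
  apply/seteqP; split => x.
    by move=> [Dx Bx]; exists (kappa x) => //; case: pselect.
  by move=> [k _]; case: pselect => //= Bk [Dx kx]; split => //; rewrite /= kx.
apply: countable_bigcupT_measurable => // k.
by case: pselect => //= _; exact: mk.
Qed.

Lemma measurable_ceil_fiber (c : R) (k : int) : 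
  measurable [set s : R | Num.ceil (c * s) = k].
Proof.
have mc : measurable_fun setT (fun s : R => c * s) by apply: measurable_funM.
have -> : [set s : R | Num.ceil (c * s) = k] =
   setT `&` (fun s => c * s) @^-1` `](k - 1)%:~R, k%:~R]%classic.
  by apply/seteqP; split => s /=; rewrite in_itv/= -ceil_eq; [move=> ->|move=> [_ /eqP]].
exact: mc.
Qed.

Lemma left_grid_cvg (s : R) :
  (Num.ceil (n.+1%:R * s) - 1)%:~R / n.+1%:R @[n --> \oo] --> s.
Proof.
apply: (@squeeze_cvgr _ _ _ _ (fun n => s - n.+1%:R^-1) (cst s)); last exact: cvg_cst.
  apply: nearW => n; have /andP[h1 h2] := ceil_itv (n.+1%:R * s).
  rewrite ler_pdivlMr// ler_pdivrMr// mulrBl mulVf// (mulrC s).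
  by move: h1 h2; rewrite intrB => h1 h2; apply/andP; split; lra.
rewrite -[X in _ --> X]subr0; apply: cvgB; first exact: cvg_cst.
exact: cvg_harmonic.
Qed.

Lemma left_grid_lt (s : R) n : (Num.ceil (n.+1%:R * s) - 1)%:~R / n.+1%:R < s.
Proof.
by have /andP[h1 _] := ceil_itv (n.+1%:R * s); rewrite ltr_pdivrMr// (mulrC s).
Qed.

(** The left limit at s is the limit of the values of X at the points of a grid
    that approach s strictly from the left; for each mesh these are step functions
    of s. *)
Lemma left_limit_measurable (X Xl : R -> dist_fun R) (T z : R) :
  (forall s, 0 < s -> s <= T -> left_limit X s (Xl s)) ->
  measurable_fun `]0, T] (fun s => Xl s z).
Proof.
move=> h.
apply: (@measurable_fun_cvg _ _ _ _ (fun k s => pairing (Xl s) (bump k z))); last first.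
  by move=> s _; exact: pairing_bump_dist.
move=> k.
pose grid n (s : R) := (Num.ceil (n.+1%:R * s) - 1)%:~R / n.+1%:R : R.
apply: (@measurable_fun_cvg _ _ _ _ (fun n s => pairing (X (grid n s)) (bump k z))); last first.
  move=> s; rewrite /= in_itv/= => /andP[s0 sT].
  have /cvg_at_leftP := left_limit_bump (k:=k) (z:=z) (h s s0 sT); apply; split.
    by move=> n; exact: left_grid_lt.
  exact: left_grid_cvg.
move=> n.
have := @measurable_fun_discrete _ _ R R (fun s : R => Num.ceil (n.+1%:R * s))
  (fun j : int => pairing (X ((j - 1)%:~R / n.+1%:R)) (bump k z)) `]0, T]%classic.
apply => j.
by apply: measurableI => //; exact: measurable_ceil_fiber.
Qed.

End left_limits.

(** * Particle systems moving left at unit speed *)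

Section particles.
Context {R : realType}.
Variable Lam : {measure set (R * R)%type -> \bar R}.

(** A pair is a particle with its times of birth and death: a particle alive
    at time t sits at the distance of t from its death. *)
Definition particles_upto (T : R) : set (R * R) := [set p | p.1 <= T /\ 0 < p.2].

Lemma ind1 (T : Type) (A : set T) x : A x -> \1_A x = 1 :> R.
Proof. by move=> Ax; rewrite indicE mem_set. Qed.

Lemma ind0 (T : Type) (A : set T) x : ~ A x -> \1_A x = 0 :> R.
Proof. by move=> Ax; rewrite indicE memNset. Qed.

Lemma measurable_fst_preimage (S : set R) : measurable S ->
  measurable [set p : R * R | S p.1].
Proof.
move=> mS; have := @measurable_fst _ _ R R measurableT S mS.
by rewrite setTI.
Qed.

Lemma measurable_snd_preimage (S : set R) : measurable S ->
  measurable [set p : R * R | S p.2].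
Proof.
move=> mS; have := @measurable_snd _ _ R R measurableT S mS.
by rewrite setTI.
Qed.

Lemma measurable_particles (S S' : set R) : measurable S -> measurable S' ->
  measurable [set p : R * R | S p.1 /\ S' p.2].
Proof.
move=> mS mS'; apply: measurableI; first exact: measurable_fst_preimage.
exact: measurable_snd_preimage.
Qed.

Lemma measurable_alive (S : set R) (t : R) : measurable S ->
  measurable [set p : R * R | S p.1 /\ t < p.2].
Proof.
move=> mS; have -> : [set p : R * R | S p.1 /\ t < p.2] =
    [set p | S p.1 /\ `]t, +oo[%classic p.2].
  by apply/seteqP; split => p /=; rewrite in_itv/= andbT.
exact: measurable_particles.
Qed.

Lemma measurable_particles_upto T : measurable (particles_upto T).
Proof.
rewrite /particles_upto (_ : mkset _ = [set p : R * R | `]-oo, T]%classic p.1 /\ 0 < p.2]).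
  exact: measurable_alive.
by apply/seteqP; split => p /=; rewrite in_itv.
Qed.

Variable T : R.
Hypothesis Lfin : (Lam (particles_upto T) < +oo)%E.

(** The empirical measure at time t of the particles born at times of S is an
    image of the particle measure; particles born outside S are sent to -1,
    where they do not count. *)
Lemma pairing_particles (S : set R) (t : R) (nu : dist_fun R) (f : R -> R) (C : R) :
  measurable S -> S `<=` `]-oo, T]%classic -> 0 <= t ->
  (forall x, 0 < x -> (nu x)%:E = Lam [set p | S p.1 /\ t < p.2 <= t + x]) ->
  measurable_fun [set: R] f -> (forall x, `|f x| <= C) ->
  pairing nu f = \int[Lam]_(p in particles_upto T)
     (f (p.2 - t) * \1_[set p : R * R | S p.1 /\ t < p.2] p).
Proof.
move=> mS ST t0 hnu mf fC.
have mal := measurable_alive t mS.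
pose phi (p : R * R) : measurableTypeR R := if p \in [set p : R * R | S p.1] then p.2 - t else -1.
have phiE' : phi = (fun p => \1_[set p : R * R | S p.1] p * (p.2 - t + 1) - 1).
  by apply/funext => p; rewrite /phi indicE; case: ifPn => _; rewrite /= ?mul1r ?mul0r ?addrK ?sub0r.
have mphi : measurable_fun [set: R * R] phi.
  rewrite phiE'; apply: (@measurable_funB _ _ R) => //; apply: measurable_funM.
    by apply: measurable_indic; exact: measurable_fst_preimage.
  by apply: measurable_funD => //; apply: measurable_funB.
pose push_phi := [the measure _ _ of pushforward Lam phi].
pose nuP := push_phi mphi.
have phiE p : (phi p > 0) = (p \in [set p : R * R | S p.1 /\ t < p.2]).
  rewrite /phi; case: ifPn => [|/negP]; rewrite inE/= => Sp.
    by apply/idP/idP; rewrite inE/= subr_gt0 // => -[].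
  rewrite ltNge lerN10/=; apply/esym/negbTE/negP; rewrite inE/= => -[Sp' _].
  by apply: Sp.
have nuE : forall A : set R, measurable A -> A `<=` `]0, +oo[%classic -> LS nu A = nuP A.
  apply: LS_eq => x x0; rewrite hnu//; congr (Lam _).
  apply/seteqP; split => p /=; rewrite in_itv/= phiE.
    move=> [Sp /andP[tp px]]; rewrite mem_set//= /phi mem_set//=.
    by rewrite lerBlDl.
  move=> /andP[]; rewrite inE/= => -[Sp tp]; rewrite /phi mem_set//= lerBlDl => ->.
  by rewrite tp.
rewrite /pairing /Rintegral.
rewrite (@eq_measure_integral _ _ _ _ nuP); last by move=> A mA A0; exact: nuE.
have preE : phi @^-1` `]0, +oo[%classic = [set p : R * R | S p.1 /\ t < p.2].
  by apply/seteqP; split => p /=; rewrite in_itv/= andbT phiE inE.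
have sub : [set p : R * R | S p.1 /\ t < p.2] `<=` particles_upto T.
  by move=> p [/ST]; rewrite /= in_itv/= => pT tp; split=> //; exact: le_lt_trans tp.
have finS : (Lam [set p : R * R | S p.1 /\ (t < p.2)%R] < +oo)%E.
  by apply: le_lt_trans Lfin; apply: le_measure; rewrite ?inE//; exact: measurable_particles_upto.
rewrite (@integral_pushforward _ _ _ (measurableTypeR R) R phi mphi Lam) //=; first last.
- rewrite preE; apply: (@bounded_integrable _ _ _ Lam _ mal finS (f \o phi) C) => //; last by move=> p _; exact: fC.
  by apply: measurable_funTS; apply: (@measurableT_comp _ _ _ _ R _ f) => //.
- exact/measurable_EFinP.
rewrite preE -[X in (\int[_]_(x in X) _)%E](setIidr sub) integral_mkcondr.
congr fine; apply: eq_integral => p _; rewrite patchE indicE.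
case: ifPn => /= pS; last by rewrite mulr0.
rewrite mulr1 /phi; move: pS; rewrite inE/= => -[Sp _].
by rewrite mem_set.
Qed.

Variable X : R -> dist_fun R.
Hypothesis hX : forall t, 0 <= t -> t <= T -> forall x, 0 < x ->
  (X t x)%:E = Lam [set p | p.1 <= t /\ t < p.2 <= t + x].

(** Dominated convergence: just after t the particles alive are those alive at t,
    except newborn particles and particles about to die, and both sets decrease
    to the empty set. *)
Lemma particles_right_continuous t : 0 <= t -> t < T -> weak_right_continuous X t.
Proof.
move=> t0 tT f cf [C fC]; apply/cvg_at_rightP => u [ut uc].
pose v n := Num.min (u n) T.
have vt n : t < v n by rewrite /v lt_min ut tT.
have vT n : v n <= T by rewrite /v ge_min lexx orbT.
have mf := continuous_measurable_fun cf.
have XE s : 0 <= s -> s <= T -> pairing (X s) f = \int[Lam]_(p in particles_upto T)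
   (f (p.2 - s) * \1_[set p : R * R | `]-oo, s]%classic p.1 /\ s < p.2] p).
  move=> s0 sT; apply: (pairing_particles (C := C)) => //.
    by apply: subset_itvl; rewrite bnd_simp.
  move=> x x0; rewrite hX//; congr (Lam _); apply/seteqP; split => p /=; by rewrite in_itv.
have uv : \forall n \near \oo, v n = u n.
  have : \forall n \near \oo, u n < T by apply: (cvgr_lt t).
  by apply: filterS => n unT; rewrite /v min_l// ltW.
have vc : v n @[n --> \oo] --> t.
  by apply: cvg_trans uc; apply: near_eq_cvg; apply: filterS uv => n ->.
apply: (@cvg_trans _ (pairing (X (v n)) f @[n --> \oo])).
  by apply: near_eq_cvg; apply: filterS uv => n ->.
rewrite XE ?(ltW tT)//; under eq_fun do rewrite XE ?(ltW (le_lt_trans t0 (vt _)))//.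
apply: (@bounded_cvg _ _ _ Lam _ (measurable_particles_upto T) Lfin _ _ C).
- move=> n; apply: measurable_funTS; apply: measurable_funM; last by apply: measurable_indic; apply: measurable_alive.
  apply: measurableT_comp => //; apply: measurable_funB => //.
- move=> n p _; rewrite normrM -[leRHS]mulr1 ler_pM// indicE.
  by rewrite ger0_norm// lern1 leq_b1.
- move=> p _; apply: cvgM.
    apply: (@cvg_comp _ _ _ (fun n => p.2 - v n) f _ (nbhs (p.2 - t))); last exact: cf.
    by apply: cvgB => //; exact: cvg_cst.
  apply: cvg_near_cst.
  have [p1|p1] := leP p.1 t; last first.
    have : \forall n \near \oo, v n < p.1 by apply: (cvgr_lt t).
    apply: filterS => n vp; rewrite !indicE !memNset//= in_itv/= => -[].
      by rewrite leNgt p1.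
    by rewrite leNgt vp.
  have [p2|p2] := ltP t p.2.
    have : \forall n \near \oo, v n < p.2 by apply: (cvgr_lt t).
    apply: filterS => n vp; rewrite !indicE !mem_set//= in_itv/=; split => //.
    by rewrite (le_trans p1)// ltW.
  apply: nearW => n; rewrite !indicE !memNset//= in_itv/= => -[_].
    by rewrite ltNge p2.
  by rewrite ltNge (le_trans p2)// ltW.
Qed.

(** Just before s the particles that die at time s are still alive and sit close
    to 0: in the limit they become the mass discarded at 0. *)
Lemma particles_left_limit s (nu : dist_fun R) : 0 < s -> s <= T ->
  (forall x, 0 < x -> (nu x)%:E = Lam [set p | p.1 < s /\ s < p.2 <= s + x]) ->
  left_limit X s nu.
Proof.
move=> s0 sT hnu.
pose Z := [set p : R * R | `]-oo, s[%classic p.1 /\ [set s] p.2].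
have mZ : measurable Z by exact: measurable_particles.
exists (fine (Lam Z)); split; first exact: fine_ge0.
move=> f cf [C fC]; apply/cvg_at_leftP => u [ut uc].
pose v n := Num.max (u n) 0.
have vs n : v n < s by rewrite /v gt_max ut s0.
have v0 n : 0 <= v n by rewrite /v le_max lexx orbT.
have mf := continuous_measurable_fun cf.
have XE t : 0 <= t -> t <= T -> pairing (X t) f = \int[Lam]_(p in particles_upto T)
   (f (p.2 - t) * \1_[set p : R * R | `]-oo, t]%classic p.1 /\ t < p.2] p).
  move=> t0 tT; apply: (pairing_particles (C := C)) => //.
    by apply: subset_itvl; rewrite bnd_simp.
  move=> x x0; rewrite hX//; congr (Lam _); apply/seteqP; split => p /=; by rewrite in_itv.
have nuE : pairing nu f = \int[Lam]_(p in particles_upto T)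
   (f (p.2 - s) * \1_[set p : R * R | `]-oo, s[%classic p.1 /\ s < p.2] p).
  apply: (pairing_particles (C := C)) => [||| x x0||] //.
  - by apply: subset_itvl; rewrite bnd_simp.
  - exact: ltW.
  - by rewrite hnu//; congr (Lam _); apply/seteqP; split => p /=; rewrite in_itv.
have ZE : fine (Lam Z) * f 0 = \int[Lam]_(p in particles_upto T) (f (p.2 - s) * \1_Z p).
  transitivity (\int[Lam]_(p in particles_upto T) (f 0 * \1_Z p)).
    have sub : Z `<=` particles_upto T.
      move=> p [/= + ps2]; rewrite in_itv/= => ps; split => /=; last by rewrite ps2.
      by rewrite ltW// (lt_le_trans ps).
    rewrite RintegralZl//; last first.
    - apply: (@bounded_integrable _ _ _ _ _ _ Lfin _ 1).
      + exact: measurable_particles_upto.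
      + exact: measurable_indic.
      + by move=> p _; rewrite indicE ger0_norm// lern1 leq_b1.
    - exact: measurable_particles_upto.
    rewrite mulrC; congr (_ * _).
    rewrite /Rintegral -/(EFin \o _) integral_indic//; last exact: measurable_particles_upto.
    by rewrite setIidl.
  apply: eq_Rintegral => p _; rewrite indicE.
  case: (boolP (p \in Z)); last by rewrite !mulr0.
  by rewrite inE => -[_ ->]; rewrite subrr.
have uv : \forall n \near \oo, v n = u n.
  have : \forall n \near \oo, 0 < u n by apply: (cvgr_gt s).
  by apply: filterS => n unT; rewrite /v max_l// ltW.
have vc : v n @[n --> \oo] --> s.
  by apply: cvg_trans uc; apply: near_eq_cvg; apply: filterS uv => n ->.
apply: (@cvg_trans _ (pairing (X (v n)) f @[n --> \oo])).
  by apply: near_eq_cvg; apply: filterS uv => n ->.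
have mfs : measurable_fun [set: R * R] (fun p : R * R => f (p.2 - s)).
  by apply: measurableT_comp => //; apply: measurable_funB.
have I1 (S : set (R * R)) : measurable S -> Lam.-integrable (particles_upto T)
    (EFin \o (fun p => f (p.2 - s) * \1_S p)).
  move=> mS; apply: (@bounded_integrable _ _ _ _ _ (measurable_particles_upto T) Lfin _ C).
    by apply: measurable_funTS; apply: measurable_funM => //; exact: measurable_indic.
  move=> p _; rewrite normrM -[leRHS]mulr1 ler_pM// indicE.
  by rewrite ger0_norm// lern1 leq_b1.
rewrite nuE ZE -RintegralD//; [|exact: measurable_particles_upto|by apply: I1; apply: measurable_alive|exact: I1].
under eq_fun do rewrite XE ?(le_trans (ltW (vs _)) sT)//.
apply: (@bounded_cvg _ _ _ Lam _ (measurable_particles_upto T) Lfin _ _ C).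
- move=> n; apply: measurable_funTS; apply: measurable_funM; last by apply: measurable_indic; apply: measurable_alive.
  by apply: measurableT_comp => //; apply: measurable_funB.
- move=> n p _; rewrite normrM -[leRHS]mulr1 ler_pM// indicE.
  by rewrite ger0_norm// lern1 leq_b1.
- move=> p _; rewrite -mulrDr; apply: cvgM.
    apply: (@cvg_comp _ _ _ (fun n => p.2 - v n) f _ (nbhs (p.2 - s))); last exact: cf.
    by apply: cvgB => //; exact: cvg_cst.
  apply: cvg_near_cst.
  have [p1|p1] := ltP p.1 s; last first.
    apply: nearW => n; rewrite !ind0 ?addr0// => -[/=]; rewrite in_itv/=.
    - by rewrite ltNge p1.
    - by rewrite ltNge p1.
    - by rewrite leNgt (lt_le_trans (vs n)).
  have [p2|p2|p2] := ltgtP s p.2.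
  - have : \forall n \near \oo, p.1 < v n by apply: (cvgr_gt s).
    apply: filterS => n vp; rewrite (@ind0 _ Z) ?addr0; last first.
      by move=> -[_ /= ps]; move: p2; rewrite ps ltxx.
    rewrite !ind1//=.
    by rewrite in_itv/= ltW//; split => //; exact: lt_trans p2.
  - have : \forall n \near \oo, p.2 < v n by apply: (cvgr_gt s).
    apply: filterS => n vp; rewrite !ind0 ?addr0//= => -[_].
    + by move=> ps; move: p2; rewrite ps ltxx.
    + by move=> h; move: (lt_trans h p2); rewrite ltxx.
    + by move=> h; move: (lt_trans h vp); rewrite ltxx.
  - have : \forall n \near \oo, p.1 < v n by apply: (cvgr_gt s).
    apply: filterS => n vp; have zE : \1_Z p = 1 :> R by rewrite indicE mem_set//=; split => //=; rewrite in_itv/=.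
    rewrite zE (@ind0 _ [set p0 | `]-oo, s[%classic _ /\ _]); last first.
      by move=> [_]; rewrite -p2 ltxx.
    by rewrite add0r indicE mem_set//=; split => /=; rewrite ?in_itv/= ?ltW// -p2.
Qed.

End particles.

(** * Measurability of the acceptance region *)

Section kernel_of_dist_fun.
Context {R : realType} d (T : measurableType d).
Variable K : T -> dist_fun R.
Hypothesis mK : forall x, measurable_fun [set: T] (fun w => K w x).

Lemma measurable_LS (U : set R) : measurable U ->
  measurable_fun [set: T] (fun w => LS (K w) U).
Proof.
pose H := [set U : set R | measurable U /\
  measurable_fun [set: T] (fun w => LS (K w) U)].
suff h : (@measurable _ (measurableTypeR R)) `<=` H by move=> /h[].
apply: (@lambda_system_subset _ (@ocitv R)) => //.
- exact: ocitvI.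
- split => //.
  + split; first exact: measurableT.
    apply: (@emeasurable_fun_cvg _ _ _ _ (fun n w => (K w n%:R)%:E)).
      by move=> n; exact/measurable_EFinP.
    by move=> w _; rewrite LS_itv0y// setTI; exact: LS_0y_cvg.
  + move=> A B BA [mA hA] [mB hB]; split; first exact: measurableD.
    rewrite (_ : (fun w => _) = (fun w => LS (K w) A - LS (K w) B)%E).
      exact: emeasurable_funB.
    by apply/funext => w; rewrite measureD ?setIidr//; exact: LS_finite.
  + move=> F ndF hF; have mF i : measurable (F i) by case: (hF i).
    split; first exact: bigcup_measurable.
    apply: (@emeasurable_fun_cvg _ _ _ _ (fun n w => LS (K w) (F n))).
      by move=> n; case: (hF n).
    have mUF : measurable (\bigcup_i F i) by apply: bigcup_measurable => i _; exact: mF.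
    by move=> w _; apply: (@nondecreasing_cvg_mu _ _ _ (LS (K w))).
- move=> _ [[a b] _ <-]/=; split; first by [].
  have [ba|ab] := leP b a.
    rewrite set_itv_ge ?bnd_simp -?leNgt//.
    by under eq_fun do rewrite measure0; exact: measurable_cst.
  under eq_fun do rewrite LS_oc ?(ltW ab)//.
  by apply/measurable_EFinP; apply: measurable_funB.
Qed.

Lemma measurable_pairing (f : R -> R) :
  measurable_fun (`]0, +oo[%classic : set R) f -> (forall x, 0 < x -> 0 <= f x) ->
  measurable_fun [set: T] (fun w => pairing (K w) f).
Proof.
move=> mf f0; apply: measurableT_comp; first exact: fine_measurable.
under eq_fun do rewrite integral_mkcond.
apply: (@measurable_fun_integral_kernel _ _ T (measurableTypeR R) R (fun w => LS (K w))).
- by move=> U mU; exact: measurable_LS.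
- move=> x; rewrite patchE; case: ifPn => //; rewrite inE/= in_itv/= andbT => x0.
  by rewrite lee_fin f0.
- apply/(@measurable_restrict _ _ (measurableTypeR R)) => //.
  by rewrite setTI; apply/measurable_EFinP.
Qed.

End kernel_of_dist_fun.

Section comparisons.
Context {R : realType}.

Lemma measurable_le_set d (T : measurableType d) (f g : T -> R) :
  measurable_fun [set: T] f -> measurable_fun [set: T] g -> measurable [set w | f w <= g w].
Proof.
move=> mf mg; rewrite -[X in measurable X]setTI.
exact: (@measurable_fun_ler _ _ R setT f g mf mg measurableT [set true]).
Qed.

Lemma measurable_lt_set d (T : measurableType d) (f g : T -> R) :
  measurable_fun [set: T] f -> measurable_fun [set: T] g -> measurable [set w | f w < g w].
Proof.
move=> mf mg; rewrite -[X in measurable X]setTI.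
exact: (@measurable_fun_ltr _ _ R setT f g mf mg measurableT [set true]).
Qed.

End comparisons.

Section acceptance.
Context {R : realType}.
Variables (alpha : R -> R) (p : R -> nat -> R).
Hypotheses (h_alpha : C1_pos alpha) (h_p : forall i, C1_pos (p ^~ i)).

Lemma C1_pos_measurable (f : R -> R) : C1_pos f ->
  measurable_fun (`]0, +oo[%classic : set R) f.
Proof.
move=> [_ _ cf _ _]; apply: open_continuous_measurable_fun.
  exact: interval_open.
by move=> x; rewrite inE/= in_itv/= andbT => x0; exact: cf.
Qed.

Definition alpha_upto (z x : R) : R := alpha x * \1_(`]0, z]) x.

Lemma measurable_alpha_upto z :
  measurable_fun (`]0, +oo[%classic : set R) (alpha_upto z).
Proof.
apply: measurable_funM; first exact: C1_pos_measurable.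
by apply: measurable_indic.
Qed.

Lemma alpha_ge0 x : 0 < x -> 0 <= alpha x.
Proof. by case: h_alpha => h _ _ _ _; exact: h. Qed.

Lemma alpha_upto_ge0 z x : 0 < x -> 0 <= alpha_upto z x.
Proof. by move=> x0; rewrite mulr_ge0 ?alpha_ge0. Qed.

Lemma pairing_integrable (mu : dist_fun R) (f : R -> R) C :
  measurable_fun (`]0, +oo[%classic : set R) f ->
  (forall x, 0 < x -> `|f x| <= C) ->
  (LS mu).-integrable `]0, +oo[%classic (EFin \o f).
Proof.
move=> mf fC; apply: (@bounded_integrable _ _ _ (LS mu) _ _ (LS_0y_fin mu) _ C) => //.
by move=> x; rewrite /= in_itv/= andbT; exact: fC.
Qed.

Lemma alpha_bounded : exists2 C, 0 <= C & forall x, 0 < x -> `|alpha x| <= C.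
Proof.
case: h_alpha => _ [C hC] _ _ _; exists (Num.max 0 C); first by rewrite le_max lexx.
by move=> x x0; rewrite le_max hC// orbT.
Qed.

Lemma pairing_alpha_upto_nd mu z z' : z <= z' ->
  pairing mu (alpha_upto z) <= pairing mu (alpha_upto z').
Proof.
move=> zz; have [C C0 hC] := alpha_bounded.
have I z0 : (LS mu).-integrable `]0, +oo[%classic (EFin \o alpha_upto z0).
  apply: (@pairing_integrable _ _ C); first exact: measurable_alpha_upto.
  move=> x x0; rewrite normrM -[leRHS]mulr1 ler_pM ?hC//.
  by rewrite indicE ger0_norm// lern1 leq_b1.
apply: le_Rintegral => //.
move=> x; rewrite /= in_itv/= andbT => x0; rewrite ler_wpM2l ?alpha_ge0//.
rewrite !indicE ler_nat; case: (boolP (x \in `]0, z']%classic)) => //.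
  by rewrite leq_b1.
move=> /negP; rewrite inE/= in_itv/= x0/= => h.
by rewrite memNset//= in_itv/= x0/= => /le_trans => /(_ _ zz).
Qed.

(** Rational thresholds suffice because the mass of alpha up to z increases with
    z. The quantile thus becomes measurable jointly in the measure and the level. *)
Lemma A_quantile_lt mu y (a : R) : (A_quantile alpha mu y < a%:E)%E <->
  exists q : rat, [/\ 0 <= ratr q :> R, ratr q < a &
     pairing mu alpha * y < pairing mu (alpha_upto (ratr q))].
Proof.
split.
  move=> /ereal_inf_lt[_ [z [z0 hz] <-]]; rewrite lte_fin => za.
  have [q] := rat_in_itvoo za; rewrite in_itv/= => /andP[zq qa].
  exists q; split => //; first by rewrite (le_trans z0)// ltW.
  by apply: lt_le_trans hz _; apply: pairing_alpha_upto_nd; exact: ltW.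
move=> [q [q0 qa hq]]; apply: (@le_lt_trans _ _ (ratr q)%:E); last by rewrite lte_fin.
by apply: ereal_inf_lbound; exists (ratr q).
Qed.

Definition accepts (mu : dist_fun R) (u y : R) (n : nat) (v : R) : Prop :=
  0 < u <= pairing mu alpha /\ 0 < v <= p_ext p (A_quantile alpha mu y) n.

Lemma accepts_bounds mu u y n v : accepts mu u y n v ->
  0 < u <= pairing mu alpha /\ 0 < v <= p_ext p (A_quantile alpha mu y) n.
Proof. by []. Qed.

Section measurability.
Context d (T : measurableType d).
Variable K : T -> dist_fun R.
Hypothesis mK : forall x, measurable_fun [set: T] (fun w => K w x).

Lemma measurable_A_quantile (y : T -> R) : measurable_fun [set: T] y ->
  measurable_fun [set: T] (fun w => A_quantile alpha (K w) (y w)).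
Proof.
move=> my; apply: (measurability _ (ErealGenInftyO.measurableE R)) => //= _ [_ [a ->]] <-.
rewrite setTI (_ : _ @^-1` _ = \bigcup_(q in [set: rat])
  if (0 <= ratr q :> R) && (ratr q < a) then
   [set w | pairing (K w) alpha * y w < pairing (K w) (alpha_upto (ratr q))] else set0).
  apply: countable_bigcupT_measurable => // q; case: ifPn => // _.
  rewrite -[X in measurable X]setTI; apply: (@measurable_fun_ltr _ _ R setT
    (fun w => pairing (K w) alpha * y w) (fun w => pairing (K w) (alpha_upto (ratr q))) _ _ _ [set true]) => //.
    apply: measurable_funM => //; apply: (measurable_pairing mK).
      exact: C1_pos_measurable.
    by move=> x; exact: alpha_ge0.
  apply: (measurable_pairing mK); first exact: measurable_alpha_upto.
  by move=> x; exact: alpha_upto_ge0.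
apply/seteqP; split => w /=; rewrite in_itv/=.
  by move=> /A_quantile_lt[q [q0 qa h]]; exists q => //; rewrite q0 qa.
move=> [q _]; case: ifPn => // /andP[q0 qa] h.
by apply/A_quantile_lt; exists q.
Qed.

Lemma measurable_p_ext (n : nat) (a : T -> \bar R) : measurable_fun [set: T] a ->
  measurable_fun [set: T] (fun w => p_ext p (a w) n).
Proof.
move=> ma.
rewrite (_ : (fun w => _) = (fun x : R => ((p ^~ n) \_ `]0, +oo[%classic) x) \o (fine \o a)).
  apply: measurableT_comp; last by apply: measurableT_comp => //; exact: fine_measurable.
  apply/measurable_restrict => //; rewrite setTI.
  exact: (C1_pos_measurable (h_p n)).
apply/funext => w /=; rewrite patchE.
have h0 : (0 : R) \in `]0, +oo[%classic = false.
  by apply/negbTE/negP; rewrite inE/= in_itv/= ltxx.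
case: (a w) => [r||] /=; rewrite ?h0//.
case: ifPn => r0; first by rewrite mem_set//= in_itv/= r0.
by rewrite memNset//= in_itv/= andbT; exact/negP.
Qed.

Lemma measurable_accepts (u y v : T -> R) (n : T -> nat) :
  measurable_fun [set: T] u -> measurable_fun [set: T] y ->
  measurable_fun [set: T] v -> measurable_fun [set: T] n ->
  measurable [set w | accepts (K w) (u w) (y w) (n w) (v w)].
Proof.
move=> mu my mv mn.
rewrite (_ : mkset _ = [set w | 0 < u w] `&` [set w | u w <= pairing (K w) alpha] `&`
  \bigcup_(k in [set: nat]) ([set w | n w = k] `&` [set w | 0 < v w] `&`
    [set w | v w <= p_ext p (A_quantile alpha (K w) (y w)) k])); last first.
  apply/seteqP; split => w /=.
    by move=> [/andP[u0 uK] /andP[v0 vp]]; split => //; exists (n w).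
  by move=> [[u0 uK] [k _ [[<- v0] vp]]]; split; apply/andP.
apply: measurableI.
  apply: measurableI; first by apply: measurable_lt_set.
  apply: measurable_le_set => //; apply: (measurable_pairing mK).
    exact: C1_pos_measurable.
  by move=> x; exact: alpha_ge0.
apply: bigcup_measurable => k _; apply: measurableI.
  apply: measurableI; last by apply: measurable_lt_set.
  have := mn measurableT [set k]; rewrite setTI; exact.
by apply: measurable_le_set => //; apply: measurable_p_ext; exact: measurable_A_quantile.
Qed.

End measurability.
End acceptance.

(** * The birth integral as a particle measure *)

Section noise_points.
Context {R : realType}.
Implicit Types (q : noise_pt R).

Definition qs q : R := q.1.1.1.
Definition qu q : R := q.1.1.2.
Definition qy q : R := q.1.2.1.1.
Definition qn q : nat := q.1.2.1.2.
Definition qz q (i : nat) : R := (q.1.2.2 : nat -> R) i.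
Definition qv q : R := q.2.

Lemma measurable_qs : measurable_fun [set: noise_pt R] qs.
Proof.
apply: (@measurableT_comp _ _ _ _ _ _ fst) => //.
by apply: (@measurableT_comp _ _ _ _ _ _ fst).
Qed.

Lemma measurable_qu : measurable_fun [set: noise_pt R] qu.
Proof.
apply: (@measurableT_comp _ _ _ _ _ _ snd) => //.
by apply: (@measurableT_comp _ _ _ _ _ _ fst).
Qed.

Lemma measurable_qmark : measurable_fun [set: noise_pt R] (fun q => q.1.2).
Proof. by apply: (@measurableT_comp _ _ _ _ _ _ snd). Qed.

Lemma measurable_qy : measurable_fun [set: noise_pt R] qy.
Proof.
apply: (@measurableT_comp _ _ _ _ _ _ fst) => //.
apply: (@measurableT_comp _ _ _ _ _ _ fst) => //.
exact: measurable_qmark.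
Qed.

Lemma measurable_qn : measurable_fun [set: noise_pt R] qn.
Proof.
apply: (@measurableT_comp _ _ _ _ _ _ snd) => //.
apply: (@measurableT_comp _ _ _ _ _ _ fst) => //.
exact: measurable_qmark.
Qed.

Lemma measurable_coord (i : nat) : measurable_fun [set: zseq R] (fun z : zseq R => (z : nat -> R) i).
Proof.
move=> _ B mB; rewrite setTI; apply: sub_sigma_algebra.
by exists i, B.
Qed.

Lemma measurable_qz i : measurable_fun [set: noise_pt R] (qz ^~ i).
Proof.
apply: (@measurableT_comp _ _ _ _ _ _ (fun z : zseq R => (z : nat -> R) i)).
  exact: measurable_coord.
apply: (@measurableT_comp _ _ _ _ _ _ snd) => //.
exact: measurable_qmark.
Qed.

Lemma measurable_qv : measurable_fun [set: noise_pt R] qv.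
Proof. exact: measurable_snd. Qed.

Lemma measurable_qs_le t : measurable [set q : noise_pt R | qs q <= t].
Proof. by apply: measurable_le_set; [exact: measurable_qs|exact: measurable_cst]. Qed.

Lemma measurable_qs_lt t : measurable [set q : noise_pt R | qs q < t].
Proof. by apply: measurable_lt_set; [exact: measurable_qs|exact: measurable_cst]. Qed.

Lemma measurable_qs_gt t : measurable [set q : noise_pt R | t < qs q].
Proof. by apply: measurable_lt_set; [exact: measurable_cst|exact: measurable_qs]. Qed.

Lemma measurable_qn_set (B : set nat) : measurable [set q : noise_pt R | B (qn q)].
Proof. have := @measurable_qn measurableT B; rewrite setTI; exact. Qed.

Lemma measurable_qmarkE : measurable [set q : noise_pt R | markE q.1.2].
Proof.
have -> : [set q : noise_pt R | markE q.1.2] =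
   [set q | 0 < qy q] `&` [set q | qy q <= 1] `&` \bigcap_i [set q | 0 < qz q i].
  apply/seteqP; split => q; rewrite /markE/=.
    by move=> [/andP[y0 y1] z0]; split => // i _; exact: z0.
  by move=> [[y0 y1] z0]; split; [exact/andP|move=> i; exact: z0].
apply: measurableI; first apply: measurableI.
- by apply: measurable_lt_set; [exact: measurable_cst|exact: measurable_qy].
- by apply: measurable_le_set; [exact: measurable_qy|exact: measurable_cst].
- apply: bigcap_measurable => // i _.
  by apply: measurable_lt_set; [exact: measurable_cst|exact: measurable_qz].
Qed.

Lemma noise_domE : noise_dom (R := R) =
  [set q | [/\ 0 < qs q, 0 < qu q, markE q.1.2 & 0 < qv q <= 1]].
Proof. by apply/seteqP; split => -[[[s u] w] v]. Qed.

Lemma measurable_noise_dom : measurable (noise_dom (R := R)).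
Proof.
rewrite noise_domE (_ : mkset _ = [set q | 0 < qs q] `&` [set q | 0 < qu q] `&`
  [set q | markE q.1.2] `&` [set q | 0 < qv q] `&` [set q | qv q <= 1]).
  apply: measurableI; first (apply: measurableI; first (apply: measurableI; first apply: measurableI)).
  - exact: measurable_qs_gt.
  - by apply: measurable_lt_set; [exact: measurable_cst|exact: measurable_qu].
  - exact: measurable_qmarkE.
  - by apply: measurable_lt_set; [exact: measurable_cst|exact: measurable_qv].
  - by apply: measurable_le_set; [exact: measurable_qv|exact: measurable_cst].
apply/seteqP; split => q /=; first by move=> [? ? ? /andP[]].
by move=> [[[[? ?] ?] ?] ?]; split => //; exact/andP.
Qed.

End noise_points.

Definition image_measure d d' (T1 : measurableType d) (T2 : measurableType d')
    (R : realType) (m : {measure set T1 -> \bar R}) (f : T1 -> T2)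
    (mf : measurable_fun [set: T1] f) : {measure set T2 -> \bar R} :=
  measure_function_pushforward__canonical__measure_function_Measure m mf.

Section off_null.
Context d (T : measurableType d) (R : realType) (P : {measure set T -> \bar R}).

Lemma measure_eq_off_null (N E E' : set T) : measurable N -> P N = 0%E ->
  measurable E -> measurable E' -> (forall w, ~ N w -> (E w <-> E' w)) -> P E = P E'.
Proof.
move=> mN PN mE mE' h; apply/eqP; rewrite eq_le; apply/andP; split.
  rewrite -[leRHS]adde0 -PN; apply: (@le_trans _ _ (P (E' `|` N))); last exact: measureU2.
  apply: le_measure; rewrite ?inE//; first exact: measurableU.
  by move=> w Ew; have [?|n] := pselect (N w); [right|left; apply/h].
rewrite -[leRHS]adde0 -PN; apply: (@le_trans _ _ (P (E `|` N))); last exact: measureU2.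
apply: le_measure; rewrite ?inE//; first exact: measurableU.
by move=> w Ew; have [?|n] := pselect (N w); [right|left; apply/h].
Qed.

End off_null.

Section births.
Context {R : realType}.
Implicit Types (m : {measure set (noise_pt R) -> \bar R}) (A : set (noise_pt R)).

Definition child_alive (i : nat) (t x : R) : set (noise_pt R) :=
  [set q | [/\ qs q <= t, (i < qn q)%N & t < qs q + qz q i <= t + x]].

Lemma measurable_child (S : set (R * R)) i : measurable S ->
  measurable [set q : noise_pt R | (i < qn q)%N /\ S (qs q, qs q + qz q i)].
Proof.
move=> mS; apply: measurableI; first exact: (measurable_qn_set [set n | (i < n)%N]).
have mf : measurable_fun [set: noise_pt R] (fun q => (qs q, qs q + qz q i)).
  apply: measurable_fun_pair; first exact: measurable_qs.
  by apply: measurable_funD; [exact: measurable_qs|exact: measurable_qz].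
by have := mf measurableT S mS; rewrite setTI.
Qed.

Lemma measurable_child_alive i t x : measurable (child_alive i t x).
Proof.
have -> : child_alive i t x = [set q | (i < qn q)%N /\
   [set p : R * R | `]-oo, t]%classic p.1 /\ `]t, t + x]%classic p.2] (qs q, qs q + qz q i)].
  by apply/seteqP; split => q; rewrite /child_alive /= !in_itv/=; [case|move=> [? []]].
by apply: measurable_child; exact: measurable_particles.
Qed.

(** The births split child by child, which turns the integral of the sum over the
    children into a sum of masses of sets of atoms. *)
Definition births m A (t x : R) : \bar R :=
  (\sum_(0 <= i <oo) m (A `&` child_alive i t x))%E.

Variable X0 : dist_fun R.

Section particle_measure.
Variables (m : {measure set (noise_pt R) -> \bar R}) (A : set (noise_pt R)).
Hypothesis mA : measurable A.

(** Each atom of A with n children gives n particles; the other pairs of an atom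
    and an index are sent to a particle that dies before time 0. *)
Definition child (i : nat) (q : noise_pt R) : R * R :=
  if q \in A `&` [set q | (i < qn q)%N] then (qs q, qs q + qz q i) else (0, -1).

Lemma measurable_fun_child i : measurable_fun [set: noise_pt R] (child i).
Proof.
move=> _ B mB; rewrite setTI.
have mAi : measurable (A `&` [set q | (i < qn q)%N]).
  by apply: measurableI => //; exact: (measurable_qn_set [set n | (i < n)%N]).
have -> : child i @^-1` B = (A `&` [set q | (i < qn q)%N /\ B (qs q, qs q + qz q i)]) `|`
    (if pselect (B (0, -1)) then ~` (A `&` [set q | (i < qn q)%N]) else set0).
  apply/seteqP; split => q; rewrite /child /=.
    case: ifPn => [|/negP]; rewrite inE/=; first by move=> [Aq iq] Bq; left.
    by move=> nq B1; right; case: pselect.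
  move=> [[Aq [iq Bq]]|]; first by rewrite mem_set.
  by case: pselect => //= B1 nq; rewrite memNset.
apply: measurableU; first by apply: measurableI => //; exact: measurable_child.
by case: pselect => //= _; exact: measurableC.
Qed.

Let init_fun (y : measurableTypeR R) : R * R := (0, y).

Let measurable_init_fun : measurable_fun [set: measurableTypeR R] init_fun.
Proof. by apply: measurable_fun_pair. Qed.

(** The individuals of X0 are born at time 0 and die at the time of their initial
    position. *)
Definition particle_measure : {measure set (R * R)%type -> \bar R} :=
  measure_add (image_measure (LS X0) measurable_init_fun)
    (mseries (fun i => image_measure m (measurable_fun_child i)) 0).

Lemma particle_measureE (U : set (R * R)) : measurable U ->
  U `<=` [set p | 0 < p.2] ->
  particle_measure U = (LS X0 [set y | U (0%R, y)] +
    \sum_(0 <= i <oo) m (A `&` [set q | (i < qn q)%N /\ U (qs q, (qs q + qz q i)%R)]))%E.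
Proof.
move=> mU U0; apply: etrans (measure_addE _ _ _) _; congr (_ + _)%E.
apply: eq_eseriesr => i _; congr (m _); apply/seteqP; split => q /=.
  rewrite /child; case: ifPn => [|_ /U0/=]; last by rewrite ltNge lerN10.
  by rewrite inE/= => -[Aq iq] Uq.
by move=> [Aq [iq Uq]]; rewrite /child mem_set.
Qed.

Lemma particle_measure_alive t x : 0 <= t -> 0 < x ->
  particle_measure [set p | p.1 <= t /\ t < p.2 <= t + x] =
  ((X0 (x + t) - X0 t)%:E + births m A t x)%E.
Proof.
move=> t0 x0; rewrite particle_measureE.
- rewrite (_ : [set y | _] = `]t, x + t]%classic).
    rewrite LS_oc ?lerDr ?(ltW x0)//; congr (_ + _)%E.
    apply: eq_eseriesr => i _; congr (m _); congr (_ `&` _).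
    by apply/seteqP; split => q; rewrite /child_alive /=; [move=> [? []]|case].
  by apply/seteqP; split => y /=; rewrite in_itv/= (addrC t); [case|move=> ->].
- have -> : [set p : R * R | p.1 <= t /\ t < p.2 <= t + x] =
    [set p : R * R | `]-oo, t]%classic p.1 /\ `]t, t + x]%classic p.2].
    by apply/seteqP; split => q /=; rewrite !in_itv.
  exact: measurable_particles.
- by move=> p /= [_ /andP[tp _]]; exact: le_lt_trans tp.
Qed.

End particle_measure.
End births.

(** * Pathwise uniqueness *)

Section dist_fun_zero.
Context {R : realType}.

Lemma dist_fun_zero_exists : exists mu : dist_fun R, forall x, mu x = 0.
Proof.
have [|mu hmu] := @dist_fun_of_measure R mzero; first by rewrite /mzero ltry.
exists mu => x; have [x0|x0] := leP x 0; first exact: dist_le0.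
by apply: EFin_inj; rewrite hmu.
Qed.

Definition dist_fun_zero : dist_fun R := projT1 (cid dist_fun_zero_exists).

Lemma dist_fun_zeroE x : dist_fun_zero x = 0.
Proof. exact: (projT2 (cid dist_fun_zero_exists)). Qed.

End dist_fun_zero.

Section pathwise.
Context {R : realType}.
Variables (alpha : R -> R) (p : R -> nat -> R).
Hypotheses (h_alpha : C1_pos alpha) (h_p : forall i, C1_pos (p ^~ i)).
Hypothesis p_le1 : forall a n, p_ext p a n <= 1.
Implicit Types (Xl : R -> dist_fun R) (D : set (noise_pt R)).
Implicit Types (m : {measure set (noise_pt R) -> \bar R}).

Definition region Xl : set (noise_pt R) := [set q | [/\ 0 < qs q, markE q.1.2 &
  accepts alpha p (Xl (qs q)) (qu q) (qy q) (qn q) (qv q)]].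

Lemma region_noise_dom Xl : region Xl `<=` noise_dom (R := R).
Proof.
rewrite noise_domE => q [s0 mq [/andP[u0 _] /andP[v0 vp]]]; split => //.
by rewrite v0 (le_trans vp).
Qed.

(** The integrand is a finite sum of indicators, one for each child; extended by
    zeros to a series it can be integrated term by term. *)
Lemma birth_integralE m Xl t x : measurable (region Xl `&` [set q | qs q <= t]) ->
  birth_integral alpha p m Xl t x = births m (region Xl) t x.
Proof.
move=> mr; rewrite /birth_integral.
rewrite (_ : [set q | _] = region Xl `&` [set q | qs q <= t]); last first.
  apply/seteqP; split => -[[[s u] [[y n] z]] v] /=; rewrite /region /accepts/=.
    by move=> [/andP[s0 st] u0 mq v0]; split.
  by move=> [[s0 mq [u0 v0]] st]; split => //; exact/andP.
pose b i (q : noise_pt R) : bool := ((i < qn q)%N && (t < qs q + qz q i <= t + x)).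
transitivity (\int[m]_(q in region Xl `&` [set q : noise_pt R | (qs q <= t)%R])
    (\sum_(0 <= i <oo) (\1_[set q : noise_pt R | b i q] q : R)%:E)%E)%E.
  apply: eq_integral => -[[[s u] [[y n] z]] v] _ /=.
  transitivity (\sum_(0 <= i < n) (\1_[set q | b i q] (s, u, (y, n, z), v) : R)%:E)%E.
    rewrite sumEFin big_mkord; congr (_%:E); apply: eq_bigr => i _.
    rewrite indicE /= (_ : _ \in _ = b i (s, u, (y, n, z), v)); last first.
      by apply/idP/idP; rewrite inE.
    rewrite /b /qn /qs /qz /= ltn_ord /=; congr (nat_of_bool _)%:R.
    by apply/idP/idP => /andP[h1 h2]; apply/andP; split; lra.
  apply/esym/cvg_lim => //; apply: cvg_near_cst; near=> N.
  rewrite (@big_cat_nat _ _ _ n)//=; last by near: N; exact: nbhs_infty_ge.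
  rewrite [X in (_ + X)%E]big_nat_cond [X in (_ + X)%E]big1 ?adde0//.
  move=> i; rewrite andbT => /andP[ni _]; rewrite indicE memNset//=.
  by rewrite /b /qn /= ltnNge ni.
have mb i : measurable [set q | b i q].
  have -> : [set q | b i q] = [set q | (i < qn q)%N /\
     [set e : R * R | setT e.1 /\ `]t, t + x]%classic e.2] (qs q, qs q + qz q i)].
    by apply/seteqP; split => q; rewrite /b /= in_itv/=; [move=> /andP[]|move=> [-> [_ ->]]].
  by apply: measurable_child; exact: measurable_particles.
rewrite integral_nneseries//; last first.
  by move=> i; apply/measurable_EFinP; exact: measurable_indic.
apply: eq_eseriesr => i _; rewrite integral_indic//; congr (m _).
apply/seteqP; split => q /=; rewrite /child_alive /b/=.
  by move=> [/andP[? ?] [? ?]]; split.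
by move=> [rq [st iq xq]]; split; [exact/andP|].
Unshelve. all: by end_near. Qed.

(** The equation localized in time and in the space of atoms. Restricting the noise
    to a set of finite mass makes schemes available, and letting the set vary
    makes the schemes of different boxes comparable. *)
Definition path_solution m D (X0 : dist_fun R) T (X Xl : R -> dist_fun R) : Prop :=
  [/\ forall t, 0 <= t -> t < T -> weak_right_continuous X t,
      forall s, 0 < s -> s <= T -> left_limit X s (Xl s) &
      forall t x, 0 <= t -> t <= T -> 0 < x -> (X t x)%:E =
        ((X0 (x + t) - X0 t)%:E + births m (region Xl `&` D) t x)%E].

Opaque accepts.

Lemma sol_eq m D X0 T X Xl t x : path_solution m D X0 T X Xl ->
  0 <= t -> t <= T -> 0 < x ->
  (X t x)%:E = ((X0 (x + t) - X0 t)%:E + births m (region Xl `&` D) t x)%E.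
Proof. by case=> _ _ + t0 tT x0; exact. Qed.

Lemma measurable_region Xl T :
  (forall x, measurable_fun (`]0, T]%classic : set R) (fun s => Xl s x)) ->
  measurable (region Xl `&` [set q | qs q <= T]).
Proof.
move=> mXl.
pose K s := if s \in (`]0, T]%classic : set R) then Xl s else dist_fun_zero.
have mK x : measurable_fun [set: R] (fun s => K s x).
  have -> : (fun s => K s x) = (fun s => Xl s x) \_ `]0, T]%classic.
    by apply/funext => s; rewrite /K patchE; case: ifPn => // _; exact: dist_fun_zeroE.
  by apply/measurable_restrict => //; rewrite setTI.
have -> : region Xl `&` [set q | qs q <= T] =
  [set q | 0 < qs q] `&` [set q | qs q <= T] `&` [set q | markE q.1.2] `&`
  [set q | accepts alpha p (K (qs q)) (qu q) (qy q) (qn q) (qv q)].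
  apply/seteqP; split => q; rewrite /region /=.
    by move=> [[s0 mq a] sT]; rewrite /K mem_set//= in_itv/= s0.
  by move=> [[[s0 sT] mq]]; rewrite /K mem_set//=; last by rewrite in_itv/= s0.
apply: measurableI; first (apply: measurableI; first apply: measurableI).
- exact: measurable_qs_gt.
- exact: measurable_qs_le.
- exact: measurable_qmarkE.
- apply: (@measurable_accepts _ _ _ h_alpha h_p _ _ (fun q => K (qs q))).
  + by move=> x; apply: (measurableT_comp (mK x)); exact: measurable_qs.
  + exact: measurable_qu.
  + exact: measurable_qy.
  + exact: measurable_qv.
  + exact: measurable_qn.
Qed.

Lemma births_upto m A A' t x : A `&` [set q | qs q <= t] = A' `&` [set q | qs q <= t] ->
  births m A t x = births m A' t x.
Proof.
move=> AA; apply: eq_eseriesr => i _; congr (m _).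
have e : child_alive i t x = [set q | qs q <= t] `&` child_alive i t x.
  by rewrite setIidr// => q [].
by rewrite e !setIA AA.
Qed.

Section one_solution.
Variables (m : {measure set (noise_pt R) -> \bar R}) (D : set (noise_pt R)).
Hypothesis mD : measurable D.
Hypothesis m_lt1 : forall B, measurable B -> B `<=` D -> (m B < 1)%E -> m B = 0%E.
Variables (X0 : dist_fun R) (T : R) (X Xl : R -> dist_fun R).
Hypothesis sol : path_solution m D X0 T X Xl.

Lemma measurable_sol_region : measurable (region Xl `&` D `&` [set q | qs q <= T]).
Proof.
rewrite -setIA (setIC D) setIA; apply: measurableI => //.
apply: measurable_region => x; case: sol => _ h _; exact: left_limit_measurable h.
Qed.

Let A := region Xl `&` D `&` [set q | qs q <= T].
Let Lam := particle_measure X0 m measurable_sol_region.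

Lemma sol_Lam t x : 0 <= t -> t <= T -> 0 < x ->
  (X t x)%:E = Lam [set e | e.1 <= t /\ t < e.2 <= t + x].
Proof.
move=> t0 tT x0; rewrite particle_measure_alive//; case: sol => _ _ -> //.
congr (_ + _)%E; apply: births_upto; rewrite /A; apply/seteqP; split => q /=.
  by move=> [Aq qt]; split => //; split => //; exact: le_trans tT.
by move=> [[Aq _] qt].
Qed.

Let alive t := [set e : R * R | e.1 <= t /\ t < e.2].

Let mlive t t' : measurable [set e : R * R | e.1 <= t /\ t' < e.2].
Proof.
have -> : [set e : R * R | e.1 <= t /\ t' < e.2] = [set e | `]-oo, t]%classic e.1 /\ t' < e.2].
  by apply/seteqP; split => e /=; rewrite in_itv.
exact: measurable_alive.
Qed.

Lemma sol_mass t : 0 <= t -> t <= T -> LS (X t) `]0%R, +oo[%classic = Lam (alive t).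
Proof.
move=> t0 tT.
have h1 := @LS_0y_cvg _ (X t).
have XLam : (fun n => (X t n%:R)%:E) = (fun n => Lam [set e | e.1 <= t /\ t < e.2 <= t + n%:R]).
  apply/funext => -[|n]; last by rewrite sol_Lam.
  rewrite dist_le0// (_ : [set _ | _] = set0) ?measure0//.
  by apply/seteqP; split => e //= [_]; rewrite addr0 => /andP[/lt_le_trans h /h]; rewrite ltxx.
have h2 : Lam [set e | e.1 <= t /\ t < e.2 <= t + n%:R] @[n --> \oo] --> Lam (alive t).
  have -> : alive t = \bigcup_n [set e | e.1 <= t /\ t < e.2 <= t + n%:R].
    apply/seteqP; split => e /=; last by move=> [n _ [? /andP[? _]]].
    move=> [et te]; exists (Num.truncn (e.2 - t)).+1 => //; split => //; rewrite te/=.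
    by rewrite addrC -lerBlDr ltW// truncnS_gt.
  apply: nondecreasing_cvg_mu.
  - move=> n; have -> : [set e : R * R | e.1 <= t /\ t < e.2 <= t + n%:R] =
      [set e | `]-oo, t]%classic e.1 /\ `]t, t + n%:R]%classic e.2].
      by apply/seteqP; split => e' /=; rewrite !in_itv.
    exact: measurable_particles.
  - have -> : \bigcup_n [set e : R * R | e.1 <= t /\ t < e.2 <= t + n%:R] = [set e | e.1 <= t /\ t < e.2].
      apply/seteqP; split => e' /=; first by move=> [n _ [? /andP[? _]]].
      move=> [et te]; exists (Num.truncn (e'.2 - t)).+1 => //; split => //; rewrite te/=.
      by rewrite addrC -lerBlDr ltW// truncnS_gt.
    exact: mlive.
  - move=> n k nk; apply/subsetPset => e' /= [-> /andP[-> h]]; split => //=.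
    by rewrite (le_trans h)// lerD2l ler_nat.
by rewrite XLam in h1; exact: (cvg_unique _ h1 h2).
Qed.

Lemma sol_alive_fin t : 0 <= t -> t <= T -> (Lam (alive t) < +oo)%E.
Proof. by move=> t0 tT; rewrite -sol_mass//; exact: LS_0y_fin. Qed.

(** Right-continuity of the total mass forbids births immediately after a
    time tau. The mass at time r of the children born in the interval from tau
    to r tends to 0, and the mass of a set of atoms is 0 as soon as it is less than 1. *)
Lemma no_birth_right tau : 0 <= tau -> tau < T -> exists2 e : R, 0 < e &
  m (A `&` [set q | [/\ tau < qs q, qs q < tau + e & (0 < qn q)%N]]) = 0%E.
Proof.
move=> tau0 tauT.
pose J r := [set e : R * R | tau < e.1 <= r /\ r < e.2].
have mJ r : measurable (J r).
  have -> : J r = [set e | `]tau, r]%classic e.1 /\ r < e.2].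
    by apply/seteqP; split => e /=; rewrite in_itv.
  exact: measurable_alive.
have hJ : \forall r \near tau^'+, (Lam (J r) < 1)%E.
  have mass1 r : pairing (X r) (cst 1) = fine (LS (X r) `]0%R, +oo[%classic).
    by rewrite /pairing (@Rintegral_cst _ _ _ (LS (X r)))// mul1r.
  have h1 : pairing (X r) (cst 1) @[r --> tau^'+] --> pairing (X tau) (cst 1).
    case: sol => h _ _; apply: h => //; first by move=> x; exact: cvg_cst.
    by exists 1 => x; rewrite normr1.
  have h2 : X tau (r - tau) @[r --> tau^'+] --> X tau 0.
    apply/cvg_at_rightP => u [ut uc].
    have := cumulative_is_right_continuous (dist_cumulative (X tau)) 0.
    move/cvg_at_rightP; apply; split; first by move=> n; rewrite subr_gt0.
    by rewrite -(subrr tau); apply: cvgB => //; exact: cvg_cst.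
  have h3 : pairing (X r) (cst 1) - pairing (X tau) (cst 1) + X tau (r - tau)
      @[r --> tau^'+] --> (0 : R).
    rewrite -[0](_ : pairing (X tau) (cst 1) - pairing (X tau) (cst 1) + X tau 0 = 0).
      by apply: cvgD; [apply: cvgB; [exact: h1|exact: cvg_cst]|exact: h2].
    by rewrite subrr add0r dist_le0.
  have h4 : \forall r \near tau^'+, 
      pairing (X r) (cst 1) - pairing (X tau) (cst 1) + X tau (r - tau) < 1.
    by apply: (cvgr_lt (0 : R)); [exact: h3|exact: ltr01].
  near=> r.
  have tr : tau < r by near: r; exact: nbhs_right_gt.
  have rT : r <= T by near: r; exact: nbhs_right_le.
  have r0 : 0 <= r by rewrite ltW// (le_lt_trans tau0).
  have h5 : pairing (X r) (cst 1) - pairing (X tau) (cst 1) + X tau (r - tau) < 1.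
    by near: r; exact: h4.
  move: h5; rewrite !mass1 => h5.
  have a1 : alive r = [set e | e.1 <= tau /\ r < e.2] `|` J r.
    apply/seteqP; split => e /=.
      by move=> [er re]; case: (leP e.1 tau) => et; [left|right]; split => //; rewrite et.
    by move=> [[et re]|[/andP[te er] re]]; split => //; rewrite (le_trans et)// ltW.
  have a2 : alive tau = [set e | e.1 <= tau /\ r < e.2] `|` [set e | e.1 <= tau /\ tau < e.2 <= tau + (r - tau)].
    apply/seteqP; split => e /=.
      move=> [er re]; case: (ltP r e.2) => et; [left|right]; split => //.
      by rewrite re/= addrC subrK.
    by move=> [[et re]|[et /andP[te re]]]; split => //; rewrite (lt_trans tr).
  have f1 := sol_alive_fin r0 rT; have f2 := sol_alive_fin tau0 (ltW tauT).
  have f3 : (Lam [set e : R * R | (e.1 <= tau)%R /\ (r < e.2)%R] < +oo)%E.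
    apply: le_lt_trans f1; apply: le_measure; rewrite ?inE; [exact: mlive|exact: mlive|].
    by move=> e [et re]; split => //; rewrite (le_trans et)// ltW.
  have f4 : (Lam (J r) < +oo)%E.
    apply: le_lt_trans f1; apply: le_measure; rewrite ?inE; [exact: mJ|exact: mlive|].
    by rewrite a1; right.
  have e1 : LS (X r) `]0%R, +oo[%classic = (Lam [set e : R * R | (e.1 <= tau)%R /\ (r < e.2)%R] + Lam (J r))%E.
    rewrite sol_mass// a1; apply: measureU; [exact: mlive|exact: mJ|].
    apply/seteqP; split => e //= [[et _] [/andP[te _] _]].
    by move: (le_lt_trans et te); rewrite ltxx.
  have e2 : LS (X tau) `]0%R, +oo[%classic = (Lam [set e : R * R | (e.1 <= tau)%R /\ (r < e.2)%R] + (X tau (r - tau))%:E)%E.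
    rewrite sol_Lam ?subr_gt0 ?(ltW tauT)// sol_mass ?(ltW tauT)// a2; apply: measureU.
    - exact: mlive.
    - have -> : [set e : R * R | e.1 <= tau /\ tau < e.2 <= tau + (r - tau)] =
        [set e | `]-oo, tau]%classic e.1 /\ `]tau, tau + (r - tau)]%classic e.2].
        by apply/seteqP; split => e' /=; rewrite !in_itv.
      exact: measurable_particles.
    - apply/seteqP; split => e //= [[_ re] [_ /andP[_]]].
      by rewrite addrC subrK leNgt re.
  move: h5; rewrite e1 e2 !fineD ?ge0_fin_numE ?ltry ?lee_fin ?dist_pos//=.
  rewrite opprD addrACA subrr add0r addrNK => h5.
  by rewrite -[Lam (J r)]fineK ?ge0_fin_numE// lte_fin.
have [e /= e0 he] := hJ.
exists (Num.min e (T - tau)); first by rewrite lt_min e0 subr_gt0.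
pose B (k : rat) := A `&` [set q | [/\ tau < qs q, qs q <= ratr k, ratr k < tau + Num.min e (T - tau), (0 < qn q)%N & ratr k < qs q + qz q 0]].
have mB k : measurable (B k).
  apply: measurableI; first exact: measurable_sol_region.
  have -> : [set q : noise_pt R | [/\ tau < qs q, qs q <= ratr k, ratr k < tau + Num.min e (T - tau), (0 < qn q)%N & ratr k < qs q + qz q 0]] =
    [set q | (0 < qn q)%N /\ [set e' : R * R | (`]tau, ratr k] : set R)%classic e'.1 /\
       [set x | ratr k < x /\ ratr k < tau + Num.min e (T - tau)] e'.2] (qs q, qs q + qz q 0)].
    apply/seteqP; split => q /=; rewrite in_itv/=.
      by move=> [-> -> ? ? ?].
    by move=> [? [/andP[? ?] [? ?]]]; split.
  apply: measurable_child; apply: measurable_particles => //.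
  apply: measurableI; last first.
    have [h|h] := pselect (ratr k < tau + Num.min e (T - tau)).
      by rewrite [X in measurable X](_ : _ = setT)//; apply/seteqP; split.
    by rewrite [X in measurable X](_ : _ = set0)//; apply/seteqP; split.
  by rewrite [X in measurable X](_ : _ = `]ratr k, +oo[%classic)//; apply/seteqP; split => x /=; rewrite in_itv/= andbT.
have B0 k : m (B k) = 0%E.
  have [kt|kt] := ltP (ratr k) (tau + Num.min e (T - tau)); last first.
    rewrite (_ : B k = set0) ?measure0//; apply/seteqP; split => q //= [_ [_ _ + _ _]].
    by rewrite ltNge kt.
  have [tk|tk] := ltP tau (ratr k); last first.
    rewrite (_ : B k = set0) ?measure0//; apply/seteqP; split => q //= [_ [ts sk _ _ _]].
    by move: (lt_le_trans ts (le_trans sk tk)); rewrite ltxx.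
  apply: m_lt1 => //; first by move=> q [[[_ ?] _] _].
  apply: (@le_lt_trans _ _ (Lam (J (ratr k)))); last first.
    apply: he => //=; rewrite ltr0_norm ?subr_lt0// opprB ltrBlDr addrC.
    by apply: (lt_le_trans kt); rewrite lerD2l ge_min lexx.
  rewrite /Lam particle_measureE//; last first.
    by move=> e' [_]; apply: lt_trans; exact: le_lt_trans tk.
  have mAJ i : measurable (A `&` [set q | (i < qn q)%N /\ J (ratr k) (qs q, (qs q + qz q i)%R)]).
    by apply: measurableI; [exact: measurable_sol_region|exact: measurable_child].
  have hB : (m (B k) <= m (A `&` [set q | (0 < qn q)%N /\ J (ratr k) (qs q, (qs q + qz q 0)%R)]))%E.
    apply: le_measure; rewrite ?inE//.
    by move=> q [Aq [? ? ? ? ?]]; split => //=; split => //; split => //=; exact/andP.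
  apply: (le_trans hB); apply: le_trans; last by apply: leeDr.
  apply: le_trans; last apply: (@nneseries_lim_ge R (fun i => m (A `&` [set q | (i < qn q)%N /\ J (ratr k) (qs q, (qs q + qz q i)%R)])) xpredT 0 1).
    by rewrite big_nat1.
  by move=> i _ _; exact: measure_ge0.
set E := [set q | _].
have mE : measurable (A `&` E).
  apply: measurableI; first exact: measurable_sol_region.
  have -> : E = [set q | tau < qs q] `&` [set q | qs q < tau + Num.min e (T - tau)] `&` [set q | (0 < qn q)%N].
    by apply/seteqP; split => q; rewrite /E /=; [case|move=> [[]]].
  apply: measurableI; last exact: (measurable_qn_set [set n | (0 < n)%N]).
  by apply: measurableI; [exact: measurable_qs_gt|exact: measurable_qs_lt].
apply: measure_negligible => //.
pose B' n := if @choice.unpickle rat n is Some k then B k else set0.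
have null : m.-negligible (\bigcup_n B' n).
  apply: negligible_bigcup => n; rewrite /B'; case: choice.unpickle => [k|]; last exact: negligible_set0.
  by exists (B k); split.
apply: negligibleS null => q [Aq [tq qe n0]].
have z0 : 0 < qz q 0 by case: Aq => -[[_ [_ h] _] _] _; exact: h.
have : qs q < Num.min (tau + Num.min e (T - tau)) (qs q + qz q 0).
  by rewrite lt_min qe ltrDl z0.
move=> /rat_in_itvoo[k]; rewrite in_itv/= lt_min => /andP[qk /andP[ke kz]].
have Bk : B k q by split; [exact: Aq|split; [exact: tq|exact: ltW|exact: ke|exact: n0|exact: kz]].
exists (choice.pickle k); first exact: I.
by rewrite /B' choice.pickleK; exact: Bk.
Unshelve. all: by end_near. Qed.

Lemma births_stop tau : 0 <= tau -> tau < T -> exists2 e : R, 0 < e &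
  forall t x, t < tau + e -> t <= T ->
    births m (region Xl `&` D) t x = births m (region Xl `&` D `&` [set q | qs q <= tau]) t x.
Proof.
move=> tau0 tauT; have [e e0 me] := no_birth_right tau0 tauT.
exists e => // t x te tT.
rewrite (@births_upto _ _ A); last first.
  rewrite /A; apply/seteqP; split => q /=; last by move=> [[]].
  by move=> [Aq qt]; split => //; split => //; exact: le_trans tT.
rewrite [RHS](@births_upto _ _ (A `&` [set q | qs q <= tau])); last first.
  rewrite /A; apply/seteqP; split => q /=; last by move=> [[[]]].
  by move=> [[Aq qt] qt']; split => //; split => //; split => //; exact: le_trans tT.
apply: eq_eseriesr => i _.
have mA := measurable_sol_region; rewrite -/A in mA.
have mc := measurable_child_alive i t x.
have mAt : measurable (A `&` [set q | qs q <= tau] `&` child_alive i t x).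
  by apply: measurableI => //; apply: measurableI => //; exact: measurable_qs_le.
set E := [set q | _] in me.
have mE : measurable (A `&` E).
  apply: measurableI => //.
  have -> : E = [set q | tau < qs q] `&` [set q | qs q < tau + e] `&` [set q | (0 < qn q)%N].
    by apply/seteqP; split => q; rewrite /E /=; [case|move=> [[]]].
  apply: measurableI; last exact: (measurable_qn_set [set n | (0 < n)%N]).
  by apply: measurableI; [exact: measurable_qs_gt|exact: measurable_qs_lt].
apply/eqP; rewrite eq_le; apply/andP; split; last first.
  apply: le_measure; rewrite ?inE//; first exact: measurableI.
  by move=> q [[]].
rewrite -[leRHS]adde0 -me.
apply: (@le_trans _ _ (m (A `&` [set q | qs q <= tau] `&` child_alive i t x `|` (A `&` E)))).
  apply: le_measure; rewrite ?inE; [exact: measurableI|exact: measurableU|].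
  move=> q [Aq cq]; have [qt|qt] := leP (qs q) tau; first by left.
  case: cq => qt' iq _; right; split => //; split => //.
    exact: le_lt_trans te.
  exact: leq_ltn_trans iq.
exact: measureU2.
Qed.

End one_solution.

(** Two solutions driven by the same atoms have the same left limits, hence the
    same births, up to and including the first time at which they could differ;
    and right after a time there is no birth. *)
Theorem path_unique m D (X0 : dist_fun R) T (X Xl Y Yl : R -> dist_fun R) :
  measurable D ->
  (forall B, measurable B -> B `<=` D -> (m B < 1)%E -> m B = 0%E) ->
  path_solution m D X0 T X Xl -> path_solution m D X0 T Y Yl ->
  forall t, 0 <= t -> t <= T -> X t = Y t.
Proof.
move=> mD m1 sX sY.
have birthE tau : (forall s, 0 <= s -> s < tau -> X s = Y s) -> tau <= T ->
    region Xl `&` D `&` [set q | qs q <= tau] = region Yl `&` D `&` [set q | qs q <= tau].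
  move=> XY tT; have lE s : 0 < s -> s <= tau -> Xl s = Yl s.
    move=> s0 st; case: sX => _ hX _; case: sY => _ hY _.
    apply: (@left_limit_unique _ X Y 0 s) => //.
    - by move=> t t0 ts; apply: XY; [exact: ltW|exact: lt_le_trans st].
    - by apply: hX => //; exact: le_trans tT.
    - by apply: hY => //; exact: le_trans tT.
  apply/seteqP; split => q /= [[[q0 mq a] Dq] qt]; have e := lE _ q0 qt.
    rewrite e in a; exact: conj (conj (And3 q0 mq a) Dq) qt.
  rewrite -e in a; exact: conj (conj (And3 q0 mq a) Dq) qt.
have stay tau : (forall s, 0 <= s -> s < tau -> X s = Y s) -> 0 <= tau -> tau <= T -> X tau = Y tau.
  move=> XY tau0 tauT; apply: dist_fun_ext => x.
  have [x0|x0] := leP x 0; first by rewrite !dist_le0.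
  apply: EFin_inj; rewrite (sol_eq sX tau0 tauT x0) (sol_eq sY tau0 tauT x0).
  have be := births_upto m x (birthE _ XY tauT).
  exact: (f_equal (fun b => ((X0 (x + tau) - X0 tau)%:E + b)%E) be).
have step tau : (forall s, 0 <= s -> s < tau -> X s = Y s) -> 0 <= tau -> tau < T ->
    exists2 e : R, 0 < e & forall t, 0 <= t -> t < tau + e -> t <= T -> X t = Y t.
  move=> XY tau0 tauT.
  have [e e0 he] := births_stop mD m1 sX tau0 tauT.
  have [e' e'0 he'] := births_stop mD m1 sY tau0 tauT.
  exists (Num.min e e'); first by rewrite lt_min e0.
  move=> t t0 te tT; apply: dist_fun_ext => x.
  have [x0|x0] := leP x 0; first by rewrite !dist_le0.
  apply: EFin_inj; rewrite (sol_eq sX t0 tT x0) (sol_eq sY t0 tT x0).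
  have te1 : t < tau + e by apply: (lt_le_trans te); rewrite lerD2l ge_min lexx.
  have te2 : t < tau + e' by apply: (lt_le_trans te); rewrite lerD2l ge_min lexx orbT.
  have be := f_equal (fun B => births m B t x) (birthE _ XY (ltW tauT)).
  have {}be := etrans (he _ x te1 tT) (etrans be (esym (he' _ x te2 tT))).
  exact: (f_equal (fun b => ((X0 (x + t) - X0 t)%:E + b)%E) be).
move=> t0 t00 t0T; apply: contrapT => XYt.
pose S := [set s | 0 <= s <= t0 /\ forall r, 0 <= r -> r <= s -> X r = Y r].
have S0 : S 0.
  split; first by rewrite lexx.
  move=> r r0 r0'; have -> : r = 0 by apply/eqP; rewrite eq_le r0 r0'.
  apply: stay => //; last exact: le_trans t0T.
  by move=> s s0; rewrite ltNge s0.
have Sub : ubound S t0 by move=> s [/andP[]].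
have hs : has_sup S by split; [exists 0|exists t0].
have tau0 : 0 <= sup S by apply: ub_le_sup => //; exists t0.
have taut : sup S <= t0 by apply: ge_sup => //; exists 0.
have XY s : 0 <= s -> s < sup S -> X s = Y s.
  by move=> s0 /(sup_gt _)[|r [_ hr] sr]; [exists 0|apply: hr => //; exact: ltW].
have tauE := stay _ XY tau0 (le_trans taut t0T).
have tt : sup S < t0.
  rewrite lt_neqAle taut andbT; apply/eqP => e; apply: XYt; by rewrite -e.
have [e e0 he] := step _ XY tau0 (lt_le_trans tt t0T).
have : S (Num.min (sup S + e / 2) t0).
  split.
    by rewrite le_min ge_min lexx orbT t00 !andbT addr_ge0// divr_ge0// ltW.
  move=> r r0; rewrite le_min => /andP[re rt]; apply: he => //; last exact: le_trans t0T.
  by apply: (le_lt_trans re); rewrite ltrD2l ltr_pdivrMr// ltr_pMr// ltr1n.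
move/(ub_le_sup (ex_intro _ t0 Sub)); rewrite leNgt lt_min tt andbT.
by rewrite ltrDl divr_gt0.
Qed.

End pathwise.

(** * The Euler scheme and its exactness *)

Section population.
Context {R : realType}.
Implicit Types (m : {measure set (noise_pt R) -> \bar R}) (A : set (noise_pt R)).

(** The integral over A of the number of children, by the layer-cake formula. *)
Definition brood m A : \bar R :=
  (\sum_(0 <= i <oo) m (A `&` [set q | (i < qn q)%N]))%E.

Lemma snapshot_exists (Lam : {measure set (R * R)%type -> \bar R}) (t : R) :
  (Lam [set e : R * R | (e.1 <= t)%R /\ (t < e.2)%R] < +oo)%E ->
  exists mu : dist_fun R, forall x, 0 < x ->
    (mu x)%:E = Lam [set e | e.1 <= t /\ t < e.2 <= t + x].
Proof.
move=> fin.
pose phi (e : R * R) : measurableTypeR R := \1_[set e : R * R | `]-oo, t]%classic e.1] e * (e.2 - t + 1) - 1.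
have mphi : measurable_fun [set: R * R] phi.
  apply: (@measurable_funB _ _ R) => //; apply: measurable_funM.
    by apply: measurable_indic; exact: measurable_fst_preimage.
  by apply: measurable_funD => //; apply: measurable_funB.
have phi1 e : e.1 <= t -> phi e = e.2 - t.
  by move=> et; rewrite /phi indicE mem_set/= ?in_itv//= mul1r addrK.
have phi0 e : ~ e.1 <= t -> phi e = -1.
  by move=> et; rewrite /phi indicE memNset/= ?in_itv//= mul0r sub0r.
have phiE e : (0 < phi e) -> e.1 <= t /\ phi e = e.2 - t.
  have [et _|et] := pselect (e.1 <= t); first by rewrite phi1.
  by rewrite phi0// ltNge lerN10.
have [|mu hmu] := @dist_fun_of_measure R (image_measure Lam mphi).
  rewrite /=; apply: le_lt_trans fin; rewrite /pushforward.
  rewrite (_ : phi @^-1` _ = [set e | e.1 <= t /\ t < e.2])//.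
  apply/seteqP; split => e /=; rewrite in_itv/= andbT.
    by move=> /[dup] /phiE[et ->]; rewrite subr_gt0.
  by move=> [et te]; rewrite phi1// subr_gt0.
exists mu => x x0; rewrite hmu//=; rewrite /pushforward; congr (Lam _).
apply/seteqP; split => e /=; rewrite in_itv/=.
  move=> /andP[p0 px]; have [et pe] := phiE _ p0; move: p0 px.
  by rewrite pe subr_gt0 lerBlDl => -> ->.
by move=> [et /andP[te ex]]; rewrite phi1// subr_gt0 te lerBlDl.
Qed.

(** The individuals of X0 and the children of the atoms of A form a distribution
    function only if their number is finite. The total definition allows the
    scheme to be written by recursion before finiteness is known. *)
Definition population m (X0 : dist_fun R) A t : dist_fun R :=
  if pselect (exists mu : dist_fun R, forall x, 0 < x ->
     (mu x)%:E = ((X0 (x + t) - X0 t)%:E + births m A t x)%E) is left h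
  then projT1 (cid h) else dist_fun_zero.

Lemma child_alive_le m A i (S : set (R * R)) : measurable A -> measurable S ->
  (m (A `&` [set q | (i < qn q)%N /\ S (qs q, (qs q + qz q i)%R)]) <= m (A `&` [set q | (i < qn q)%N]))%E.
Proof.
move=> mA mS; apply: le_measure; rewrite ?inE.
- by apply: measurableI => //; exact: measurable_child.
- by apply: measurableI => //; exact: (measurable_qn_set [set n | (i < n)%N]).
- by move=> q [Aq []].
Qed.

Lemma particle_measure_fin m X0 A (mA : measurable A) (S : set (R * R)) : measurable S ->
  S `<=` [set e | 0 < e.2] -> (brood m A < +oo)%E ->
  (particle_measure X0 m mA S < +oo)%E.
Proof.
move=> mS S0 fin; rewrite particle_measureE//; apply: lte_add_pinfty.
  apply: LS_finite; have mp : measurable_fun [set: R] (fun y : R => ((0 : R), y)).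
    exact: measurable_fun_pair.
  by have := mp measurableT S mS; rewrite setTI.
apply: le_lt_trans fin; apply: lee_nneseries => // i _; exact: child_alive_le.
Qed.

Lemma populationE m X0 A t x : measurable A -> (brood m A < +oo)%E -> 0 <= t -> 0 < x ->
  (population m X0 A t x)%:E = ((X0 (x + t) - X0 t)%:E + births m A t x)%E.
Proof.
move=> mA fin t0; move: x; rewrite /population; case: pselect => [h|[]].
  by move=> x x0; rewrite (projT2 (cid h)).
have [|mu hmu] := @snapshot_exists (particle_measure X0 m mA) t.
  apply: particle_measure_fin => //.
    have -> : [set e : R * R | e.1 <= t /\ t < e.2] = [set e | `]-oo, t]%classic e.1 /\ t < e.2].
      by apply/seteqP; split => e /=; rewrite in_itv.
    exact: measurable_alive.
  by move=> e [_]; exact: le_lt_trans.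
by exists mu => x x0; rewrite hmu// particle_measure_alive.
Qed.

Lemma population_births m X0 A A' t :
  (forall x, births m A t x = births m A' t x) ->
  population m X0 A t = population m X0 A' t.
Proof.
move=> h; have e : births m A t = births m A' t by exact/funext.
by rewrite /population e.
Qed.

End population.

Section cadlag_population.
Context {R : realType}.
Variables (m : {measure set (noise_pt R) -> \bar R}) (X0 : dist_fun R).
Variables (A : set (noise_pt R)) (mA : measurable A) (fin : (brood m A < +oo)%E).

Let Lam := particle_measure X0 m mA.

Let Lfin T : (Lam (particles_upto T) < +oo)%E.
Proof.
apply: particle_measure_fin => //; first exact: measurable_particles_upto.
by move=> e [].
Qed.

Lemma population_Lam t : 0 <= t -> forall x, 0 < x ->
  (population m X0 A t x)%:E = Lam [set e | e.1 <= t /\ t < e.2 <= t + x].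
Proof. by move=> t0 x x0; rewrite populationE// particle_measure_alive. Qed.

Lemma population_right_continuous t : 0 <= t ->
  weak_right_continuous (population m X0 A) t.
Proof.
move=> t0; apply: (@particles_right_continuous _ Lam (t + 1) (Lfin _)) => //.
  by move=> s s0 _; exact: population_Lam.
by rewrite ltrDl.
Qed.

Lemma population_left_limit s : 0 < s ->
  left_limit (population m X0 A) s (population m X0 (A `&` [set q | qs q < s]) s).
Proof.
move=> s0; apply: (@particles_left_limit _ Lam s (Lfin _)) => //.
  by move=> t t0 _; exact: population_Lam.
have mAs : measurable (A `&` [set q | qs q < s]).
  by apply: measurableI => //; exact: measurable_qs_lt.
move=> x x0; rewrite populationE//; last exact: ltW.
  rewrite particle_measureE; first last.
  - by move=> e [_ /andP[/(lt_trans s0)]].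
  - have -> : [set e : R * R | e.1 < s /\ s < e.2 <= s + x] =
      [set e | `]-oo, s[%classic e.1 /\ `]s, s + x]%classic e.2].
      by apply/seteqP; split => e /=; rewrite !in_itv.
    exact: measurable_particles.
  rewrite (_ : [set y | _] = `]s, x + s]%classic).
    rewrite LS_oc ?lerDr ?(ltW x0)//; congr (_ + _)%E.
    apply: eq_eseriesr => i _; congr (m _).
    apply/seteqP; split => q; rewrite /child_alive /=.
      by move=> [[Aq qs'] [_ iq xq]].
    by move=> [Aq [iq [qs' xq]]]; split => //; split => //; exact: ltW.
  by apply/seteqP; split => y /=; rewrite in_itv/= (addrC s); [case|move=> ->].
apply: le_lt_trans fin; apply: lee_nneseries => // i _.
have mi := measurable_qn_set [set n | (i < n)%N].
apply: le_measure; rewrite ?inE; [exact: measurableI|exact: measurableI|].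
by move=> q [[Aq _] iq].
Qed.

End cadlag_population.

Section mass.
Context {R : realType}.

Lemma population_mass (m : {measure set (noise_pt R) -> \bar R}) X0 A t :
  measurable A -> (brood m A < +oo)%E -> 0 <= t ->
  (LS (population m X0 A t) `]0%R, +oo[%classic <= LS X0 `]0%R, +oo[%classic + brood m A)%E.
Proof.
move=> mA fin t0.
have h := @LS_0y_cvg _ (population m X0 A t).
rewrite -(cvg_lim _ h)//; apply: lime_le; first exact: cvgP h.
apply: nearW => -[|n]; first by rewrite dist_le0// adde_ge0// nneseries_ge0.
rewrite populationE//; apply: leeD.
  apply: le_trans (dist_le_mass X0 (n.+1%:R + t)); rewrite lee_fin lerBlDr lerDl.
  exact: dist_pos.
apply: lee_nneseries => // i _; apply: le_measure; rewrite ?inE.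
- by apply: measurableI => //; exact: measurable_child_alive.
- by apply: measurableI => //; exact: (measurable_qn_set [set n | (i < n)%N]).
- by move=> q [Aq [_ iq _]].
Qed.

Lemma pairing_le_mass (alpha : R -> R) (C : R) (mu : dist_fun R) :
  C1_pos alpha -> (forall x, 0 < x -> `|alpha x| <= C) ->
  ((pairing mu alpha)%:E <= C%:E * LS mu `]0%R, +oo[%classic)%E.
Proof.
move=> h_alpha hC.
have fin := LS_0y_fin mu.
rewrite -[X in (_ * X)%E]fineK ?ge0_fin_numE// -EFinM lee_fin.
have -> : C * fine (LS mu `]0%R, +oo[%classic) = pairing mu (cst C).
  by rewrite /pairing (@Rintegral_cst _ _ _ (LS mu)).
apply: le_Rintegral => //.
- by apply: (@pairing_integrable _ _ _ C) => //; exact: C1_pos_measurable.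
- by apply: (@pairing_integrable _ _ _ `|C|) => // x _.
- by move=> x; rewrite /= in_itv/= andbT => /hC; apply: le_trans; exact: ler_norm.
Qed.

Lemma brood_setU (m : {measure set (noise_pt R) -> \bar R}) A B :
  measurable A -> measurable B -> (brood m (A `|` B) <= brood m A + brood m B)%E.
Proof.
move=> mA mB; rewrite /brood -nneseriesD//.
apply: lee_nneseries => // i _; rewrite setIUl.
have mi := measurable_qn_set [set n | (i < n)%N].
by apply: measureU2; exact: measurableI.
Qed.

End mass.

Section euler.
Context {R : realType}.
Variables (alpha : R -> R) (p : R -> nat -> R).
Hypotheses (h_alpha : C1_pos alpha) (h_p : forall i, C1_pos (p ^~ i)).
Hypothesis p_le1 : forall a n, p_ext p a n <= 1.
Variables (m : {measure set (noise_pt R) -> \bar R}) (X0 : dist_fun R).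
Variables (D : set (noise_pt R)) (K : nat).

Definition grid (i : nat) : R := i%:R / K.+1%:R.

Definition cell i : set (noise_pt R) := [set q | grid i < qs q <= grid i.+1].

(** In the i-th cell the decisions are taken as if no birth had happened since the
    beginning of the cell. *)
Fixpoint accepted (i : nat) : set (noise_pt R) :=
  if i is j.+1 then accepted j `|` (D `&` cell j `&`
    [set q | accepts alpha p (population m X0 (accepted j) (qs q))
       (qu q) (qy q) (qn q) (qv q)])
  else set0.

Definition euler : set (noise_pt R) := \bigcup_i accepted i.

Lemma grid_le i j : (i <= j)%N -> grid i <= grid j.
Proof. by move=> ij; rewrite ler_pM2r ?invr_gt0// ler_nat. Qed.

Lemma grid0 : grid 0 = 0.
Proof. by rewrite /grid mul0r. Qed.

Lemma cell_exists s : 0 < s -> exists i, grid i < s <= grid i.+1.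
Proof.
move=> s0; have s1 : 0 < K.+1%:R * s by rewrite mulr_gt0.
have := ceil_itv (K.+1%:R * s); have c0 : (0 < Num.ceil (K.+1%:R * s))%R by rewrite ceil_gt0.
case: (Num.ceil (K.+1%:R * s)) c0 => // -[//|n] _; rewrite intrB /= => /andP[h1 h2].
exists n; rewrite /grid ltr_pdivrMr// ler_pdivlMr// (mulrC s) h2 andbT.
by move: h1; rewrite -natr1 /= -[X in X - _ < _]/(n.+1%:R) -natr1 addrK.
Qed.

Lemma accepted_sub i : accepted i `<=` D `&` [set q | 0 < qs q <= grid i].
Proof.
elim: i => [//|i IH] q [/IH[Dq /= /andP[q0 qi]]|[[Dq /andP[q0 qi]] _]].
  by split => //=; rewrite q0 (le_trans qi)// grid_le.
by split => //=; rewrite qi andbT (le_lt_trans _ q0)// -grid0 grid_le.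
Qed.

Lemma accepted_mono i j : (i <= j)%N -> accepted i `<=` accepted j.
Proof.
move=> /subnK <-; elim: (j - i)%N => [//|k IH] q /IH; rewrite addSn; by left.
Qed.

Lemma euler_upto i : euler `&` [set q | qs q <= grid i] = accepted i.
Proof.
apply/seteqP; split => q; last first.
  by move=> aq; split; [exists i|have [_ /andP[_ ?]] := accepted_sub aq].
move=> [[j _ aq] /= qi]; have [ji|ij] := leqP j i; first exact: accepted_mono aq.
have {ij} : (i <= j)%N by exact: ltnW.
elim: j aq => [//|j IH] aq; rewrite leq_eqVlt => /predU1P[->//|]; rewrite ltnS => ij.
apply: IH => //; case: aq => // -[[_ /andP[jq _]] _].
by move: (lt_le_trans jq (le_trans qi (grid_le ij))); rewrite ltxx.
Qed.

Lemma euler_sub : euler `<=` D.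
Proof. by move=> q [i _ /accepted_sub[]]. Qed.

Lemma euler_cell i q : cell i q -> euler q <->
  D q /\ accepts alpha p (population m X0 (accepted i) (qs q)) (qu q) (qy q) (qn q) (qv q).
Proof.
move=> cq; have /andP[iq qi] := cq; split => [eq|[Dq aq]].
  have : accepted i.+1 q by rewrite -euler_upto.
  case=> [/accepted_sub[_ /andP[_]]|[[Dq _] aq] //].
  by rewrite leNgt iq.
by exists i.+1 => //; right.
Qed.

Hypothesis mD : measurable D.
Hypothesis D_dom : D `<=` noise_dom (R := R).
Hypothesis m_lt1 : forall B, measurable B -> B `<=` D -> (m B < 1)%E -> m B = 0%E.
Hypothesis m_cell : forall i, (m (D `&` cell i) <= 1)%E.
Hypothesis brood_fin : (brood m D < +oo)%E.
Hypothesis m_acc : forall i, measurable (accepted i).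

Lemma measurable_euler : measurable euler.
Proof. exact: bigcup_measurable. Qed.

Lemma brood_le A B : measurable A -> measurable B -> A `<=` B -> (brood m A <= brood m B)%E.
Proof.
move=> mA mB AB; apply: lee_nneseries => // i _.
have mi := measurable_qn_set [set n | (i < n)%N].
apply: le_measure; rewrite ?inE; [exact: measurableI|exact: measurableI|].
by move=> q [/AB].
Qed.

Lemma euler_fin A : measurable A -> A `<=` D -> (brood m A < +oo)%E.
Proof. by move=> mA AD; apply: le_lt_trans brood_fin; exact: brood_le. Qed.

Lemma measurable_cell i : measurable (cell i).
Proof.
have -> : cell i = [set q | grid i < qs q] `&` [set q | qs q <= grid i.+1].
  by apply/seteqP; split => q /=; rewrite /cell/=; [move=> /andP[]|move=> [-> ->]].
by apply: measurableI; [exact: measurable_qs_gt|exact: measurable_qs_le].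
Qed.

Let early i k := D `&` cell i `&` [set q | qs q < k].
Let late i k := D `&` cell i `&` [set q | k <= qs q].

Let measurable_early i k : measurable (early i k).
Proof.
apply: measurableI; last exact: measurable_qs_lt.
by apply: measurableI => //; exact: measurable_cell.
Qed.

Let measurable_late i k : measurable (late i k).
Proof.
apply: measurableI; last first.
  by apply: measurable_le_set; [exact: measurable_cst|exact: measurable_qs].
by apply: measurableI => //; exact: measurable_cell.
Qed.

(** The atoms that are not the first of their cell. They form a null set when no
    cell has two atoms: a rational time separates such an atom from an earlier
    one, and then one of the two parts of the cell is null. *)
Definition crowded : set (noise_pt R) :=
  \bigcup_i \bigcup_n (if @choice.unpickle rat n is Some k then
     (if m (early i (ratr k)) == 0%E then set0 else late i (ratr k)) else set0).

Lemma measurable_crowded : measurable crowded.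
Proof.
apply: bigcup_measurable => i _; apply: bigcup_measurable => n _.
by case: choice.unpickle => // k; case: ifPn.
Qed.

Lemma crowded_null : m crowded = 0%E.
Proof.
apply: measure_negligible; first exact: measurable_crowded.
apply: negligible_bigcup => i; apply: negligible_bigcup => n.
case: choice.unpickle => [k|]; last exact: negligible_set0.
case: ifPn => mk; first exact: negligible_set0.
exists (late i (ratr k)); split => //.
have h1 : (1 <= m (early i (ratr k)))%E.
  rewrite leNgt; apply/negP => h; move/negP: mk; apply; apply/eqP.
  by apply: m_lt1 => //; move=> q [[]].
have hU : m (D `&` cell i) = (m (early i (ratr k)) + m (late i (ratr k)))%E.
  rewrite -measureU//.
    congr (m _); apply/seteqP; split => q /=; last by case=> -[].
    by move=> Dq; case: (ltP (qs q) (ratr k)) => ?; [left|right].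
  apply/seteqP; split => q //= [[_ /= h] [_ /= h']].
  by move: (lt_le_trans h h'); rewrite ltxx.
have := m_cell i; rewrite hU => h2.
have fe : m (early i (ratr k)) \is a fin_num.
  rewrite ge0_fin_numE//; apply: (@le_lt_trans _ _ 1%E); last exact: ltry.
  by apply: le_trans h2; rewrite leeDl.
have h3 : (m (early i (ratr k)) + m (late i (ratr k)) <= m (early i (ratr k)))%E.
  exact: le_trans h2 h1.
move: h3; rewrite -leeBrDl// subee// => h3.
by apply/eqP; rewrite eq_le h3/=.
Qed.

Lemma not_crowded_early q i : cell i q -> D q -> ~ crowded q -> m (early i (qs q)) = 0%E.
Proof.
move=> cq Dq nq; apply: measure_negligible => //.
pose F n := if @choice.unpickle rat n is Some k then
    (if ratr k < qs q then early i (ratr k) else set0) else set0.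
have null : m.-negligible (\bigcup_n F n).
  apply: negligible_bigcup => n; rewrite /F.
  case e : choice.unpickle => [k|]; last exact: negligible_set0.
  case: ifPn => kq; last exact: negligible_set0.
  exists (early i (ratr k)); split => //.
  apply: contrapT => /eqP h; apply: nq; exists i; first exact: I.
  exists n; first exact: I.
  rewrite e (negbTE h); split; first by split.
  by apply: ltW.
apply: negligibleS null => q' [Dq' /= h].
have /rat_in_itvoo[k] := h; rewrite in_itv/= => /andP[h1 h2].
have hk : early i (ratr k) q' by split.
exists (choice.pickle k); first exact: I.
by rewrite /F choice.pickleK h2; exact: hk.
Qed.

Definition euler_path t := population m X0 euler t.
Definition euler_left s := population m X0 (euler `&` [set q | qs q < s]) s.

(** Without an earlier atom in the cell, nobody was born between the beginning of
    the cell and the atom, so the predicted state is the true left limit. *)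
Lemma euler_left_predictor q i : cell i q -> D q -> ~ crowded q ->
  euler_left (qs q) = population m X0 (accepted i) (qs q).
Proof.
move=> cq Dq nq; have e0 := not_crowded_early cq Dq nq.
have /andP[iq qi] := cq.
apply: population_births => x; apply: eq_eseriesr => j _.
have mc := measurable_child_alive j (qs q) x.
have ml := measurable_qs_lt (qs q).
have me := measurable_euler.
apply/eqP; rewrite eq_le; apply/andP; split.
  rewrite -[leRHS]adde0 -e0.
  apply: (@le_trans _ _ (m (accepted i `&` child_alive j (qs q) x `|` early i (qs q)))).
    apply: le_measure; rewrite ?inE.
    - by apply: measurableI => //; apply: measurableI.
    - by apply: measurableU => //; exact: measurableI.
    - move=> q' [[eq' lt'] cq']; have [h|h] := leP (qs q') (grid i).
        by left; split => //; rewrite -euler_upto.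
      right; split => //; split; first exact: euler_sub eq'.
      by rewrite /cell/= h (le_trans (ltW lt')).
  by apply: measureU2 => //; exact: measurableI.
apply: le_measure; rewrite ?inE; [exact: measurableI|by apply: measurableI => //; apply: measurableI|].
move=> q' [aq' cq']; split => //; split; first by exists i.
by have [_ /andP[_ h]] := accepted_sub aq'; exact: le_lt_trans iq.
Qed.

Lemma left_limit_euler s : 0 < s -> left_limit euler_path s (euler_left s).
Proof.
move=> s0; apply: population_left_limit => //; first exact: measurable_euler.
by apply: euler_fin; [exact: measurable_euler|exact: euler_sub].
Qed.

Lemma measurable_euler_region E t : measurable E ->
  measurable (region alpha p euler_left `&` E `&` [set q | qs q <= t]).
Proof.
move=> mE; rewrite -setIA (setIC E) setIA; apply: measurableI => //.
apply: measurable_region => // z; apply: (@left_limit_measurable _ euler_path).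
by move=> s s0 _; exact: left_limit_euler.
Qed.

Lemma euler_region q : ~ crowded q ->
  (euler q <-> (region alpha p euler_left `&` D) q).
Proof.
move=> nq; split => [eq|[[q0 mq aq] Dq]].
  have Dq := euler_sub eq.
  have := D_dom Dq; rewrite noise_domE => -[q0 _ mq _].
  have [i ci] := cell_exists q0.
  have [_ aq] := (euler_cell ci).1 eq.
  by rewrite -(euler_left_predictor ci Dq nq) in aq.
have [i ci] := cell_exists q0.
rewrite (euler_left_predictor ci Dq nq) in aq.
by apply/(euler_cell ci).
Qed.

(** If no cell has two atoms of D then, at almost every atom, the state predicted
    by the scheme is the left limit of its path. *)
Theorem euler_solution T : path_solution alpha p m D X0 T euler_path euler_left.
Proof.
have me := measurable_euler.
have fe := euler_fin me euler_sub.
split.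
- by move=> t t0 _; exact: population_right_continuous.
- by move=> s s0 _; exact: left_limit_euler.
- move=> t x t0 tT x0; rewrite /euler_path populationE//; congr (_ + _)%E.
  set rg := region alpha p euler_left `&` D.
  have mr : measurable (rg `&` [set q | qs q <= t]) by exact: measurable_euler_region.
  apply: eq_eseriesr => i _.
  have mc := measurable_child_alive i t x.
  have mrc : measurable (rg `&` child_alive i t x).
    have -> : rg `&` child_alive i t x = rg `&` [set q | qs q <= t] `&` child_alive i t x.
      by rewrite -setIA; congr (_ `&` _); rewrite setIidr// => q [].
    exact: measurableI.
  have mec : measurable (euler `&` child_alive i t x) by exact: measurableI.
  apply: (measure_eq_off_null measurable_crowded crowded_null mec mrc).
  move=> q nq; split => -[eq cq]; split; try exact: cq; exact/(euler_region nq).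
Qed.

(** An accepted atom has its second coordinate below the bound of alpha times the
    total mass, and has at most as many children as there are births in total.
    When these quantities are small, every accepted atom lies in the smaller set
    E, so the path solves the equation restricted to E as well. *)
Theorem euler_restrict E T k (Ca : R) :
  measurable E -> E `<=` D -> T <= grid k ->
  0 <= Ca -> (forall x, 0 < x -> `|alpha x| <= Ca) -> 
  (forall q c, D q -> qs q <= T -> qu q <= c ->
    (c%:E <= Ca%:E * (LS X0 `]0%R, +oo[%classic + brood m (accepted k)))%E ->
    (((qn q)%:R)%:E <= brood m (accepted k))%E -> E q) ->
  path_solution alpha p m E X0 T euler_path euler_left.
Proof.
move=> mE ED Tk Ca0 hCa hE.
set acc := accepted k.
have me := measurable_euler.
have macc : measurable acc by exact: m_acc.
have accD : acc `<=` D by move=> q /accepted_sub[].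
have facc : (brood m acc < +oo)%E by exact: euler_fin.
have bE : brood m acc = (fine (brood m acc))%:E.
  by rewrite fineK// ge0_fin_numE// nneseries_ge0.
set b := fine (brood m acc) in bE.
have b0 : 0 <= b by rewrite fine_ge0// nneseries_ge0.
pose B := acc `&` [set q | b < (qn q)%:R].
have mB : measurable B by apply: measurableI => //; exact: (measurable_qn_set [set n | b < n%:R]).
(* an atom of B alone would already have more than b children *)
have mB0 : m B = 0%E.
  apply: m_lt1 => //; first by move=> q [/accD].
  rewrite ltNge; apply/negP => B1.
  have : ((Num.truncn b).+1%:R%:E <= brood m acc)%E.
    apply: (@le_trans _ _ (\sum_(0 <= i < (Num.truncn b).+1) m (acc `&` [set q | (i < qn q)%N]))%E); last first.
      by apply: nneseries_lim_ge => i _ _.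
    rewrite -[X in (X%:E <= _)%E](_ : \sum_(0 <= i < (Num.truncn b).+1) 1 = _); last first.
      by rewrite sumr_const_nat subn0.
    rewrite -sumEFin big_nat [leRHS]big_nat; apply: lee_sum => i /andP[_ ib].
    apply: (le_trans B1); apply: le_measure; rewrite ?inE//.
      by apply: measurableI => //; exact: (measurable_qn_set [set n | (i < n)%N]).
    move=> q [aq bq]; split => //=; apply: (leq_ltn_trans (n := Num.truncn b)) => //.
    by rewrite -(ltr_nat R); apply: le_lt_trans bq; rewrite truncn_le.
  by rewrite bE lee_fin leNgt truncnS_gt.
have inE_ q : (region alpha p euler_left `&` D) q -> qs q <= T -> ~ crowded q -> ~ B q -> E q.
  move=> rq qT nc nB; have eq := (euler_region nc).2 rq.
  have aq : acc q by rewrite /acc -euler_upto; split => //=; exact: le_trans Tk.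
  case: rq => -[q0 _ /accepts_bounds[/andP[_ uq] _]] Dq.
  apply: (hE q _ Dq qT uq).
    apply: (le_trans (pairing_le_mass _ h_alpha hCa)); apply: lee_wpmul2l; first by rewrite lee_fin.
    have mes : measurable (euler `&` [set q' | qs q' < qs q]).
      by apply: measurableI => //; exact: measurable_qs_lt.
    have ea : euler `&` [set q' | qs q' < qs q] `<=` acc.
      move=> q' [eq' /ltW lq]; rewrite /acc -euler_upto; split => //=.
      exact: le_trans lq (le_trans qT Tk).
    apply: (le_trans (population_mass _ mes _ (ltW q0))).
      by apply: le_lt_trans facc; exact: brood_le.
    by apply: leeD; [exact: lexx|exact: brood_le].
  by rewrite -/acc bE lee_fin leNgt; apply/negP => bq; apply: nB.
have [h1 h2 h3] := euler_solution T.
split; [exact: h1|exact: h2|] => t x t0 tT x0; rewrite h3//; congr (_ + _)%E.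
apply: eq_eseriesr => i _.
have mc := measurable_child_alive i t x.
have mc' (A : set (noise_pt R)) : measurable A ->
    measurable (region alpha p euler_left `&` A `&` child_alive i t x).
  move=> mA; have -> : region alpha p euler_left `&` A `&` child_alive i t x =
      region alpha p euler_left `&` A `&` [set q | qs q <= t] `&` child_alive i t x.
    by rewrite -[RHS]setIA; congr (_ `&` _); rewrite setIidr// => q [].
  by apply: measurableI => //; exact: measurable_euler_region.
have mN : measurable (crowded `|` B) by apply: measurableU => //; exact: measurable_crowded.
have N0 : m (crowded `|` B) = 0%E.
  have c0 := crowded_null; apply/eqP; rewrite -measure_le0.
  apply: (@le_trans _ _ (m crowded + m B)%E); last by rewrite c0 mB0 adde0.
  exact: (measureU2 _ measurable_crowded mB).
apply: (measure_eq_off_null mN N0); [exact: mc'|exact: mc'|].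
move=> q /not_orP[nc nB]; split => -[[rq Aq] cq].
  split; last exact: cq; split; first exact: rq.
  by apply: inE_ => //; case: cq => qt _ _; exact: le_trans tT.
by split; last exact: cq; split; [exact: rq|exact: ED].
Qed.

End euler.

(** * The intensity measure *)

HB.instance Definition _ (R : realType) :=
  @Measure_isSigmaFinite.Build _ nat R (@counting nat R) (sigma_finite_counting R).

Section product_sigma_finite.
Context d1 d2 (T1 : measurableType d1) (T2 : measurableType d2) (R : realType).
Variables (m1 : {sigma_finite_measure set T1 -> \bar R}).
Variables (m2 : {sigma_finite_measure set T2 -> \bar R}).

Lemma product_sigma_finite : sigma_finite setT (m1 \x m2)%E.
Proof.
have /sigma_finiteP[F [TF ndF Foo]] := sigma_finiteT m1.
have /sigma_finiteP[G [TG ndG Goo]] := sigma_finiteT m2.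
exists (fun n => F n `*` G n).
  rewrite -setXTT TF TG; apply/seteqP; split => [[x y] /= [[n _ Fx] [k _ Gy]]|[x y] [n _ [Fx Gy]]].
    exists (maxn n k) => //; split.
      by move: x Fx; exact/subsetPset/ndF/leq_maxl.
    by move: y Gy; exact/subsetPset/ndG/leq_maxr.
  by split; exists n.
move=> k; have [mF Fk] := Foo k; have [mG Gk] := Goo k.
split; first exact: measurableX.
by rewrite product_measure1E// lte_mul_pinfty// ge0_fin_numE.
Qed.

Definition product_measure : {sigma_finite_measure set (T1 * T2)%type -> \bar R} :=
  HB.pack (m1 \x m2)%E (@Measure_isSigmaFinite.Build _ _ _ (m1 \x m2)%E product_sigma_finite).

Lemma product_measureE A B : measurable A -> measurable B ->
  product_measure (A `*` B) = (m1 A * m2 B)%E.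
Proof. by move=> mA mB; exact: product_measure1E. Qed.

End product_sigma_finite.

Section intensity_measure.
Context {R : realType} (Ginf : probability (zseq R) R).

Local Notation RR := (measurableTypeR R).

Definition lebesgue2 : {sigma_finite_measure set (RR * RR)%type -> \bar R} :=
  product_measure (@lebesgue_measure R) (@lebesgue_measure R).

Definition lebesgue_counting : {sigma_finite_measure set (RR * nat)%type -> \bar R} :=
  product_measure (@lebesgue_measure R) (@counting nat R).

Definition mark_measure : {sigma_finite_measure set (RR * nat * zseq R)%type -> \bar R} :=
  product_measure lebesgue_counting Ginf.

Definition time_mark_measure :
    {sigma_finite_measure set (RR * RR * (RR * nat * zseq R))%type -> \bar R} :=
  product_measure lebesgue2 mark_measure.

Definition intensity0 :
    {sigma_finite_measure set (RR * RR * (RR * nat * zseq R) * RR)%type -> \bar R} :=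
  product_measure time_mark_measure (@lebesgue_measure R).

(** The same measure on [noise_pt]; the two carriers have the same measurable sets
    but are distinct as structures. *)
Let intensity_set0 : intensity Ginf set0 = 0%E.
Proof. exact: (measure0 intensity0). Qed.

Let intensity_pos A : (0 <= intensity Ginf A)%E.
Proof. exact: (measure_ge0 intensity0). Qed.

Let intensity_sigma_additive :
  @semi_sigma_additive _ _ (noise_pt R) (intensity Ginf).
Proof. exact: (@measure_semi_sigma_additive _ _ _ intensity0). Qed.

Let intensity_sigma_finite : @sigma_finite _ (noise_pt R) _ setT (intensity Ginf).
Proof. exact: (@sigma_finiteT _ _ _ intensity0). Qed.

HB.instance Definition _ := isMeasure.Build _ (noise_pt R) R (intensity Ginf)
  intensity_set0 intensity_pos intensity_sigma_additive.
HB.instance Definition _ := @Measure_isSigmaFinite.Build _ (noise_pt R) R (intensity Ginf)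
  intensity_sigma_finite.

End intensity_measure.

(** * Integer-valued measures *)

Section countable_generation.

Lemma sigma_preimage (T U : Type) (f : T -> U) (G : set (set T)) (H : set (set U)) :
  (forall B, H B -> <<s G >> (f @^-1` B)) -> forall B, <<s H >> B -> <<s G >> (f @^-1` B).
Proof.
move=> GH; apply: (@smallest_sub _ _ _ [set B | <<s G >> (f @^-1` B)]) => //.
split => /=.
- by rewrite preimage_set0; exact: sigma_algebra0.
- by move=> A GA; rewrite setTD -preimage_setC -setTD; exact: sigma_algebraCD.
- by move=> A GA; rewrite preimage_bigcup; exact: sigma_algebra_bigcup.
Qed.

Definition countably_generated d (T : measurableType d) : Prop :=
  exists C : nat -> set T, (forall n, measurable (C n)) /\
    (@measurable d T) `<=` <<s range C >>.

Lemma countably_generated_R (R : realType) : countably_generated (R : measurableType _).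
Proof.
pose C n : set R := if @choice.unpickle rat n is Some q then `]-oo, ratr q[%classic else set0.
exists C; split; first by move=> n; rewrite /C; case: choice.unpickle.
have sC n : @measurable _ (g_sigma_algebraType (range C)) (C n).
  by apply: sub_sigma_algebra; exists n.
have sx x : @measurable _ (g_sigma_algebraType (range C)) (`]-oo, x]%classic : set R).
  rewrite (_ : `]-oo, x]%classic = \bigcap_n (if @choice.unpickle rat n is Some q then
     if x < ratr q then C n else setT else setT)).
    apply: bigcap_measurable => // n _.
    by case: choice.unpickle => [q|] //; case: ifP.
  apply/seteqP; split => y /=; rewrite in_itv/=.
    move=> yx n _; rewrite /C; case: choice.unpickle => [q|] //; case: ifP => // xq.
    by rewrite /= in_itv/=; exact: le_lt_trans xq.
  move=> h; rewrite leNgt; apply/negP => /rat_in_itvoo[q]; rewrite in_itv/= => /andP[xq qy].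
  have := h (choice.pickle q) I; rewrite /C choice.pickleK xq /= in_itv/= => yq.
  by move: (lt_trans qy yq); rewrite ltxx.
apply: smallest_sub; first exact: smallest_sigma_algebra.
move=> _ [[a b] _ <-] /=; change (@measurable _ (g_sigma_algebraType (range C)) (`]a, b]%classic : set R)).
rewrite (_ : `]a, b]%classic = (`]-oo, b]%classic : set R) `\` `]-oo, a]%classic).
  by apply: measurableD.
apply/seteqP; split => y /=; rewrite !in_itv/=.
  by move=> /andP[ay yb]; split => //; rewrite leNgt ay.
by move=> [yb /negP]; rewrite -ltNge => ->.
Qed.

Lemma countably_generated_nat : countably_generated (nat : measurableType _).
Proof.
exists (fun n => [set n]); split => // B _.
change (@measurable _ (g_sigma_algebraType (range (fun n : nat => [set n]))) B).
rewrite (_ : B = \bigcup_(n in B) [set n]); last first.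
  by apply/seteqP; split => [n Bn|n [k Bk ->]]; first by exists n.
by apply: bigcup_measurable => n _; apply: sub_sigma_algebra; exists n.
Qed.

Lemma countably_generated_prod d1 d2 (T1 : measurableType d1) (T2 : measurableType d2) :
  countably_generated T1 -> countably_generated T2 ->
  countably_generated (T1 * T2 : measurableType _)%type.
Proof.
move=> [C1 [mC1 h1]] [C2 [mC2 h2]].
pose C n := if odd n then setT `*` C2 n./2 else C1 n./2 `*` setT : set (T1 * T2).
exists C; split; first by move=> n; rewrite /C; case: ifP => _; exact: measurableX.
rewrite measurable_prod_measurableType.
apply: smallest_sub; first exact: smallest_sigma_algebra.
move=> _ [A mA [B mB <-]].
have -> : A `*` B = (fst @^-1` A) `&` (snd @^-1` B) by [].
suff : @measurable _ (g_sigma_algebraType (range C)) ((fst @^-1` A) `&` (snd @^-1` B)) by [].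
apply: measurableI.
- apply: (sigma_preimage (H := range C1)); last exact: h1.
  move=> _ [n _ <-]; apply: sub_sigma_algebra; exists n.*2 => //.
  by rewrite /C odd_double doubleK; apply/seteqP; split => [[x y] []|[x y]].
- apply: (sigma_preimage (H := range C2)); last exact: h2.
  move=> _ [n _ <-]; apply: sub_sigma_algebra; exists n.*2.+1 => //.
  by rewrite /C /= odd_double /= uphalf_double; apply/seteqP; split => [[x y] []|[x y]].
Qed.

Lemma countably_generated_zseq (R : realType) : countably_generated (zseq R).
Proof.
have [C [mC hC]] := countably_generated_R R.
pose C' n : set (zseq R) := if @choice.unpickle (nat * nat)%type n is Some ik
  then (fun z : nat -> R => z ik.1) @^-1` (C ik.2) else set0.
exists C'; split.
  move=> n; rewrite /C'; case: choice.unpickle => // ik.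
  by apply: sub_sigma_algebra; exists ik.1, (C ik.2).
apply: smallest_sub; first exact: smallest_sigma_algebra.
move=> _ [i [B [mB ->]]]; apply: (sigma_preimage (H := range C)); last exact: hC.
move=> _ [k _ <-]; apply: sub_sigma_algebra; exists (choice.pickle (i, k)) => //.
by rewrite /C' choice.pickleK.
Qed.

(** For each set the noise is almost surely an integer, outside a null event that
    depends on the set. Countable generation allows a single null event. *)
Lemma countably_generated_noise (R : realType) : countably_generated (noise_pt R).
Proof.
have cR := countably_generated_R R; have cz := countably_generated_zseq R.
apply: (countably_generated_prod (T1 := (R * R * (R * nat * zseq R))%type) (T2 := R)) => //.
apply: (countably_generated_prod (T1 := (R * R)%type) (T2 := (R * nat * zseq R)%type)).
  exact: countably_generated_prod.
apply: (countably_generated_prod (T1 := (R * nat)%type) (T2 := zseq R)) => //.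
apply: countably_generated_prod => //; exact: countably_generated_nat.
Qed.

End countable_generation.

Section natural_valued.
Context {R : realType}.

Definition natural_value (x : \bar R) : Prop := exists k : nat, x = k%:R%:E.

Lemma natural_value_lt1 x : natural_value x -> (x < 1)%E -> x = 0%E.
Proof. by move=> [[|k] ->] //; rewrite lte_fin ltrn1. Qed.

Lemma natural_value_cvg (u : nat -> \bar R) (x : \bar R) :
  (forall n, natural_value (u n)) -> x \is a fin_num -> u n @[n --> \oo] --> x ->
  natural_value x.
Proof.
move=> /choice[k hk]; rewrite (_ : u = (fun n => (k n)%:R%:E)); last exact/funext.
case: x => // x _ /fine_cvgP[_ /= h].
have /cvgrPdist_lt/(_ (1 / 2))[//|N _ hN] := h.
have kN n : (N <= n)%N -> k n = k N.
  move=> Nn; have := hN _ Nn; have := hN _ (leqnn N); rewrite /= => h1 h2.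
  have h3 : `|(k n)%:R - (k N)%:R| < 1 :> R.
    have -> : (k n)%:R - (k N)%:R = (x - (k N)%:R) - (x - (k n)%:R) :> R by ring.
    apply: (le_lt_trans (ler_normB _ _)); rewrite [ltRHS](splitr 1).
    by apply: ltrD; [exact: h1|exact: h2].
  move: h3; rewrite ltr_norml => /andP[h3 h4].
  have h5 : (k n)%:R < (k N).+1%:R :> R by rewrite -natr1; lra.
  have h6 : (k N)%:R < (k n).+1%:R :> R by rewrite -natr1; lra.
  by apply/eqP; rewrite eqn_leq; move: h5 h6; rewrite !ltr_nat !ltnS => -> ->.
exists (k N); congr EFin; apply: (cvg_unique _ h) => //.
apply: cvg_near_cst; exists N => // n Nn /=; by rewrite (kN _ Nn).
Qed.

(** A finite measure with natural values on a countable family of sets that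
    generates the sigma-algebra and is stable under intersection has only
    natural values: sets with this property form a Dynkin system. *)
Lemma natural_value_ext d (T : measurableType d) (C : nat -> set T) (mu : {measure set T -> \bar R}) (D : set T) :
  (forall n, measurable (C n)) -> (@measurable d T) `<=` <<s range C >> ->
  measurable D -> (mu D < +oo)%E ->
  (forall s : seq nat, natural_value (mu ((\bigcap_(i in [set` s]) C i) `&` D))) ->
  forall B, measurable B -> natural_value (mu (B `&` D)).
Proof.
move=> mC gC mD fD hs.
pose F (s : seq nat) := \bigcap_(i in [set` s]) C i.
pose H := [set B | measurable B /\ natural_value (mu (B `&` D))].
have fB B : measurable B -> mu (B `&` D) \is a fin_num.
  move=> mB; rewrite ge0_fin_numE//; apply: le_lt_trans fD.
  by apply: le_measure; rewrite ?inE//; exact: measurableI.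
have mF s : measurable (F s) by apply: fin_bigcap_measurable => // i _.
suff h : (@measurable d T) `<=` H by move=> B /h[].
apply: (@subset_trans _ (<<s range F >>)).
  apply: (subset_trans gC); apply: sub_sigma_algebra2.
  move=> _ [n _ <-]; exists [:: n] => //.
  by apply/seteqP; split => [x /(_ n)|x Cx i /=]; rewrite /= inE ?eqxx; [apply|move=> /eqP ->].
apply: (@lambda_system_subset _ (range F)) => //.
- move=> _ _ [s _ <-] [t _ <-]; exists (s ++ t) => //.
  apply/seteqP; split => x.
    by move=> h; split => i /= it; apply: h; rewrite /= mem_cat it ?orbT.
  by move=> [h1 h2] i /=; rewrite mem_cat => /orP[]; [exact: h1|exact: h2].
- split => //.
  + split => //; have := hs [::]; rewrite (_ : \bigcap_(i in _) _ = setT)//.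
    by apply/seteqP; split.
  + move=> A B BA [mA [a ha]] [mB [b hb]]; split; first exact: measurableD.
    exists (a - b)%N.
    have e : mu ((A `\` B) `&` D) = (mu (A `&` D) - mu (B `&` D))%E.
      rewrite (_ : (A `\` B) `&` D = (A `&` D) `\` (B `&` D)).
        rewrite measureD; [|exact: measurableI|exact: measurableI|].
          by congr (_ - mu _)%E; apply/seteqP; split => x [] => [_ //|Bx Dx]; split => //; split => //; exact: BA.
        by rewrite -ge0_fin_numE//; exact: fB.
      by apply/seteqP; split => x /=; tauto.
    have ab : (b <= a)%N.
      rewrite -(ler_nat R) -lee_fin -ha -hb; apply: le_measure; rewrite ?inE; try exact: measurableI.
      by move=> x [/BA].
    by rewrite e ha hb -EFinB natrB.
  + move=> G ndG hG; have mG i : measurable (G i) by case: (hG i).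
    split; first exact: bigcup_measurable.
    apply: (@natural_value_cvg (fun n => mu (G n `&` D))); first by move=> n; case: (hG n).
      by apply: fB; exact: bigcup_measurable.
    rewrite setI_bigcupl; apply: nondecreasing_cvg_mu.
    * by move=> n; exact: measurableI.
    * by apply: bigcup_measurable => n _; exact: measurableI.
    * move=> n k nk; apply/subsetPset; apply: setSI; apply/subsetPset; exact: ndG.
- by move=> _ [s _ <-]; split => //; exact: hs.
Qed.

End natural_valued.

(** * Random measures with measurable sections *)

Section slices.
Context d1 d2 (T : measurableType d1) (U : measurableType d2).

Definition slice (Gam : set (T * U)) (w : T) : set U := [set q | Gam (w, q)].

Lemma xsection_slice Gam w : xsection Gam w = slice Gam w.
Proof. by apply/seteqP; split => q; rewrite /xsection /= inE. Qed.

Lemma measurable_slice Gam w : measurable Gam -> measurable (slice Gam w).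
Proof. by move=> mG; rewrite -xsection_slice; exact: measurable_xsection. Qed.

End slices.

Section section_mass.
Context d (T : measurableType d) dU (U : measurableType dU) (R : realType).
Variables (kappa : T -> {measure set U -> \bar R}) (D : set U).
Hypotheses (mD : measurable D) (finD : forall w, (kappa w D < +oo)%E).
Hypothesis mkappa : forall B, measurable B ->
  measurable_fun [set: T] (fun w => kappa w (B `&` D)).

Lemma measurable_slice_mass (Gam : set (T * U)) : measurable Gam ->
  measurable_fun [set: T] (fun w => kappa w (slice Gam w `&` D)).
Proof.
pose H := [set Gam : set (T * U) | measurable Gam /\
  measurable_fun [set: T] (fun w => kappa w (slice Gam w `&` D))].
suff h : measurable `<=` H by move=> /h[].
rewrite measurable_prod_measurableType.
have mS (G : set (T * U)) w : measurable G -> measurable (slice G w `&` D).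
  by move=> mG; apply: measurableI => //; exact: measurable_slice.
apply: (@lambda_system_subset _ [set A `*` B | A in measurable & B in measurable]) => //.
- move=> _ _ [A1 mA1 [B1 mB1 <-]] [A2 mA2 [B2 mB2 <-]]; rewrite -setXI.
  by exists (A1 `&` A2); [exact: measurableI|exists (B1 `&` B2) => //; exact: measurableI].
- split => //.
  + split; first exact: measurableT.
    rewrite (_ : (fun w => _) = (fun w => kappa w (setT `&` D))); first exact: mkappa.
    by apply/funext => w; congr (kappa w (_ `&` _)); apply/seteqP; split.
  + move=> A B BA [mA hA] [mB hB]; split; first exact: measurableD.
    rewrite (_ : (fun w => _) = (fun w => kappa w (slice A w `&` D) - kappa w (slice B w `&` D))%E).
      exact: emeasurable_funB.
    apply/funext => w; rewrite (_ : _ `&` D = (slice A w `&` D) `\` (slice B w `&` D)).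
      rewrite measureD; [|exact: mS|exact: mS|].
        congr (_ - kappa w _)%E; apply/seteqP; split => q /=; first by move=> [_].
        by move=> [Bq Dq]; split => //; split => //; exact: BA.
      apply: le_lt_trans (finD w); apply: le_measure; rewrite ?inE//; first exact: mS.
    by apply/seteqP; split => q; rewrite /slice/=; tauto.
  + move=> F ndF hF; have mF i : measurable (F i) by case: (hF i).
    have mUF : measurable (\bigcup_i F i) by apply: bigcup_measurable => i _; exact: mF.
    split => //.
    apply: (@emeasurable_fun_cvg _ _ _ _ (fun n w => kappa w (slice (F n) w `&` D))).
      by move=> n; case: (hF n).
    move=> w _.
    rewrite (_ : slice (\bigcup_n F n) w `&` D = \bigcup_n (slice (F n) w `&` D)); last first.
      by rewrite -setI_bigcupl; congr (_ `&` _); apply/seteqP; split => q [i ? ?]; exists i.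
    apply: nondecreasing_cvg_mu.
    * by move=> n; exact: mS.
    * by apply: bigcup_measurable => n _; exact: mS.
    * move=> n k nk; apply/subsetPset => q [Fq Dq]; split => //.
      by move/subsetPset: (ndF _ _ nk); apply.
- move=> _ [A mA [B mB <-]]; split; first exact: measurableX.
  rewrite (_ : (fun w => _) = (fun w => (kappa w (B `&` D) * (\1_A w)%:E)%E)).
    apply: emeasurable_funM; first exact: mkappa.
    by apply/measurable_EFinP; exact: measurable_indic.
  apply/funext => w; rewrite indicE; case: (boolP (w \in A)) => wA /=.
    rewrite mule1; congr (kappa w (_ `&` D)); move: wA; rewrite inE => wA.
    by apply/seteqP; split => q; [case|].
  rewrite mule0 (_ : _ `&` D = set0) ?measure0//.
  by apply/seteqP; split => q // [[/= /mem_set]]; rewrite (negbTE wA).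
Qed.

End section_mass.

Section freezing.
Context d (T : measurableType d) dS (S : measurableType dS) dU (U : measurableType dU).
Context {R : realType}.
Variables (P : probability T R) (phi : T -> S) (mphi : measurable_fun [set: T] phi).
Variables (kappa : T -> {measure set U -> \bar R}) (lam : {measure set U -> \bar R}).
Variable D : set U.
Hypotheses (mD : measurable D) (finD : forall w, (kappa w D < +oo)%E).
Hypothesis lamD : (lam D < +oo)%E.
Hypothesis mkappa : forall B, measurable B ->
  measurable_fun [set: T] (fun w => kappa w (B `&` D)).
Hypothesis mean : forall A B, measurable A -> measurable B ->
  (\int[P]_(w in phi @^-1` A) kappa w (B `&` D) =
    P (phi @^-1` A) * lam (B `&` D))%E.

Let pull (Gam : set (S * U)) : set (T * U) := [set x | Gam (phi x.1, x.2)].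

Let measurable_pull Gam : measurable Gam -> measurable (pull Gam).
Proof.
move=> mG; have mf : measurable_fun [set: T * U] (fun x => (phi x.1, x.2)).
  by apply: measurable_fun_pair => //; exact: (measurableT_comp mphi).
by have := mf measurableT Gam mG; rewrite setTI.
Qed.

Let mean_mass (Gam : set (S * U)) : \bar R :=
  if `[< measurable Gam >] then
  (\int[P]_w kappa w (slice Gam (phi w) `&` D))%E else 0%E.

Lemma measurable_frozen Gam : measurable Gam ->
  measurable_fun [set: T] (fun w => kappa w (slice Gam (phi w) `&` D)).
Proof. by move=> /measurable_pull; exact: measurable_slice_mass. Qed.

Let mean_mass0 : mean_mass set0 = 0%E.
Proof.
rewrite /mean_mass asboolT//; rewrite integral0_eq// => w _.
by rewrite (_ : _ `&` D = set0) ?measure0//; apply/seteqP; split => q [].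
Qed.

Let mean_mass_ge0 Gam : (0 <= mean_mass Gam)%E.
Proof. by rewrite /mean_mass; case: ifP => // _; apply: integral_ge0 => w _. Qed.

Let mean_mass_sigma_additive : semi_sigma_additive mean_mass.
Proof.
move=> F mF tF mUF; rewrite {2}/mean_mass asboolT//.
rewrite (_ : (\int[P]_w _ = \sum_(0 <= n <oo) mean_mass (F n))%E).
  by apply: is_cvg_nneseries => n _ _; exact: mean_mass_ge0.
transitivity (\int[P]_w (\sum_(0 <= n <oo) kappa w (slice (F n) (phi w) `&` D)))%E.
  apply: eq_integral => w _.
  rewrite (_ : slice (\bigcup_n F n) (phi w) `&` D = \bigcup_n (slice (F n) (phi w) `&` D)); last first.
    by rewrite -setI_bigcupl; congr (_ `&` _); apply/seteqP; split => q [i ? ?]; exists i.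
  have mF' n : measurable (slice (F n) (phi w) `&` D).
    by apply: measurableI => //; exact: measurable_slice.
  apply: measure_semi_bigcup => //; last exact: bigcup_measurable.
  move=> i j _ _ [q [[Fi _] [Fj _]]]; apply: tF => //.
  by exists (phi w, q).
rewrite integral_nneseries//; last by move=> n; exact: measurable_frozen.
by apply: eq_eseriesr => n _; rewrite /mean_mass asboolT.
Qed.

HB.instance Definition _ := isMeasure.Build _ _ _ mean_mass
  mean_mass0 mean_mass_ge0 mean_mass_sigma_additive.

(** A random set that is determined by the sigma-algebra of phi can be treated
    as deterministic inside a random measure that is independent of it, because
    the two sides are measures in Gam that agree on rectangles. *)
Lemma freezing Gam : measurable Gam ->
  (\int[P]_w kappa w (slice Gam (phi w) `&` D) =
   \int[P]_w lam (slice Gam (phi w) `&` D))%E.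
Proof.
move=> mG.
pose lamr := mfrestr mD lamD.
pose f : {mfun T >-> S} := HB.pack phi (isMeasurableFun.Build _ _ _ _ phi mphi).
have e := @product_measure_unique _ _ S U R (distribution P f) lamr mean_mass.
transitivity (mean_mass Gam); first by rewrite /mean_mass asboolT.
rewrite -e//; last first.
  move=> A B mA mB; change (mean_mass (A `*` B) = (P (phi @^-1` A) * lam (B `&` D))%E).
  rewrite /mean_mass asboolT; last exact: measurableX.
  rewrite -[RHS]mean//.
  rewrite [RHS]integral_mkcond; apply: eq_integral => w _; rewrite patchE.
  case: ifPn => [|/negP]; rewrite inE/= => wA.
    by congr (kappa w (_ `&` D)); apply/seteqP; split => q; [case|].
  change (kappa w (slice (A `*` B) (phi w) `&` D) = 0%E).
  by rewrite (_ : _ `&` D = set0) ?measure0//; apply/seteqP; split => q // [[]].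
rewrite /product_measure1 (@ge0_integral_pushforward _ _ _ _ _ _ mphi)//.
- by apply: eq_integral => w _ /=; rewrite xsection_slice.
- exact: measurable_fun_xsection.
Qed.

End freezing.

(** Borel-Cantelli: the sum of the series has a finite mean, so it is almost surely
    finite and its terms tend to 0. *)
Lemma ae_eventually_lt1 d (T : measurableType d) (R : realType)
    (P : {measure set T -> \bar R}) (f : nat -> T -> \bar R) (C : R) :
  (forall j, measurable_fun [set: T] (f j)) -> (forall j w, 0 <= f j w)%E ->
  (forall j, \int[P]_w f j w <= (C / 2 ^+ j)%:E)%E ->
  {ae P, forall w, \forall j \near \oo, (f j w < 1)%E}.
Proof.
move=> mf f0 fC.
have mS : measurable_fun [set: T] (fun w => \sum_(0 <= j <oo) f j w)%E.
  exact: ge0_emeasurable_sum.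
have iS : P.-integrable [set: T] (fun w => \sum_(0 <= j <oo) f j w)%E.
  apply/integrableP; split => //.
  under eq_integral do rewrite gee0_abs ?nneseries_ge0//.
  rewrite integral_nneseries//.
  apply: (@le_lt_trans _ _ (\sum_(0 <= j <oo) (C / 2 ^+ j)%:E)%E).
    by apply: lee_nneseries => j _; [move=> _; by apply: integral_ge0 => w _|exact: fC].
  have := @cvg_geometric_eseries_half R (C * 2) 0; rewrite expr0 divr1.
  rewrite (_ : eseries _ = fun n => (\sum_(0 <= j < n) (C / 2 ^+ j)%:E)%E).
    by move/cvg_lim => -> //; rewrite ltry.
  apply/funext => n; apply: eq_bigr => j _; congr EFin.
  by rewrite natrX addn1 exprS; field; rewrite expf_neq0.
have := integrable_ae measurableT iS.
apply: filterS => w /(_ I) Sw.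
have tail : (\sum_(N <= k <oo) f k w)%E @[N --> \oo] --> 0%E.
  by apply: nneseries_tail_cvg => //; rewrite -ge0_fin_numE// nneseries_ge0.
have : \forall N \near \oo, (\sum_(N <= k <oo) f k w < 1)%E.
  by move/fine_cvgP: tail => [fN /cvgr_lt/(_ _ ltr01)]; apply: filterS2 fN => N fN; rewrite -lte_fin/= fineK.
apply: filterS => N; apply: le_lt_trans.
have h : (\sum_(N <= k < N.+1) f k w <= \sum_(N <= k <oo) f k w)%E.
  by apply: nneseries_lim_ge => k _ _.
by move: h; rewrite big_nat1.
Qed.

(** * The noise in bounded boxes *)

Section boxes.
Context {R : realType}.

Definition box (N : nat) : set (noise_pt R) :=
  noise_dom (R := R) `&` [set q | qs q <= N%:R] `&` [set q | qu q <= N%:R] `&`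
  [set q | (qn q <= N)%N].

Lemma measurable_box N : measurable (box N).
Proof.
apply: measurableI; last exact: (measurable_qn_set [set n | (n <= N)%N]).
apply: measurableI; last first.
  by apply: measurable_le_set; [exact: measurable_qu|exact: measurable_cst].
by apply: measurableI; [exact: measurable_noise_dom|exact: measurable_qs_le].
Qed.

Lemma box_dom N : box N `<=` noise_dom (R := R).
Proof. by move=> q [[[]]]. Qed.

Lemma box_le N N' : (N <= N')%N -> box N `<=` box N'.
Proof.
move=> NN q [[[Dq qs'] qu'] qn']; split; last exact: (@leq_trans N).
have NR : N%:R <= N'%:R :> R by rewrite ler_nat.
by split; [split => //=; exact: le_trans NR|exact: le_trans NR].
Qed.

Lemma box_past N : box N `<=` past N%:R.
Proof. by move=> q [[[Dq qs'] _] _]. Qed.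

Lemma bigcup_box : \bigcup_N box N = noise_dom (R := R).
Proof.
apply/seteqP; split => [q [N _ /box_dom//]|q Dq].
pose N := maxn (qn q) (maxn (Num.truncn (qs q)).+1 (Num.truncn (qu q)).+1).
exists N => //; split; last exact: leq_maxl.
split; first split => //; apply/ltW; apply: (lt_le_trans (truncnS_gt _)).
  by rewrite ler_nat /N leq_max leq_max leqnn orbT.
by rewrite ler_nat /N leq_max leq_max leqnn !orbT.
Qed.

Lemma box_above N q : box N q -> 0 < qs q <= N%:R.
Proof.
by move=> [[[Dq qs'] _] _]; rewrite qs' andbT; move: Dq; rewrite noise_domE => -[].
Qed.

Lemma lebesgue_measure_oc (x y : R) : x <= y ->
  lebesgue_measure (`]x, y]%classic : set R) = (y - x)%:E.
Proof.
move=> xy; rewrite lebesgue_measure_itv/= lte_fin; case: ltP => // yx.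
by rewrite (_ : y = x) ?subrr//; apply/eqP; rewrite eq_le yx.
Qed.

Variable Ginf : probability (zseq R) R.

Definition noise_intensity : {measure set (noise_pt R) -> \bar R} := intensity Ginf.

Definition strip (N : nat) (a b : R) : set (noise_pt R) :=
  box N `&` [set q | a < qs q <= b].

Lemma measurable_strip N a b : measurable (strip N a b).
Proof.
apply: measurableI; first exact: measurable_box.
have -> : [set q : noise_pt R | a < qs q <= b] = [set q | a < qs q] `&` [set q | qs q <= b].
  by apply/seteqP; split => q /=; [move=> /andP[]|move=> [-> ->]].
by apply: measurableI; [exact: measurable_qs_gt|exact: measurable_qs_le].
Qed.

Lemma intensity_strip N : exists2 c : R, 0 <= c & forall a b, a <= b ->
  (noise_intensity (strip N a b) <= (c * (b - a))%:E)%E.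
Proof.
have finN : finite_set [set n | (n <= N)%N].
  by apply: (sub_finite_set _ (finite_II N.+1)) => n /=; rewrite ltnS.
have [cN cNE] : exists cN : nat, @counting nat R [set n | (n <= N)%N] = cN%:R%:E.
  by rewrite /counting asboolT//; eexists.
exists (N%:R * cN%:R) => [|a b ab]; first by rewrite mulr_ge0.
pose Q : set (noise_pt R) := (((`]a, b]%classic `*` `]0%R, N%:R]%classic) `*`
  ((`]0%R, 1%R]%classic `*` [set n | (n <= N)%N]) `*` [set: zseq R])) `*` `]0%R, 1%R]%classic).
have mQ : measurable Q.
  by do !apply: measurableX => //.
apply: (@le_trans _ _ (noise_intensity Q)).
  apply: (le_measure noise_intensity); rewrite ?inE; [exact: measurable_strip|exact: mQ|].
  move=> -[[[s u] [[y n] z]] v] [[[[Dq sN] uN] nN] ab'].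
  move: Dq => [s0 u0 [y01 _] v01].
  by rewrite /Q /= !in_itv/=; repeat split => //; rewrite ?u0 ?uN.
change (noise_intensity Q) with (intensity0 Ginf Q).
rewrite /Q /intensity0 product_measureE; [|by do !apply: measurableX|by []].
rewrite /time_mark_measure product_measureE; [|by do !apply: measurableX|by do !apply: measurableX].
rewrite /lebesgue2 /mark_measure /lebesgue_counting !product_measureE => //; last by do !apply: measurableX.
rewrite [X in (_ * (_ * X * _) * _)%E](_ : _ = cN%:R%:E)//.
rewrite [X in (_ * (_ * _ * X) * _)%E](_ : _ = 1%E); last exact: probability_setT.
have -> : (N%:R * cN%:R * (b - a))%:E = ((b - a)%:E * (N%:R - 0)%:E * ((1 - 0)%:E * cN%:R%:E * 1) * (1 - 0)%:E)%E :> \bar R.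
  by rewrite mule1 -!EFinM; congr EFin; ring.
by rewrite le_eqVlt; apply/orP; left; apply/eqP; congr (_ * _ * (_ * _ * _) * _)%E; exact: lebesgue_measure_oc.
Qed.

Lemma intensity_box N : (noise_intensity (box N) < +oo)%E.
Proof.
have [c c0 hc] := intensity_strip N.
rewrite (_ : box N = strip N 0 N%:R); last first.
  by apply/seteqP; split => q [] //= bq; split => //; exact: box_above.
by apply: le_lt_trans (hc _ _ _) _; rewrite ?ltry.
Qed.

End boxes.

(** * A version of the noise with integer values *)

Section poisson_law.
Context {R : realType}.

Lemma poisson_total (r : R) : (\sum_(0 <= k <oo) poisson_prob r 0 [set k] = 1)%E.
Proof.
rewrite -(probability_setT (poisson_prob r 0)).
have e : [set: nat] = \bigcup_k [set k] by apply/seteqP; split => k // _; exists k.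
rewrite e; apply/esym/(@measure_semi_bigcup _ _ _ (poisson_prob r 0)) => //.
by move=> i j _ _ [k [/= -> ->]].
Qed.

Lemma poisson_pos (r : R) k : 0 < r -> poisson_prob r 0 [set k] = (poisson_pmf r k)%:E.
Proof. by move=> r0; rewrite /poisson_prob r0 esum_set1// lee_fin poisson_pmf_ge0. Qed.

Lemma poisson_mean (r : R) : 0 <= r ->
  (\sum_(0 <= k <oo) k%:R%:E * poisson_prob r 0 [set k] = r%:E)%E.
Proof.
rewrite le_eqVlt => /predU1P[<-|r0].
  rewrite eseries0// => k _ _; rewrite /poisson_prob ltxx diracE.
  by case: k => [|k]; [rewrite mul0e|rewrite memNset ?mule0].
rewrite nneseries_recl//; last by move=> k _; rewrite mule_ge0.
rewrite -nneseries_addn; last by move=> k; rewrite mule_ge0.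
under eq_eseriesr do rewrite addn1.
rewrite mul0e add0e -[RHS]mule1 -(poisson_total r) -nneseriesZl//.
apply: eq_eseriesr => k _; rewrite !poisson_pos// -!EFinM; congr EFin.
rewrite /poisson_pmf r0 factS natrM exprS; field.
by rewrite pnatr_eq0 -lt0n fact_gt0 /= addrC natr1 pnatr_eq0.
Qed.

Lemma poisson_01 (r : R) : 0 <= r ->
  ((1 - r ^+ 2)%:E <= poisson_prob r 0 [set 0%N] + poisson_prob r 0 [set 1%N])%E.
Proof.
rewrite le_eqVlt => /predU1P[<-|r0].
  rewrite expr0n/= subr0 /poisson_prob ltxx !diracE mem_set// memNset//.
  by rewrite adde0.
rewrite !poisson_pos// -EFinD lee_fin /poisson_pmf r0 expr0 expr1 fact0 invr1 !mulr1.
have -> : 1 - r ^+ 2 = (1 + r) * (1 - r) by ring.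
rewrite -[leRHS]mulrDl ler_wpM2l ?addr_ge0// ?(ltW r0)//.
by have := expR_ge1Dx (- r).
Qed.

End poisson_law.

Section integer_noise.
Context {R : realType} (Ginf : probability (zseq R) R).
Context {d : measure_display} {Omega : measurableType d} (P : probability Omega R).
Variables (F : R -> set (set Omega)) (M : Omega -> {measure set (noise_pt R) -> \bar R}).
Variable X0 : Omega -> dist_fun R.
Hypothesis h_F : usual_filtration P F.
Hypothesis h_M : poisson_random_measure P F (intensity Ginf) M.
Hypothesis h_X0 : init_sigma X0 `<=` F 0.

Local Notation lam := (noise_intensity Ginf).

(** The natural filtration at time t as a structure on a type, so that being
    adapted is measurability of functions on that type. *)
Definition history (t : R) :=
  g_sigma_algebraType (init_sigma X0 `|` noise_sigma M (past t) `|` P.-negligible).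

Lemma filtration_measurable t A : 0 <= t -> F t A -> measurable A.
Proof. by move=> t0; case: h_F => /(_ _ t0)[_ h] _ _ _; exact: h. Qed.

Lemma history_filtration t (A : set Omega) : 0 <= t -> measurable (A : set (history t)) -> F t A.
Proof.
move=> t0; case: h_F => sF mF _ nF; apply: smallest_sub; first by case: (sF t t0).
move=> B [[]|]; first by move=> /h_X0; apply: mF.
  by case: h_M => h _ _ _; exact: h.
by move=> /nF; exact: mF.
Qed.

Lemma history_measurable t (A : set Omega) : 0 <= t ->
  measurable (A : set (history t)) -> measurable A.
Proof. by move=> t0 /(history_filtration t0); exact: filtration_measurable. Qed.

Lemma history_negligible t N : P.-negligible N -> measurable (N : set (history t)).
Proof. by move=> PN; apply: sub_sigma_algebra; right. Qed.

Lemma history_noise t B C : measurable B -> B `<=` past t -> measurable C ->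
  measurable ((fun w => M w B) @^-1` C : set (history t)).
Proof.
move=> mB Bt mC; apply: sub_sigma_algebra; left; right.
by apply: sub_sigma_algebra; exists B, C.
Qed.

Lemma history_init t x : measurable_fun [set: history t] (fun w => X0 w x).
Proof.
move=> _ C mC; rewrite setTI; apply: sub_sigma_algebra; left; left.
by apply: sub_sigma_algebra; exists x, C.
Qed.

Lemma box_fin N B : measurable B -> B `<=` box N -> (lam B < +oo)%E.
Proof.
move=> mB BN; apply: le_lt_trans (intensity_box Ginf N).
by apply: le_measure; rewrite ?inE//; exact: measurable_box.
Qed.

Lemma noise_law N B k : measurable B -> B `<=` box N ->
  P ((fun w => M w B) @^-1` [set (k%:R)%:E]) = poisson_prob (fine (lam B)) 0 [set k].
Proof.
move=> mB BN; case: h_M => _ _ h _; apply: h => //; first by move=> q /BN/box_dom.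
exact: box_fin BN.
Qed.

Lemma noise_natural_as N B : measurable B -> B `<=` box N ->
  {ae P, forall w, natural_value (M w B)}.
Proof.
move=> mB BN; pose E k := (fun w => M w B) @^-1` [set (k%:R)%:E].
have mE k : measurable (E k).
  apply: (@history_measurable N%:R) => //; apply: history_noise => // q /BN; exact: box_past.
have tE : trivIset setT E.
  move=> i j _ _ [w []]; rewrite /E/= => -> [] /eqP; rewrite eqr_nat => /eqP; exact.
have PE : P (\bigcup_k E k) = 1%E.
  rewrite measure_semi_bigcup//; last exact: bigcup_measurable.
  rewrite -[RHS](poisson_total (fine (lam B))); apply: eq_eseriesr => k _; exact: noise_law BN.
exists (~` \bigcup_k E k); split.
- by apply: measurableC; exact: bigcup_measurable.
- by rewrite probability_setC ?PE ?subee//; exact: bigcup_measurable.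
- by move=> w /= h [k _ Ek]; apply: h; exists k.
Qed.

Definition good : set Omega := [set w | forall N B, measurable B ->
  natural_value (M w (B `&` box N))].

Lemma good_ae : P.-negligible (~` good).
Proof.
have [C [mC gC]] := countably_generated_noise R.
have mCs (s : seq nat) : measurable (\bigcap_(i in [set` s]) C i).
  by apply: fin_bigcap_measurable => // i _.
have [e eK] : exists e : nat -> seq nat, forall s, exists k, e k = s.
  exists (fun k => odflt [::] (@choice.unpickle (seq nat) k)) => s.
  by exists (choice.pickle s); rewrite choice.pickleK.
have h : {ae P, forall w, forall N k,
    natural_value (M w ((\bigcap_(i in [set` e k]) C i) `&` box N))}.
  apply: ae_foralln => N; apply: ae_foralln => k.
  apply: (@noise_natural_as N); last by move=> q [].
  by apply: measurableI => //; exact: measurable_box.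
apply: negligibleS h => w; apply: contra_not => /= h N B mB.
have hs (s : seq nat) : natural_value (M w ((\bigcap_(i in [set` s]) C i) `&` box N)).
  by have [k <-] := eK s; exact: h.
apply: (natural_value_ext mC gC _ _ hs) => //; first exact: measurable_box.
have [k] := hs [::]; rewrite (_ : \bigcap_(i in _) _ = setT) ?setTI; last by apply/seteqP; split.
by move=> ->; rewrite ltry.
Qed.

(** Setting the noise to zero on the null event where some value is not an integer
    gives integer values at every outcome, as the pathwise results require. The
    event belongs to every [history], which contains the null sets. *)
Definition noise (w : Omega) : {measure set (noise_pt R) -> \bar R} :=
  if pselect (good w) then M w else mzero.

Lemma noise_good w : good w -> noise w = M w.
Proof. by rewrite /noise; case: pselect. Qed.

Lemma noise_bad w B : ~ good w -> noise w B = 0%E.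
Proof. by rewrite /noise; case: pselect. Qed.

Lemma noise_natural w N B : measurable B -> natural_value (noise w (B `&` box N)).
Proof.
move=> mB; have [h|h] := pselect (good w); first by rewrite noise_good//; exact: h.
by rewrite noise_bad//; exists 0%N.
Qed.

Lemma noise_natural_sub w N B : measurable B -> B `<=` box N -> natural_value (noise w B).
Proof. by move=> mB BN; rewrite -(setIidl BN); exact: noise_natural. Qed.

Lemma noise_fin w N : (noise w (box N) < +oo)%E.
Proof.
by have [k ->] := @noise_natural_sub w N _ (measurable_box N) (@subset_refl _ _); rewrite ltry.
Qed.

Lemma noise_lt1 w B : measurable B -> B `<=` noise_dom (R := R) ->
  (noise w B < 1)%E -> noise w B = 0%E.
Proof.
move=> mB BD B1; apply: measure_negligible => //.
rewrite -(setIidl BD) -bigcup_box setI_bigcupr; apply: negligible_bigcup => N.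
have mBN : measurable (B `&` box N) by apply: measurableI => //; exact: measurable_box.
exists (B `&` box N); split => //.
apply: natural_value_lt1; first exact: noise_natural.
by apply: le_lt_trans B1; apply: le_measure; rewrite ?inE//; exact: subIsetl.
Qed.

Lemma brood_box_fin w N : (brood (noise w) (box N) < +oo)%E.
Proof.
have -> : brood (noise w) (box N) =
    (\sum_(0 <= i < N) noise w (box N `&` [set q | (i < qn q)%N]))%E.
  apply/cvg_lim => //; apply: cvg_near_cst; exists N => // n /= Nn.
  rewrite (@big_cat_nat _ _ _ N)//=.
  rewrite [X in (_ + X)%E]big_nat_cond [X in (_ + X)%E]big1 ?adde0// => i.
  rewrite andbT => /andP[Ni _]; rewrite (_ : _ `&` _ = set0) ?measure0//.
  apply/seteqP; split => q //= -[[_ /= qN] iq].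
  by move: (leq_ltn_trans Ni (leq_trans iq qN)); rewrite ltnn.
apply/lte_sum_pinfty => i _; apply: le_lt_trans (noise_fin w N).
apply: le_measure; rewrite ?inE; [|exact: measurable_box|exact: subIsetl].
by apply: measurableI; [exact: measurable_box|exact: (measurable_qn_set [set n | (i < n)%N])].
Qed.

Lemma measurable_noise_history t N B : measurable B -> B `<=` past t -> B `<=` box N ->
  measurable_fun [set: history t] (fun w => noise w B).
Proof.
move=> mB Bt BN _ C mC; rewrite setTI.
have ng : measurable (~` good : set (history t)) by apply: history_negligible; exact: good_ae.
have -> : (fun w => noise w B) @^-1` C = ((fun w => M w B) @^-1` C `&` good) `|`
    (if pselect (C 0%E) then ~` good else set0).
  apply/seteqP; split => w /=.
    have [h|h] := pselect (good w); first by rewrite noise_good//; left.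
    by rewrite noise_bad// => C0; right; case: pselect.
  move=> [[Cw gw]|]; first by rewrite noise_good.
  by case: pselect => // C0 gw; rewrite noise_bad.
apply: measurableU; last by case: pselect => //= _; exact: measurable0.
apply: measurableI; first exact: history_noise.
by rewrite -[good]setCK; exact: measurableC.
Qed.

Lemma measurable_noise_box N B : measurable B -> B `<=` box N ->
  measurable_fun [set: Omega] (fun w => noise w B).
Proof.
move=> mB BN _ C mC; rewrite setTI; apply: (@history_measurable N%:R) => //.
have mh : measurable_fun [set: history N%:R] (fun w => noise w B).
  by apply: (@measurable_noise_history _ N) => // q /BN/box_past.
by have := mh measurableT C mC; rewrite setTI.
Qed.

Lemma noise_law_indep N a (A : set Omega) B k : 0 <= a -> measurable (A : set (history a)) ->
  measurable B -> B `<=` box N -> B `<=` future a ->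
  P (A `&` (fun w => noise w B) @^-1` [set (k%:R)%:E]) =
  (P A * poisson_prob (fine (lam B)) 0 [set k])%E.
Proof.
move=> a0 mA mB BN Ba.
have mM : measurable ((fun w => M w B) @^-1` [set (k%:R)%:E]).
  by apply: (@history_measurable N%:R) => //; apply: history_noise => // q /BN/box_past.
have mA' := history_measurable a0 mA.
have mn : measurable ((fun w => noise w B) @^-1` [set (k%:R)%:E]).
  by rewrite -[X in measurable X]setTI; apply: (measurable_noise_box mB BN).
rewrite -(noise_law k mB BN).
have [N0 [mN0 PN0 gN0]] := good_ae.
transitivity (P (A `&` (fun w => M w B) @^-1` [set (k%:R)%:E])).
  apply: (measure_eq_off_null mN0 PN0); [exact: measurableI|exact: measurableI|].
  move=> w nw; have gw : good w by apply: contrapT => gw; apply: nw; exact: gN0.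
  by rewrite /= noise_good.
case: h_M => _ h _ _; apply: (h a) => //; first exact: history_filtration.
by apply: sub_sigma_algebra; exists B, [set (k%:R)%:E].
Qed.

Lemma natural_value_sum (x : \bar R) : natural_value x ->
  x = (\sum_(0 <= k <oo) (k%:R * (x == k%:R%:E)%:R)%:E)%E.
Proof.
move=> [n ->]; apply/esym/cvg_lim => //; apply: cvg_near_cst; exists n.+1 => // N /= nN.
rewrite (@big_cat_nat _ _ _ n.+1)//= big_nat_recr//= eqxx mulr1.
rewrite big_nat_cond big1 ?add0e.
  rewrite big_nat_cond big1 ?adde0// => i; rewrite andbT => /andP[ni _].
  by rewrite eqe eqr_nat ltn_eqF// mulr0.
move=> i; rewrite andbT => /andP[_ ni].
by rewrite eqe eqr_nat gtn_eqF// mulr0.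
Qed.

(** The mean is obtained by summing over the possible integer values, for each of
    which the independence of the past factors out the probability of A. *)
Lemma noise_mean N a (A : set Omega) B : 0 <= a -> measurable (A : set (history a)) ->
  measurable B -> B `<=` box N -> B `<=` future a ->
  (\int[P]_(w in A) noise w B = P A * lam B)%E.
Proof.
move=> a0 mA mB BN Ba; have mA' := history_measurable a0 mA.
pose E k := (fun w => noise w B) @^-1` [set (k%:R)%:E].
have mE k : measurable (E k).
  by rewrite -[X in measurable X]setTI; apply: (measurable_noise_box mB BN).
transitivity (\int[P]_(w in A) \sum_(0 <= k <oo) (k%:R * \1_(E k) w)%:E)%E.
  apply: eq_integral => w _; rewrite [LHS]natural_value_sum; last exact: noise_natural_sub BN.
  apply: eq_eseriesr => k _; congr (_ * _%:R)%:E; congr nat_of_bool.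
  by rewrite /E; apply/idP/idP => [/eqP h|]; [rewrite inE|rewrite inE => /eqP].
rewrite integral_nneseries//; last first.
  by move=> k; apply/measurable_EFinP; apply: measurable_funM => //; exact: measurable_indic.
transitivity (\sum_(0 <= k <oo) ((fine (P A))%:E * (k%:R%:E * poisson_prob (fine (lam B)) 0 [set k])))%E.
  apply: eq_eseriesr => k _; rewrite (@integralZl_indic _ _ _ P A mA' (fun=> E k))//; last first.
    by move=> k0; move: (ler0n R k); rewrite leNgt k0.
  have := noise_law_indep k a0 mA mB BN Ba; rewrite -/(E k) setIC => e.
  rewrite integral_indic//; transitivity (k%:R%:E * (P A * poisson_prob (fine (lam B)) 0 [set k]))%E.
    by congr (_ * _)%E; exact: e.
  by rewrite fineK ?muleA ?fin_num_measure// (muleC _ (P A)).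
rewrite nneseriesZl; last by move=> k _; rewrite mule_ge0.
rewrite poisson_mean ?fine_ge0// fineK; last exact: fin_num_measure.
by rewrite fineK// ge0_fin_numE//; exact: box_fin BN.
Qed.

(** For a Poisson law of mean a, the probability of a value above 1 is
    1 - exp(-a) (1 + a), and exp(-a) is at least 1 - a. *)
Lemma noise_double N B : measurable B -> B `<=` box N ->
  (P [set w | (1 < noise w B)%E] <= lam B * lam B)%E.
Proof.
move=> mB BN.
have Bf : B `<=` future 0.
  move=> q /BN bq; split; first exact: box_dom bq.
  by have /andP[] := box_above bq.
pose E k := (fun w => noise w B) @^-1` [set (k%:R)%:E].
have mE k : measurable (E k).
  by rewrite -[X in measurable X]setTI; apply: (measurable_noise_box mB BN).
have PE k : P (E k) = poisson_prob (fine (lam B)) 0 [set k].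
  rewrite -[RHS]mul1e -(probability_setT P) -(@noise_law_indep N 0 setT B k)//.
  by rewrite setTI.
have lf : lam B = (fine (lam B))%:E by rewrite fineK// ge0_fin_numE//; exact: box_fin BN.
have -> : [set w | (1 < noise w B)%E] = ~` (E 0%N `|` E 1%N).
  apply/seteqP; split => w; rewrite /E /=.
    by move=> h [] e; move: h; rewrite e ?ltxx// lte_fin ltr10.
  have [k ->] := noise_natural_sub w mB BN.
  case: k => [|[|k]]; [by move=> []; left|by move=> []; right|].
  by move=> _; rewrite lte_fin (ltr_nat R 1).
rewrite probability_setC; last exact: measurableU.
rewrite measureU//; last first.
  by apply/seteqP; split => w //=; rewrite /E/= => -[->] [] /eqP; rewrite eq_sym oner_eq0.
rewrite [leRHS](_ : _ = (fine (lam B) ^+ 2)%:E); last by rewrite lf -EFinM expr2.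
have := poisson_01 (fine_ge0 (measure_ge0 lam B)).
rewrite -!PE [X in (1 - X <= _)%E](_ : _ = (fine (P (E 0%N)) + fine (P (E 1%N)))%:E).
  rewrite -{1}(fineK (fin_num_measure P _ (mE 0%N))) -{1}(fineK (fin_num_measure P _ (mE 1%N))).
  by rewrite -EFinD -EFinB !lee_fin => h; lra.
by rewrite EFinD !fineK ?fin_num_measure.
Qed.

End integer_noise.

(** * Measurability of the Euler scheme *)

Section euler_measurable.
Context {R : realType} d (T : measurableType d).
Variables (alpha : R -> R) (p : R -> nat -> R).
Hypotheses (h_alpha : C1_pos alpha) (h_p : forall i, C1_pos (p ^~ i)).
Variables (kappa : T -> {measure set (noise_pt R) -> \bar R}) (x0 : T -> dist_fun R).
Variables (D : set (noise_pt R)) (K : nat) (t : R).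
Hypotheses (mD : measurable D) (D_dom : D `<=` noise_dom (R := R)).
Hypothesis finD : forall w, (kappa w D < +oo)%E.
Hypothesis broodD : forall w, (brood (kappa w) D < +oo)%E.
Let Dt := D `&` [set q | qs q <= t].
Hypothesis mkappa : forall B, measurable B ->
  measurable_fun [set: T] (fun w => kappa w (B `&` Dt)).
Hypothesis mx0 : forall x, measurable_fun [set: T] (fun w => x0 w x).

Let mDt : measurable Dt.
Proof. by apply: measurableI => //; exact: measurable_qs_le. Qed.

Let finDt w : (kappa w Dt < +oo)%E.
Proof.
by apply: le_lt_trans (finD w); apply: le_measure; rewrite ?inE//; exact: subIsetl.
Qed.

Lemma measurable_init_eval dU (U : measurableType dU) (f : U -> T) (r : U -> R) :
  measurable_fun [set: U] f -> measurable_fun [set: U] r ->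
  measurable_fun [set: U] (fun x => x0 (f x) (r x)).
Proof.
move=> mf mr; apply/measurable_EFinP.
pose Gam : set (U * measurableTypeR R) := [set e | 0 < e.2] `&` [set e | e.2 <= r e.1].
have mGam : measurable Gam.
  apply: measurableI; first by apply: measurable_lt_set; [exact: measurable_cst|exact: measurable_snd].
  by apply: measurable_le_set; [exact: measurable_snd|exact: (measurableT_comp mr)].
have := @measurable_slice_mass _ U _ (measurableTypeR R) R (fun x => LS (x0 (f x)))
  `]0%R, +oo[%classic _ (fun x => LS_0y_fin _) _ Gam mGam.
move=> /(_ _ _) h.
apply: eq_measurable_fun (h _ _) => [x _||B mB].
- apply: etrans _ (LS_0x _ _); congr (LS _ _); apply/seteqP; split => y; rewrite /slice /Gam/= !in_itv/= ?andbT.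
    by move=> [[_ ->] ->].
  by move=> /andP[-> ->].
- exact: measurable_itv.
- apply: (measurableT_comp (f := fun w => LS (x0 w) (B `&` `]0%R, +oo[%classic))) => //.
  by apply: measurable_LS => //; exact: measurableI.
Qed.

Lemma measurable_births (Gam : set (T * noise_pt R)) z : measurable Gam ->
  (forall w, slice Gam w `<=` Dt) ->
  measurable_fun [set: T * R] (fun x => births (kappa x.1) (slice Gam x.1) x.2 z).
Proof.
move=> mGam GD; apply: ge0_emeasurable_sum => // i _.
pose Gam' : set ((T * R) * noise_pt R) := [set e | Gam (e.1.1, e.2)] `&`
  ([set e | qs e.2 <= e.1.2] `&` [set e | (i < qn e.2)%N] `&`
   ([set e | e.1.2 < qs e.2 + qz e.2 i] `&` [set e | qs e.2 + qz e.2 i <= e.1.2 + z])).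
have m1 : measurable_fun [set: (T * R) * noise_pt R] (fun e => e.1.1).
  by apply: measurableT_comp.
have m2 : measurable_fun [set: (T * R) * noise_pt R] (fun e => e.1.2).
  by apply: measurableT_comp.
have mq dU (U : measurableType dU) (f : noise_pt R -> U) : measurable_fun [set: noise_pt R] f ->
    measurable_fun [set: (T * R) * noise_pt R] (fun e => f e.2).
  by move=> mf; apply: measurableT_comp.
have msz : measurable_fun [set: (T * R) * noise_pt R] (fun e => qs e.2 + qz e.2 i).
  apply: measurable_funD; first exact: (mq _ _ qs measurable_qs).
  exact: (mq _ _ (qz ^~ i) (measurable_qz i)).
have mGam' : measurable Gam'.
  apply: measurableI.
    have mf : measurable_fun [set: (T * R) * noise_pt R] (fun e => (e.1.1, e.2)).
      by apply: measurable_fun_pair.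
    by have := mf measurableT _ mGam; rewrite setTI.
  apply: measurableI; apply: measurableI.
  - by apply: measurable_le_set => //; apply: mq; exact: measurable_qs.
  - have := mq _ _ _ measurable_qn measurableT [set n | (i < n)%N] I; rewrite setTI; exact.
  - exact: measurable_lt_set.
  - by apply: measurable_le_set => //; exact: measurable_funD.
have := @measurable_slice_mass _ _ _ _ R (fun x : T * R => kappa x.1) Dt mDt
  (fun x => finDt x.1) _ Gam' mGam'.
move=> /(_ _) h; apply: eq_measurable_fun (h _) => [[w s] _|B mB]; last first.
  by apply: (measurableT_comp (f := fun w => kappa w (B `&` Dt))) => //; exact: mkappa.
congr (kappa w _); apply/seteqP; split => q; rewrite /slice /Gam' /child_alive/=.
  by move=> [[Gq [[? ?] [? ?]]] _]; split => //; split => //; exact/andP.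
move=> [Gq [? ? /andP[? ?]]]; split; last exact: GD Gq.
by split.
Qed.

(** Populations at a negative time are irrelevant; the zero measure makes the
    evaluations measurable on the whole space. *)
Definition population_pos (Gam : set (T * noise_pt R)) (x : T * R) : dist_fun R :=
  if 0 <= x.2 then population (kappa x.1) (x0 x.1) (slice Gam x.1) x.2 else dist_fun_zero.

Lemma measurable_population (Gam : set (T * noise_pt R)) z : measurable Gam ->
  (forall w, slice Gam w `<=` Dt) ->
  measurable_fun [set: T * R] (fun x => population_pos Gam x z).
Proof.
move=> mGam GD; have [z0|z0] := leP z 0.
  rewrite (_ : (fun x => _) = cst 0); first exact: measurable_cst.
  by apply/funext => x; rewrite dist_le0.
pose f (x : T * R) : \bar R := ((x0 x.1 (z + x.2) - x0 x.1 x.2)%:E +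
  births (kappa x.1) (slice Gam x.1) x.2 z)%E.
rewrite (_ : (fun x => _) = (fun x => if 0 <= x.2 then fine (f x) else 0)); last first.
  apply/funext => -[w s]; rewrite /population_pos /=; case: ifPn => [s0|_]; last exact: dist_fun_zeroE.
  rewrite /f/= -populationE//; first exact: measurable_slice.
  apply: le_lt_trans (broodD w); apply: brood_le => //; first exact: measurable_slice.
  by move=> q /GD[].
apply: measurable_fun_if => //.
- by apply: (measurable_fun_ler (f := cst 0)) => //; exact: measurable_snd.
- apply: (measurable_funS measurableT) => //.
  apply: (measurableT_comp (f := @fine R)); first exact: fine_measurable.
  apply: emeasurable_funD; last exact: measurable_births.
  apply/measurable_EFinP; apply: measurable_funB; apply: measurable_init_eval => //.
  by apply: measurable_funD.
Qed.

Let measurable_second (B : set (noise_pt R)) : measurable B ->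
  measurable [set x : T * noise_pt R | B x.2].
Proof.
move=> mB; rewrite -[X in measurable X]setTI.
exact: (@measurable_snd _ _ T (noise_pt R) measurableT B mB).
Qed.

Notation acc w := (accepted alpha p (kappa w) (x0 w) D K).

Lemma measurable_decision (Gam : set (T * noise_pt R)) : measurable Gam ->
  (forall w, slice Gam w `<=` Dt) ->
  measurable [set x : T * noise_pt R | D x.2 /\
    accepts alpha p (population (kappa x.1) (x0 x.1) (slice Gam x.1) (qs x.2))
      (qu x.2) (qy x.2) (qn x.2) (qv x.2)].
Proof.
move=> mGam GD.
have mq dU (U : measurableType dU) (f : noise_pt R -> U) : measurable_fun [set: noise_pt R] f ->
    measurable_fun [set: T * noise_pt R] (fun e => f e.2).
  by move=> mf; apply: measurableT_comp.
have -> : [set x : T * noise_pt R | D x.2 /\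
    accepts alpha p (population (kappa x.1) (x0 x.1) (slice Gam x.1) (qs x.2))
      (qu x.2) (qy x.2) (qn x.2) (qv x.2)] =
  (snd @^-1` D) `&` [set x | accepts alpha p (population_pos Gam (x.1, qs x.2))
      (qu x.2) (qy x.2) (qn x.2) (qv x.2)].
  have q0 q : D q -> 0 <= qs q by move=> /D_dom; rewrite noise_domE => -[/ltW].
  apply/seteqP; split => -[w q] /=; rewrite /population_pos/=.
    by move=> [Dq]; rewrite (q0 q Dq) => aq; exact: conj Dq aq.
  by move=> [Dq]; rewrite (q0 q Dq) => aq; exact: conj Dq aq.
apply: measurableI; first exact: measurable_second.
apply: (measurable_accepts h_alpha h_p (K := fun x => population_pos Gam (x.1, qs x.2))).
- move=> z; apply: (measurableT_comp (measurable_population z mGam GD)).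
  by apply: measurable_fun_pair => //; apply: mq; exact: measurable_qs.
- by apply: mq; exact: measurable_qu.
- by apply: mq; exact: measurable_qy.
- by apply: mq; exact: measurable_qv.
- by apply: mq; exact: measurable_qn.
Qed.

Definition newborn i : set (T * noise_pt R) := [set x | (D `&` cell K i) x.2 /\
  accepts alpha p (population (kappa x.1) (x0 x.1) (acc x.1 i) (qs x.2))
    (qu x.2) (qy x.2) (qn x.2) (qv x.2)].

Definition accepted_upto i : set (T * noise_pt R) :=
  [set x | acc x.1 i x.2 /\ qs x.2 <= t].

Let measurable_newborn_of i : grid K i <= t -> measurable (accepted_upto i) ->
  measurable (newborn i).
Proof.
move=> it mi.
have sl w : slice (accepted_upto i) w = acc w i.
  apply/seteqP; split => q; first by case.
  move=> aq; split => //; have [_ /andP[_ /= h]] := accepted_sub aq.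
  exact: le_trans it.
have -> : newborn i = (snd @^-1` cell K i) `&` [set x : T * noise_pt R | D x.2 /\
    accepts alpha p (population (kappa x.1) (x0 x.1) (slice (accepted_upto i) x.1) (qs x.2))
      (qu x.2) (qy x.2) (qn x.2) (qv x.2)].
  apply/seteqP; split => -[w q]; rewrite /newborn/= sl; first by move=> [[]].
  by move=> [? []].
apply: measurableI; first by apply: measurable_second; exact: measurable_cell.
apply: measurable_decision => //.
by move=> w q; rewrite sl => aq; have [Dq /andP[_ /= h]] := accepted_sub aq; split => //=; exact: le_trans it.
Qed.

(** By induction on the cells: a decision before time t looks only at decisions of
    earlier cells. The noise and the initial value have to be measurable only as
    far as the time t is concerned, which is why the scheme is adapted. *)
Lemma measurable_accepted i : measurable (accepted_upto i).
Proof.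
elim: i => [|i IH].
  by rewrite (_ : accepted_upto 0 = set0)//; apply/seteqP; split => // x [].
have [ti|it] := ltP t (grid K i).
  rewrite (_ : accepted_upto i.+1 = accepted_upto i)//; apply/seteqP; split => -[w q] /=.
    move=> [[//|[[_ /andP[iq _]] _]]] qt; move: (le_lt_trans qt (lt_trans ti iq)).
    by rewrite ltxx.
  by move=> [aq qt]; split => //; left.
have mn := measurable_newborn_of it IH.
rewrite (_ : accepted_upto i.+1 = accepted_upto i `|` (newborn i `&` [set x | qs x.2 <= t])).
  apply: measurableU => //; apply: measurableI => //.
  exact: (measurable_second (measurable_qs_le t)).
apply/seteqP; split => -[w q] /=.
  by move=> [[aq|aq] qt]; [left|right].
by move=> [[aq qt]|[aq qt]]; split => //; [left|right].
Qed.

Lemma measurable_newborn i : grid K i <= t -> measurable (newborn i).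
Proof. by move=> it; apply: measurable_newborn_of => //; exact: measurable_accepted. Qed.

Lemma measurable_euler_path z : 0 <= t ->
  measurable_fun [set: T] (fun w => euler_path alpha p (kappa w) (x0 w) D K t z).
Proof.
move=> t0; pose Gam := \bigcup_i accepted_upto i.
have mGam : measurable Gam by apply: bigcup_measurable => i _; exact: measurable_accepted.
have GD w : slice Gam w `<=` Dt.
  by move=> q [i _ [aq qt]]; have [Dq _] := accepted_sub aq; split.
have m := measurable_population z mGam GD.
have mp : measurable_fun [set: T] (fun w => (w, t)) by exact: measurable_fun_pair.
apply: eq_measurable_fun (measurableT_comp m mp) => w _ /=.
rewrite /population_pos /= t0; congr (dist_cumulative _ z).
apply: population_births => x; apply: births_upto; apply/seteqP; split => q /=.
  by move=> [[i _ [aq _]] qt]; split => //; exists i.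
by move=> [[i _ aq] qt]; split => //; exists i.
Qed.

End euler_measurable.

(** * Mean number of births *)

Lemma mean_offspring_ge0 (R : realType) (p : R -> nat -> R) (C : R) :
  (forall a n, 0 <= p_ext p a n) ->
  (forall a, (\sum_(0 <= n <oo) (n%:R * p_ext p a n)%:E <= C%:E)%E) -> 0 <= C.
Proof.
move=> p0 /(_ 0%E); rewrite -lee_fin; apply: le_trans.
by apply: nneseries_ge0 => n _ _; rewrite lee_fin mulr_ge0.
Qed.

Section intensity_bound.
Context {R : realType} (Ginf : probability (zseq R) R).
Variables (alpha : R -> R) (p : R -> nat -> R).
Hypotheses (h_alpha : C1_pos alpha) (h_p : forall i, C1_pos (p ^~ i)).
Variable Y : R -> dist_fun R.
Hypothesis mY : forall x, measurable_fun [set: R] (fun s => Y s x).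

Definition offspring_bound (s y : R) (n : nat) : R :=
  p_ext p (A_quantile alpha (Y s) y) n.

Lemma measurable_nat_family d d' (T : measurableType d) (U : measurableType d')
    (g : nat -> T -> U) (n : T -> nat) :
  (forall k, measurable_fun [set: T] (g k)) -> measurable_fun [set: T] n ->
  measurable_fun [set: T] (fun x => g (n x) x).
Proof.
move=> mg mn _ B mB; rewrite setTI.
rewrite (_ : _ @^-1` B = \bigcup_k (n @^-1` [set k] `&` g k @^-1` B)).
  apply: bigcup_measurable => k _; apply: measurableI.
    by rewrite -[X in measurable X]setTI; exact: mn.
  by rewrite -[X in measurable X]setTI; exact: mg.
by apply/seteqP; split => x /= => [|[k _ [<-]]//]; exists (n x).
Qed.

Lemma measurable_offspring_bound d (T : measurableType d) (s y : T -> R) (n : T -> nat) :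
  measurable_fun [set: T] s -> measurable_fun [set: T] y -> measurable_fun [set: T] n ->
  measurable_fun [set: T] (fun x => offspring_bound (s x) (y x) (n x)).
Proof.
move=> ms my mn; apply: (measurable_nat_family (g := fun k x => offspring_bound (s x) (y x) k)) => // k.
apply: measurable_p_ext => //; apply: (measurable_A_quantile h_alpha) => // z.
exact: (measurableT_comp (mY z)).
Qed.

Hypothesis p_ge0 : forall a n, 0 <= p_ext p a n.

Variable C : R.
Hypothesis hC : forall a, (\sum_(0 <= n <oo) (n%:R * p_ext p a n)%:E <= C%:E)%E.
Variables (a b c : R).
Hypotheses (ab : a <= b) (c0 : 0 <= c).

Notation RR := (measurableTypeR R).
Notation marks := (RR * nat * zseq R)%type.

Let times : set (RR * RR) := `]a, b]%classic `*` `]0, c]%classic.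
Let unit_itv : set RR := `]0, 1]%classic.

Let mtimes : measurable times. Proof. exact: measurableX. Qed.

Let munit : measurable unit_itv. Proof. exact: measurable_itv. Qed.

Let box3 : set ((RR * RR) * (RR * nat)) := times `*` (unit_itv `*` [set: nat]).

Let mbox3 : measurable box3.
Proof.
apply: measurableX; first exact: mtimes.
by apply: measurableX.
Qed.

(** The last coordinate of the noise is integrated out: it contributes the length
    of its interval of acceptance, which is the probability of n children. *)
Let density (x : (RR * RR) * (RR * nat)) : R :=
  \1_box3 x * (x.2.2%:R * offspring_bound x.1.1 x.2.1 x.2.2).

Let density_ge0 x : 0 <= density x.
Proof. by apply: mulr_ge0 => //; apply: mulr_ge0 => //; exact: p_ge0. Qed.

Let measurable_density : measurable_fun [set: (RR * RR) * (RR * nat)] density.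
Proof.
have my : measurable_fun [set: (RR * RR) * (RR * nat)] (fun x => x.2.1).
  exact: (measurableT_comp (f := fst)).
have mn : measurable_fun [set: (RR * RR) * (RR * nat)] (fun x => x.2.2).
  exact: (measurableT_comp (f := snd)).
have ms : measurable_fun [set: (RR * RR) * (RR * nat)] (fun x => x.1.1).
  exact: (measurableT_comp (f := fst)).
apply: measurable_funM; first by apply: measurable_indic; exact: mbox3.
apply: measurable_funM; last exact: measurable_offspring_bound.
exact: (measurableT_comp (f := fun n : nat => n%:R : R)).
Qed.

Let box3E st y n : \1_box3 (st, (y, n)) = \1_times st * \1_unit_itv y :> R.
Proof.
rewrite !indicE -natrM mulnb; congr (nat_of_bool _)%:R.
apply/idP/idP; first by rewrite inE => -[h1 [h2 _]]; rewrite !mem_set.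
by move=> /andP[]; rewrite !inE => h1 h2; split.
Qed.

Let integral_counting st y :
  (\int[@counting nat R]_n (density (st, (y, n)))%:E <= (C * \1_times st * \1_unit_itv y)%:E)%E.
Proof.
rewrite ge0_integral_count; last by move=> n; rewrite lee_fin.
under eq_eseriesr do rewrite /density box3E EFinM.
rewrite nneseriesZl; last by move=> n _; rewrite lee_fin mulr_ge0// p_ge0.
rewrite -mulrA (mulrC C) [X in (_ <= X)%E]EFinM; apply: lee_wpmul2l; first by rewrite lee_fin mulr_ge0.
rewrite /offspring_bound /=; exact: (hC (A_quantile alpha (Y st.1) y)).
Qed.

Let integral_marks (st : RR * RR) :
  (\int[mark_measure Ginf]_w (density (st, w.1))%:E <= (C * \1_times st)%:E)%E.
Proof.
have mst : measurable_fun [set: RR * nat] (fun yn => (density (st, yn))%:E).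
  by apply/measurable_EFinP; exact: (measurableT_comp measurable_density (measurable_pair1 st)).
rewrite (@fubini_tonelli1 _ _ (RR * nat)%type (zseq R) R lebesgue_counting Ginf
  (fun w => (density (st, w.1))%:E)); first last.
- by move=> w; rewrite lee_fin.
- exact: (measurableT_comp mst).
rewrite (_ : (\int[_]_x _ = \int[lebesgue_counting]_yn (density (st, yn))%:E)%E); last first.
  apply: eq_integral => yn _; rewrite /fubini_F/=.
  rewrite (_ : (\int[Ginf]_y _ = (density (st, yn))%:E * Ginf [set: zseq R])%E); last first.
    exact: integral_cst.
  by rewrite probability_setT mule1.
rewrite (@fubini_tonelli1 _ _ RR nat R (@lebesgue_measure R) (@counting nat R)
  (fun yn => (density (st, yn))%:E)); first last.
- by move=> w; rewrite lee_fin.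
- exact: mst.
have C0 := mean_offspring_ge0 p_ge0 hC.
apply: (@le_trans _ _ (\int[@lebesgue_measure R]_y ((C * \1_times st)%:E * (\1_unit_itv y)%:E))%E).
  apply: ge0_le_integral => //.
  - by move=> y _; apply: integral_ge0 => n _; rewrite lee_fin.
  - apply: measurable_fun_fubini_tonelli_F => //; by move=> w; rewrite lee_fin.
  - by apply: measurable_funeM; apply/measurable_EFinP; apply: measurable_indic.
  - by move=> y _; rewrite -EFinM; exact: integral_counting.
rewrite ge0_integralZl//; last 2 first.
- by apply/measurable_EFinP; apply: measurable_indic.
- by rewrite lee_fin mulr_ge0.
rewrite integral_indic// setIT.
rewrite -[leRHS]mule1; apply: lee_wpmul2l; first by rewrite lee_fin mulr_ge0.
by rewrite le_eqVlt; apply/orP; left; apply/eqP; apply: etrans (lebesgue_measure_oc ler01) _; rewrite subr0.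
Qed.

Let integral_density :
  (\int[time_mark_measure Ginf]_w (density (w.1, w.2.1))%:E <= (C * ((b - a) * c))%:E)%E.
Proof.
have C0 := mean_offspring_ge0 p_ge0 hC.
have m1 : measurable_fun [set: (RR * RR) * marks] (fun w => (w.1, w.2.1)).
  by apply: measurable_fun_pair => //; apply: measurableT_comp.
have md : measurable_fun [set: (RR * RR) * marks] (fun w => (density (w.1, w.2.1))%:E).
  by apply/measurable_EFinP; exact: (measurableT_comp measurable_density m1).
rewrite (@fubini_tonelli1 _ _ (RR * RR)%type marks R lebesgue2 (mark_measure Ginf)
  (fun w => (density (w.1, w.2.1))%:E)); first last.
- by move=> w; rewrite lee_fin.
- exact: md.
apply: (@le_trans _ _ (\int[lebesgue2]_st (C%:E * (\1_times st)%:E))%E).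
  apply: ge0_le_integral => //.
  - by move=> y _; apply: integral_ge0 => n _; rewrite lee_fin.
  - apply: measurable_fun_fubini_tonelli_F => //; by move=> w; rewrite lee_fin.
  - by apply: measurable_funeM; apply/measurable_EFinP; apply: measurable_indic.
  - by move=> st _; rewrite -EFinM; exact: integral_marks.
rewrite ge0_integralZl//; last by apply/measurable_EFinP; apply: measurable_indic.
rewrite integral_indic// setIT EFinM; apply: lee_wpmul2l; first by rewrite lee_fin.
rewrite -[X in ((b - a) * X)%:E]subr0 EFinM le_eqVlt; apply/orP; left; apply/eqP.
transitivity (lebesgue_measure (`]a, b]%classic : set RR) * lebesgue_measure (`]0%R, c]%classic : set RR))%E.
  by apply: product_measureE; exact: measurable_itv.
by congr (_ * _)%E; exact: lebesgue_measure_oc.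
Qed.

(** Marks with n children are accepted with rate p(x,n) and count n times. Hence the
    sum over n is the mean offspring at x, bounded uniformly in x, however large
    the numbers of children may be. *)
Lemma brood_intensity (Gam : set (noise_pt R)) : measurable Gam ->
  Gam `<=` [set q | [/\ a < qs q <= b, 0 < qu q <= c, 0 < qy q <= 1 &
                       0 < qv q <= offspring_bound (qs q) (qy q) (qn q)]] ->
  (brood (noise_intensity Ginf) Gam <= (C * ((b - a) * c))%:E)%E.
Proof.
move=> mGam hG; apply: le_trans integral_density.
pose dl l (x : (RR * RR) * (RR * nat)) : R :=
  \1_box3 x * ((l < x.2.2)%N%:R * offspring_bound x.1.1 x.2.1 x.2.2).
have dl0 l x : 0 <= dl l x by rewrite !mulr_ge0// p_ge0.
have m1 : measurable_fun [set: (RR * RR) * marks] (fun w => (w.1, w.2.1)).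
  by apply: measurable_fun_pair => //; apply: measurableT_comp.
have mdl l : measurable_fun [set: (RR * RR) * marks] (fun w => (dl l (w.1, w.2.1))%:E).
  apply/measurable_EFinP; apply: (measurableT_comp (f := dl l) _ m1).
  have my : measurable_fun [set: (RR * RR) * (RR * nat)] (fun x => x.2.1).
    exact: (measurableT_comp (f := fst)).
  have mn : measurable_fun [set: (RR * RR) * (RR * nat)] (fun x => x.2.2).
    exact: (measurableT_comp (f := snd)).
  have ms : measurable_fun [set: (RR * RR) * (RR * nat)] (fun x => x.1.1).
    exact: (measurableT_comp (f := fst)).
  apply: measurable_funM; first by apply: measurable_indic; exact: mbox3.
  apply: measurable_funM; last exact: measurable_offspring_bound.
  exact: (measurableT_comp (f := fun n : nat => (l < n)%N%:R : R)).
rewrite (_ : (\int[_]_w _ = \sum_(0 <= l <oo) \int[time_mark_measure Ginf]_w (dl l (w.1, w.2.1))%:E)%E); last first.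
  rewrite -integral_nneseries//; last by move=> l w _; rewrite lee_fin.
  apply: eq_integral => w _; apply/esym/cvg_lim => //; apply: cvg_near_cst.
  exists w.2.1.2 => // N /= nN; rewrite sumEFin; congr EFin.
  rewrite /dl /density -mulr_sumr -mulr_suml /=; congr (_ * (_ * _)).
  rewrite (@big_cat_nat _ _ _ w.2.1.2)//= [X in _ + X]big_nat_cond [X in _ + X]big1 ?addr0; last first.
    by move=> i; rewrite andbT => /andP[ni _]; rewrite ltnNge ni.
  rewrite big_nat_cond (eq_bigr (fun=> 1)); last by move=> i; rewrite andbT => /andP[_ ->].
  by rewrite -big_nat_cond sumr_const_nat subn0.
apply: lee_nneseries => [//|l _].
have mGl : measurable (Gam `&` [set q | (l < qn q)%N]).
  by apply: measurableI => //; exact: (measurable_qn_set [set n | (l < n)%N]).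
set Gl := _ `&` _ in mGl *.
change (\int[time_mark_measure Ginf]_w (@lebesgue_measure R (xsection Gl w)) <=
  \int[time_mark_measure Ginf]_w (dl l (w.1, w.2.1))%:E)%E.
apply: ge0_le_integral => //.
- exact: (@measurable_fun_xsection _ _ _ _ R (@lebesgue_measure R)).
move=> [[s u] [[y n] z]] _.
have [h|h] := pselect (exists v, Gl (s, u, (y, n, z), v)); last first.
  rewrite (_ : xsection _ _ = set0) ?measure0 ?lee_fin//.
  by apply/seteqP; split => v //; rewrite /xsection/= inE => Gv; case: h; exists v.
have [v0 [/hG[/= sab u0 y0 _] ln]] := h.
rewrite -(_ : offspring_bound s y n = dl l (s, u, (y, n))); last first.
  rewrite /dl /= (_ : (l < n)%N = true)// mul1r indicE mem_set ?mul1r//.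
have e := lebesgue_measure_oc (p_ge0 (A_quantile alpha (Y s) y) n).
rewrite subr0 in e; rewrite -[X in (_ <= X)%E]e.
apply: le_measure; rewrite ?inE//; first exact: (@measurable_xsection _ _ _ _ Gl).
by move=> v; rewrite /xsection /= inE in_itv/= => -[/hG[]].
Qed.

End intensity_bound.

Section moments.
Context {R : realType} (Ginf : probability (zseq R) R).
Context {d : measure_display} {Omega : measurableType d} (P : probability Omega R).
Variables (F : R -> set (set Omega)) (M : Omega -> {measure set (noise_pt R) -> \bar R}).
Variable X0 : Omega -> dist_fun R.
Hypothesis h_F : usual_filtration P F.
Hypothesis h_M : poisson_random_measure P F (intensity Ginf) M.
Hypothesis h_X0 : init_sigma X0 `<=` F 0.
Variables (alpha : R -> R) (p : R -> nat -> R).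
Hypotheses (h_alpha : C1_pos alpha) (h_p : forall i, C1_pos (p ^~ i)).
Hypothesis p_ge0 : forall a n, 0 <= p_ext p a n.
Variables (C Ca : R).
Hypothesis hC : forall a, (\sum_(0 <= n <oo) (n%:R * p_ext p a n)%:E <= C%:E)%E.
Hypotheses (Ca0 : 0 <= Ca) (hCa : forall x, 0 < x -> `|alpha x| <= Ca).
Variables (N K : nat).

Local Notation lam := (noise_intensity Ginf).
Local Notation xi := (noise M).
Local Notation acc w i := (accepted alpha p (xi w) (X0 w) (box N) K i).
Local Notation mass w := (LS (X0 w) `]0%R, +oo[%classic).

Lemma measurable_noise_cut t (B : set (noise_pt R)) : measurable B ->
  measurable_fun [set: history P M X0 t] (fun w => xi w (B `&` (box N `&` [set q | qs q <= t]))).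
Proof.
move=> mB; apply: (@measurable_noise_history _ Ginf _ _ P F M X0 h_F h_M h_X0 _ N).
- apply: measurableI => //; apply: measurableI; [exact: measurable_box|exact: measurable_qs_le].
- by move=> q [_ [/box_dom Dq qt]].
- by move=> q [_ []].
Qed.

Let hnew i : measurable (newborn alpha p (xi : history P M X0 (grid K i) -> _) X0 (box N) K i).
Proof.
apply: (@measurable_newborn _ _ (history P M X0 (grid K i)) alpha p h_alpha h_p xi X0 (box N) K (grid K i)).
- exact: measurable_box.
- exact: box_dom.
- by move=> w; exact: noise_fin.
- by move=> w; exact: brood_box_fin.
- exact: measurable_noise_cut.
- by move=> x; exact: history_init.
- exact: lexx.
Qed.


Local Notation hist i := (history P M X0 (grid K i)).

Let hist0 i : 0 <= (grid K i : R).
Proof. by rewrite -[leLHS](grid0 K) grid_le. Qed.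

Let haccepted i :
  measurable (accepted_upto alpha p (xi : hist i -> _) X0 (box N) K (grid K i) i).
Proof.
apply: (@measurable_accepted _ _ (hist i) alpha p h_alpha h_p xi X0 (box N) K (grid K i)).
- exact: measurable_box.
- exact: box_dom.
- by move=> w; exact: noise_fin.
- by move=> w; exact: brood_box_fin.
- exact: measurable_noise_cut.
- by move=> x; exact: history_init.
Qed.

Let slice_accepted i w :
  slice (accepted_upto alpha p (xi : hist i -> _) X0 (box N) K (grid K i) i) w = acc w i.
Proof.
apply/seteqP; split => q; first by case.
by move=> aq; split => //; have [_ /andP[_]] := accepted_sub aq.
Qed.

Lemma measurable_accepted_noise i w : measurable (acc w i).
Proof. by rewrite -slice_accepted; exact: measurable_slice. Qed.

Let acc_fin i w : (brood (xi w) (acc w i) < +oo)%E.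
Proof.
apply: le_lt_trans (brood_box_fin M w N); apply: brood_le; [exact: measurable_accepted_noise|exact: measurable_box|].
by move=> q /accepted_sub[].
Qed.

Lemma history_measurable_fun t dU (U : measurableType dU) (f : Omega -> U) : 0 <= t ->
  measurable_fun [set: history P M X0 t] f -> measurable_fun [set: Omega] f.
Proof.
move=> t0 mf _ B mB; rewrite setTI; apply: (history_measurable h_F h_M h_X0 t0).
by have := mf measurableT B mB; rewrite setTI.
Qed.

(** The initial mass need not have a finite mean. These events exhaust the sample
    space and make all the means finite. *)
Definition small (k : nat) : set Omega := [set w | (mass w <= k%:R%:E)%E].

Lemma measurable_small t k : measurable (small k : set (history P M X0 t)).
Proof.
have mf : measurable_fun [set: history P M X0 t] (fun w => mass w).
  by apply: (measurable_LS (T := history P M X0 t)) => // x; exact: history_init.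
have := emeasurable_fun_infty_c measurableT mf k%:R%:E.
by rewrite setTI.
Qed.

Let msmall k : measurable (small k).
Proof.
by apply: (history_measurable h_F h_M h_X0 (lexx 0)); exact: measurable_small.
Qed.

Let mbrood_acc i : measurable_fun [set: Omega] (fun w => brood (xi w) (acc w i)).
Proof.
apply: ge0_emeasurable_sum => // l _.
apply: (history_measurable_fun (hist0 i)).
pose Gam := accepted_upto alpha p (xi : hist i -> _) X0 (box N) K (grid K i) i `&`
  [set x | (l < qn x.2)%N].
have mGam : measurable Gam.
  apply: measurableI; first exact: haccepted.
  rewrite -[X in measurable X]setTI.
  exact: (@measurable_snd _ _ (hist i) (noise_pt R) measurableT _ (measurable_qn_set [set n | (l < n)%N])).
have mD : measurable (box N `&` [set q : noise_pt R | qs q <= grid K i]).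
  by apply: measurableI; [exact: measurable_box|exact: measurable_qs_le].
have fD w : (xi w (box N `&` [set q : noise_pt R | (qs q <= grid K i)%R]) < +oo)%E.
  apply: le_lt_trans (noise_fin M w N); apply: le_measure; rewrite ?inE//.
  exact: measurable_box.
have := @measurable_slice_mass _ (hist i) _ _ _ _ _ mD fD (@measurable_noise_cut (grid K i)) _ mGam.
apply: eq_measurable_fun => w _; congr (xi w _); apply/seteqP; split => q.
  by move=> [[[aq _] lq] _].
by move=> [aq lq]; have [Bq /andP[_ ql]] := accepted_sub aq; split.
Qed.

Let late i := box N `&` [set q : noise_pt R | grid K i < qs q].

Let mlate i : measurable (late i).
Proof. by apply: measurableI; [exact: measurable_box|exact: measurable_qs_gt]. Qed.

Let newborn_of i (w : Omega) : set (noise_pt R) :=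
  slice (newborn alpha p (xi : hist i -> _) X0 (box N) K i) w.

Let newborn_late i w : newborn_of i w `<=` late i.
Proof. by move=> q [[Bq /andP[iq _]] _]. Qed.

Let mnewborn i w : measurable (newborn_of i w).
Proof. exact: measurable_slice. Qed.

Let newborn_Gam i k l : set (hist i * noise_pt R) :=
  newborn alpha p (xi : hist i -> _) X0 (box N) K i `&`
  ([set x | small k x.1] `&` [set x | (l < qn x.2)%N]).

Let mnewborn_Gam i k l : measurable (@newborn_Gam i k l).
Proof.
apply: measurableI; first exact: hnew.
apply: measurableI.
  have := @measurable_fst _ _ (hist i) (noise_pt R) measurableT (small k) (@measurable_small (grid K i) k).
  rewrite setTI; exact.
rewrite -[X in measurable X]setTI.
exact: (@measurable_snd _ _ (hist i) (noise_pt R) measurableT _ (measurable_qn_set [set n | (l < n)%N])).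
Qed.

Let newborn_GamE i k l w : slice (@newborn_Gam i k l) w `&` late i =
  if w \in small k then newborn_of i w `&` [set q | (l < qn q)%N] else set0.
Proof.
apply/seteqP; split => q.
  by move=> [[nq [sw lq]] _]; rewrite mem_set.
case: ifPn => //; rewrite inE => sw [nq lq]; split; last exact: newborn_late nq.
by split => //; split.
Qed.

Let fin_late i w : (xi w (late i) < +oo)%E.
Proof.
by apply: le_lt_trans (noise_fin M w N); apply: le_measure; rewrite ?inE//; [exact: measurable_box|exact: subIsetl].
Qed.

Let mxi_late i (B : set (noise_pt R)) : measurable B ->
  measurable_fun [set: Omega] (fun w => xi w (B `&` late i)).
Proof.
move=> mB; apply: (measurable_noise_box h_F h_M h_X0 (N := N)); first exact: measurableI.
by move=> q [_ []].
Qed.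

Let id_hist i : measurable_fun [set: Omega] (id : Omega -> hist i).
Proof. by apply: (history_measurable_fun (hist0 i)); exact: measurable_id. Qed.

Let mean_late i (A : set (hist i)) (B : set (noise_pt R)) : measurable A -> measurable B ->
  (\int[P]_(w in (id : Omega -> hist i) @^-1` A) xi w (B `&` late i) =
   P ((id : Omega -> hist i) @^-1` A) * lam (B `&` late i))%E.
Proof.
move=> mA mB; apply: (noise_mean h_F h_M h_X0 (N := N) (hist0 i)) => //.
- exact: measurableI.
- by move=> q [_ []].
- by move=> q [_ [/box_dom ? ?]].
Qed.

Let lam_late i : (lam (late i) < +oo)%E.
Proof. by apply: (@box_fin _ _ N) => //; exact: subIsetl. Qed.

(** The prediction ignores the births of the current cell, so an atom accepted there
    has its second coordinate below Ca times the initial mass plus the number of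
    births of the earlier cells. *)
Let intensity_newborn i w : 
  (brood lam (newborn_of i w) <=
   (C * (K.+1%:R^-1 * Ca))%:E * (mass w + brood (xi w) (acc w i)))%E.
Proof.
set c := Ca * fine (mass w + brood (xi w) (acc w i))%E.
have b0 : (0 <= brood (xi w) (acc w i))%E by exact: nneseries_ge0.
have m0 : (0 <= mass w)%E by [].
have fs : (mass w + brood (xi w) (acc w i) < +oo)%E.
  by apply: lte_add_pinfty; [exact: LS_0y_fin|exact: acc_fin].
have c0 : 0 <= c by rewrite mulr_ge0// fine_ge0// adde_ge0.
pose Y s := population_pos (xi : hist i -> _) X0
  (accepted_upto alpha p (xi : hist i -> _) X0 (box N) K (grid K i) i) (w, s).
have mY x : measurable_fun [set: R] (fun s => Y s x).
  have mp := @measurable_population _ _ (hist i) xi X0 (box N) (grid K i) (measurable_box N)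
    (fun w => noise_fin M w N) (fun w => brood_box_fin M w N) (@measurable_noise_cut (grid K i))
    (fun x => @history_init _ _ _ P M X0 (grid K i) x) _ x (@haccepted i).
  apply: (measurableT_comp (mp _) (measurable_pair1 (w : hist i))).
  move=> w' q; rewrite slice_accepted => /accepted_sub[Bq /andP[_ ?]]; by split.
have ii : (grid K i : R) <= grid K i.+1 by exact: grid_le.
have := brood_intensity Ginf h_alpha h_p mY p_ge0 hC ii c0 (@mnewborn i w).
have -> : C * ((grid K i.+1 - grid K i) * c) =
    C * (K.+1%:R^-1 * Ca) * fine (mass w + brood (xi w) (acc w i))%E.
  by rewrite /c /grid -mulrBl -natrB// subSnn mul1r !mulrA.
rewrite EFinM fineK ?ge0_fin_numE ?adde_ge0//; apply.
move=> q [[Bq ciq] /accepts_bounds[/andP[u0 uc] v0]].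
have := box_dom Bq; rewrite noise_domE => -[q0 _ [qy01 _] _].
have YE : Y (qs q) = population (xi w) (X0 w) (acc w i) (qs q).
  by rewrite /Y /population_pos /= (ltW q0) slice_accepted.
have v1 : 0 < qv q <= offspring_bound alpha p Y (qs q) (qy q) (qn q).
  by rewrite /offspring_bound YE; exact: v0.
refine (And4 ciq _ qy01 v1); apply/andP; split; first exact: u0.
apply: (le_trans uc); rewrite -lee_fin.
apply: (le_trans (pairing_le_mass _ h_alpha hCa)).
rewrite EFinM fineK ?ge0_fin_numE ?adde_ge0//; apply: lee_wpmul2l; first by rewrite lee_fin.
by apply: population_mass; [exact: measurable_accepted_noise|exact: acc_fin|exact: ltW].
Qed.

Let newborn_brood i k :
  (fun w => brood (xi w) (newborn_of i w)) \_ (small k) =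
  (fun w => \sum_(0 <= l <oo) xi w (slice (@newborn_Gam i k l) w `&` late i))%E.
Proof.
apply/funext => w; rewrite patchE; case: ifPn => sw.
  by apply: eq_eseriesr => l _; rewrite newborn_GamE sw.
by rewrite eseries0// => l _ _; rewrite newborn_GamE (negbTE sw) measure0.
Qed.

Let mbrood_newborn i k : measurable_fun (small k) (fun w => brood (xi w) (newborn_of i w)).
Proof.
apply/(measurable_restrictT _ (msmall k)).2; rewrite newborn_brood.
apply: ge0_emeasurable_sum => // l _.
exact: (measurable_frozen (@id_hist i) (mlate i) (fin_late i) (@mxi_late i) (@mnewborn_Gam i k l)).
Qed.

Let mmass : measurable_fun [set: Omega] (fun w => mass w).
Proof.
apply: (history_measurable_fun (lexx 0)).
by apply: (measurable_LS (T := history P M X0 0)) => // x; exact: history_init.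
Qed.

(** The atoms accepted in a cell form a random set, but one that is known at the
    beginning of the cell, and the noise in the cell is independent of it. *)
Let mean_newborn i k :
  (\int[P]_(w in small k) brood (xi w) (newborn_of i w) <=
   \int[P]_(w in small k) ((C * (K.+1%:R^-1 * Ca))%:E * (mass w + brood (xi w) (acc w i))))%E.
Proof.
have fr l := freezing (@id_hist i) (mlate i) (fin_late i) (lam_late i) (@mxi_late i)
  (@mean_late i) (@mnewborn_Gam i k l).
have mfr l := measurable_frozen (@id_hist i) (mlate i) (fin_late i) (@mxi_late i) (@mnewborn_Gam i k l).
have mlam l : measurable_fun [set: Omega] (fun w => lam (slice (@newborn_Gam i k l) w `&` late i)).
  apply: (history_measurable_fun (hist0 i)).
  exact: (@measurable_slice_mass _ (hist i) _ (noise_pt R) R (fun=> lam) (late i) (mlate i) (fun _ => lam_late i) (fun B mB => measurable_cst _) _ (@mnewborn_Gam i k l)).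
rewrite [leLHS]integral_mkcond [leRHS]integral_mkcond.
rewrite newborn_brood.
rewrite integral_nneseries//.
under eq_eseriesr do rewrite fr.
rewrite -integral_nneseries//.
apply: ge0_le_integral => //.
- by move=> w _; exact: nneseries_ge0.
- exact: ge0_emeasurable_sum.
- apply/(measurable_restrictT _ _).1 => //.
  by apply: measurable_funTS; apply: measurable_funeM; exact: emeasurable_funD.
move=> w _; rewrite patchE; case: ifPn => sw.
  apply: le_trans (intensity_newborn i w); rewrite le_eqVlt; apply/orP; left; apply/eqP.
  by apply: eq_eseriesr => l _; rewrite newborn_GamE sw.
by rewrite eseries0// => l _ _; rewrite newborn_GamE (negbTE sw) measure0.
Qed.

(** A discrete Gronwall inequality: each cell multiplies the mean number of births,
    increased by the bound k of the initial mass, by at most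
    1 + C Ca / (K + 1). *)
Lemma mean_accepted i k :
  (\int[P]_(w in small k) brood (xi w) (acc w i) + k%:R%:E <=
   (k%:R * (1 + C * (K.+1%:R^-1 * Ca)) ^+ i)%:E)%E.
Proof.
elim: i => [|i IH].
  rewrite expr0 mulr1 integral0_eq ?add0e// => w _.
  by rewrite /brood eseries0// => l _ _ /=; rewrite set0I measure0.
have C0 := mean_offspring_ge0 p_ge0 hC.
set h := C * (K.+1%:R^-1 * Ca) in IH *.
have h0 : 0 <= h by rewrite /h !mulr_ge0.
set e := (\int[P]_(w in small k) brood (xi w) (acc w i))%E in IH *.
have e0 : (0 <= e)%E by apply: integral_ge0 => w _; exact: nneseries_ge0.
have b0 w A : (0 <= brood (xi w) A)%E by exact: nneseries_ge0.
have macc := measurable_funTS (D := small k) (mbrood_acc i).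
have mm := measurable_funTS (D := small k) mmass.
have step1 : (\int[P]_(w in small k) brood (xi w) (acc w i.+1) <=
    e + \int[P]_(w in small k) brood (xi w) (newborn_of i w))%E.
  rewrite -ge0_integralD//.
  apply: ge0_le_integral => //.
  - exact: (measurable_funTS (mbrood_acc i.+1)).
  - exact: emeasurable_funD.
  - by move=> w _; exact: (brood_setU (xi w) (@measurable_accepted_noise i w) (@mnewborn i w)).
have step2 : (\int[P]_(w in small k) (h%:E * (mass w + brood (xi w) (acc w i))) <= h%:E * (k%:R%:E + e))%E.
  rewrite ge0_integralZl//; last 2 first.
  - exact: emeasurable_funD.
  - by move=> w _; exact: adde_ge0.
  apply: lee_wpmul2l => //; rewrite ge0_integralD//; apply: leeD => //.
  apply: (@le_trans _ _ (\int[P]_(w in small k) k%:R%:E)%E); first exact: ge0_le_integral.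
  rewrite integral_cst// -[leRHS]mule1; apply: lee_wpmul2l => //; exact: probability_le1.
apply: (@le_trans _ _ ((1 + h)%:E * (e + k%:R%:E))%E).
  have -> : ((1 + h)%:E * (e + k%:R%:E) = e + h%:E * (e + k%:R%:E) + k%:R%:E)%E.
    by rewrite EFinD ge0_muleDl// mul1e addeAC.
  apply: leeD; last exact: lexx.
  apply: (le_trans step1); apply: leeD; first exact: lexx.
  by apply: (le_trans (mean_newborn i k)); rewrite (addeC e).
rewrite exprS mulrCA EFinM; apply: lee_wpmul2l => //; by rewrite lee_fin addr_ge0.
Qed.

Lemma mean_accepted_time (T k : nat) :
  (\int[P]_(w in small k) brood (xi w) (acc w (T * K.+1)) <=
   (k%:R * expR (C * Ca * T%:R))%:E)%E.
Proof.
apply: (@le_trans _ _ (k%:R * (1 + C * (K.+1%:R^-1 * Ca)) ^+ (T * K.+1))%:E).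
  by apply: le_trans (mean_accepted _ k); rewrite leeDl.
have C0 := mean_offspring_ge0 p_ge0 hC.
rewrite lee_fin ler_wpM2l//.
have -> : C * Ca * T%:R = C * (K.+1%:R^-1 * Ca) * (T * K.+1)%:R.
  by rewrite natrM; field; rewrite addrC natr1 pnatr_eq0.
rewrite [X in _ <= expR X]mulrC expRM_natl lerXn2r// ?nnegrE ?expR_ge0//.
  by rewrite addr_ge0// !mulr_ge0.
exact: expR_ge1Dx.
Qed.

Lemma measurable_mean_accepted i k :
  measurable_fun [set: Omega] ((fun w => brood (xi w) (acc w i)) \_ (small k)).
Proof.
apply/(measurable_restrictT _ _).1 => //; exact: measurable_funTS.
Qed.

End moments.

(** * Cells with several atoms *)

Section crowded_cells.
Context {R : realType} (Ginf : probability (zseq R) R).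
Context {d : measure_display} {Omega : measurableType d} (P : probability Omega R).
Variables (F : R -> set (set Omega)) (M : Omega -> {measure set (noise_pt R) -> \bar R}).
Variable X0 : Omega -> dist_fun R.
Hypothesis h_F : usual_filtration P F.
Hypothesis h_M : poisson_random_measure P F (intensity Ginf) M.
Hypothesis h_X0 : init_sigma X0 `<=` F 0.
Variable N : nat.

Local Notation lam := (noise_intensity Ginf).
Local Notation xi := (noise M).

Section mesh.
Variable K : nat.

Definition crowded_cell : set Omega :=
  [set w | exists i, (1 < xi w (box N `&` cell K i))%E].

Let cell_strip i : box N `&` cell K i = strip N (grid K i) (grid K i.+1) :> set (noise_pt R).
Proof. by []. Qed.

Let measurable_double (B : set (noise_pt R)) : measurable B -> B `<=` box N ->
  measurable [set w | (1 < xi w B)%E].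
Proof.
move=> mB BN; rewrite -[X in measurable X]setTI.
exact: (emeasurable_fun_o_infty measurableT (measurable_noise_box h_F h_M h_X0 mB BN) 1%:E).
Qed.

Lemma crowded_cellE : crowded_cell =
  \big[setU/set0]_(i < N * K.+1) [set w | (1 < xi w (box N `&` cell K i))%E].
Proof.
rewrite -(bigcup_mkord _ (fun i => [set w | (1 < xi w (box N `&` cell K i))%E])).
apply/seteqP; split => w; last by move=> [i _ h]; exists i.
move=> [i hi]; exists i => //=; rewrite ltnNge; apply/negP => Ni; move: hi.
rewrite (_ : _ `&` _ = set0) ?measure0 ?lte_fin ?ltr10//.
apply/seteqP; split => q // -[/box_above/andP[_ qN] /andP[iq _]].
have : (N%:R : R) <= grid K i by rewrite /grid ler_pdivlMr// -natrM ler_nat.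
by move/(le_trans qN)/(lt_le_trans iq); rewrite ltxx.
Qed.

Lemma measurable_crowded_cell : measurable crowded_cell.
Proof.
rewrite crowded_cellE; apply: bigsetU_measurable => i _; apply: measurable_double.
  rewrite cell_strip; exact: measurable_strip.
exact: subIsetl.
Qed.

Lemma crowded_cell_le (c : R) : 0 <= c -> (forall a b, a <= b ->
    (lam (strip N a b) <= (c * (b - a))%:E)%E) ->
  (P crowded_cell <= (N%:R * c ^+ 2 / K.+1%:R)%:E)%E.
Proof.
move=> c0 hc.
rewrite crowded_cellE.
have ms i : measurable (box N `&` cell K i : set (noise_pt R)) by rewrite cell_strip; exact: measurable_strip.
have boole := @Boole_inequality _ _ _ P (fun i => [set w | (1 < xi w (box N `&` cell K i))%E]) (N * K.+1)%N.
apply: (le_trans (boole _)).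
  by move=> i _; apply: measurable_double => //; exact: subIsetl.
have -> : (N%:R * c ^+ 2 / K.+1%:R)%:E = (\sum_(i < N * K.+1) (c / K.+1%:R) ^+ 2)%:E :> \bar R.
  rewrite sumr_const card_ord; congr EFin.
  rewrite -[RHS]mulr_natr natrM; field.
  by rewrite addrC natr1 pnatr_eq0.
rewrite -sumEFin; apply: lee_sum => i _.
apply: (le_trans (noise_double h_F h_M h_X0 (ms i) (@subIsetl _ _ _))).
have hi : (lam (box N `&` cell K i) <= (c / K.+1%:R)%:E)%E.
  rewrite cell_strip; have ii : (grid K i : R) <= grid K i.+1 by exact: grid_le.
  apply: (le_trans (hc _ _ ii)).
  by rewrite /grid -mulrBl -natrB// subSnn mul1r.
by rewrite expr2 EFinM; apply: lee_pmul.
Qed.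

End mesh.

(** The number of cells is of order K, and each of them has two atoms with a
    probability of order 1 / K^2. *)
Lemma crowded_cell_small (e : R) : 0 < e ->
  exists K : nat, (P (crowded_cell K) <= e%:E)%E.
Proof.
move=> e0; have [c c0 hc] := intensity_strip Ginf N.
exists (Num.truncn (N%:R * c ^+ 2 / e)).
apply: (le_trans (crowded_cell_le _ c0 hc)).
rewrite lee_fin ler_pdivrMr// -ler_pdivrMl// mulrC; apply: ltW; exact: truncnS_gt.
Qed.

End crowded_cells.

(** * Passing to the limit along the Euler schemes *)

Section offspring_facts.
Context {R : realType} (p : R -> nat -> R).
Hypothesis h_p : offspring_law p.

Lemma p_ext_ge0 a n : 0 <= p_ext p a n.
Proof.
case: h_p => h _ _ _; case: a => [r||] //=; case: ifPn => // r0.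
by case: (h r r0) => + _; exact.
Qed.

Lemma p_ext_le1 a n : p_ext p a n <= 1.
Proof.
case: h_p => h _ _ _; case: a => [r||] //=; case: ifPn => // r0.
have [p0 p1] := h r r0; rewrite -lee_fin -p1.
apply: (@le_trans _ _ (\sum_(0 <= i < n.+1) (p r i)%:E)%E); last first.
  by apply: nneseries_lim_ge => i _ _; rewrite lee_fin.
by rewrite big_nat_recr//= leeDr// sume_ge0// => i _; rewrite lee_fin.
Qed.

Lemma mean_offspring_bounded : exists C : R, forall a,
  (\sum_(0 <= n <oo) (n%:R * p_ext p a n)%:E <= C%:E)%E.
Proof.
case: h_p => h _ hs _; set S := ereal_sup _ in hs.
have S0 : (0 <= S)%E.
  apply: (@le_trans _ _ (\sum_(1 <= i <oo) (i%:R * p 1 i)%:E)%E).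
    apply: nneseries_ge0 => i _ _; rewrite lee_fin mulr_ge0//.
    by case: (h 1 ltr01) => + _; exact.
  by apply: ereal_sup_ubound; exists 1 => //; rewrite /= in_itv/= andbT.
exists (fine S) => a; rewrite fineK ?ge0_fin_numE//.
have zero : (\sum_(0 <= n <oo) (n%:R * 0 : R)%:E <= S)%E.
  by rewrite eseries0// => n _ _; rewrite mulr0.
case: a => [r||]; [|exact: zero|exact: zero].
have [r0|r0] := boolP (0 < r); last by rewrite /p_ext (negbTE r0).
have e n : p_ext p r%:E n = p r n by rewrite /p_ext r0.
under eq_eseriesr do rewrite e.
rewrite nneseries_recl//; last first.
  by move=> n _; rewrite lee_fin mulr_ge0//; case: (h r r0) => + _; exact.
rewrite mul0r add0e; apply: ereal_sup_ubound; exists r => //=.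
by rewrite in_itv/= r0.
Qed.

End offspring_facts.

Section limit_ext.
Context {R : realType}.

Lemma weak_right_continuous_ext (X Y : R -> dist_fun R) t r : t < r ->
  (forall s, t <= s -> s < r -> X s = Y s) ->
  weak_right_continuous X t -> weak_right_continuous Y t.
Proof.
move=> tr XY h f cf bf; rewrite -XY//.
apply: cvg_trans (h f cf bf); apply: near_eq_cvg; near=> s.
have ts : t < s by near: s; exact: nbhs_right_gt.
have sr : s < r by near: s; exact: nbhs_right_lt.
by rewrite XY// ltW.
Unshelve. all: by end_near. Qed.

Lemma births_cvg (m : {measure set (noise_pt R) -> \bar R}) (A : nat -> set (noise_pt R)) t x :
  (forall n, measurable (A n)) -> nondecreasing_seq A ->
  births m (A n) t x @[n --> \oo] --> births m (\bigcup_n A n) t x.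
Proof.
move=> mA ndA.
pose mu := mseries (fun i => mrestr m (measurable_child_alive i t x)) 0.
by apply: (@nondecreasing_cvg_mu _ _ _ mu) => //; exact: bigcup_measurable.
Qed.

End limit_ext.

Section pathwise_limit.
Context {R : realType}.
Variables (alpha : R -> R) (p : R -> nat -> R).
Hypotheses (h_alpha : C1_pos alpha) (h_p : forall i, C1_pos (p ^~ i)).
Hypothesis p_le1 : forall a n, p_ext p a n <= 1.
Variables (m : {measure set (noise_pt R) -> \bar R}) (X0 : dist_fun R).
Hypothesis m_lt1 : forall B, measurable B -> B `<=` noise_dom (R := R) ->
  (m B < 1)%E -> m B = 0%E.
Variables (N : nat -> nat) (Xj Xlj : nat -> R -> dist_fun R).
Hypothesis N_nd : forall i j, (i <= j)%N -> (N i <= N j)%N.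
Hypothesis N_oo : forall k, exists j, (k <= N j)%N.
Local Notation psol j T X Xl := (path_solution alpha p m (box (N j)) X0 T X Xl).
Hypothesis own : forall T : nat, \forall j \near \oo, psol j T%:R (Xj j) (Xlj j).
Hypothesis next : forall T : nat, \forall j \near \oo, psol j T%:R (Xj j.+1) (Xlj j.+1).

(** The schemes j and j + 1 solve the same localized equation, so uniqueness makes
    them equal up to time T. *)
Lemma stabilize (T : nat) : exists J, forall j, (J <= j)%N ->
  psol j T%:R (Xj j) (Xlj j) /\ forall t, 0 <= t -> t <= T%:R -> Xj j t = Xj J t.
Proof.
have [J1 _ h1] := own T; have [J2 _ h2] := next T.
exists (maxn J1 J2) => j Jj.
have ge1 i : (maxn J1 J2 <= i)%N -> psol i T%:R (Xj i) (Xlj i).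
  by rewrite geq_max => /andP[Ji _]; exact: h1.
split; first exact: ge1.
move=> t t0 tT; elim: j Jj => [|j IH]; first by rewrite leqn0 => /eqP ->.
rewrite leq_eqVlt => /predU1P[->//|]; rewrite ltnS => Jj.
rewrite -IH//; apply/esym.
have s2 : psol j T%:R (Xj j.+1) (Xlj j.+1) by apply: h2; move: Jj; rewrite geq_max => /andP[].
have m1 B : measurable B -> B `<=` box (N j) -> (m B < 1)%E -> m B = 0%E.
  by move=> mB BN; apply: m_lt1 => // q /BN/box_dom.
exact: (path_unique h_alpha h_p (measurable_box (N j)) m1 (ge1 _ Jj) s2 t0 tT).
Qed.

(** Until a given time the births over the boxes increase to the births over the
    whole space of atoms, and they are eventually constant because the paths are. *)
Theorem pathwise_limit (X : R -> dist_fun R) :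
  (forall t, 0 <= t -> \forall j \near \oo, X t = Xj j t) ->
  exists Xl : R -> dist_fun R,
    [/\ forall t : R, 0 <= t -> weak_right_continuous X t,
        forall s : R, 0 < s -> left_limit X s (Xl s) &
        forall t x : R, 0 <= t -> 0 < x ->
          (X t x)%:E = ((X0 (x + t) - X0 t)%R%:E + birth_integral alpha p m Xl t x)%E].
Proof.
move=> hX.
have agree (T : nat) : exists J, forall j, (J <= j)%N ->
    psol j T%:R (Xj j) (Xlj j) /\ forall t, 0 <= t -> t <= T%:R -> X t = Xj j t.
  have [J hJ] := stabilize T; exists J => j Jj; have [s1 s2] := hJ j Jj; split => // t t0 tT.
  have [k _ hk] := hX t t0; rewrite (hk (maxn J k) (leq_maxr _ _)).
  have [_ ->//] := hJ (maxn J k) (leq_maxl _ _).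
  by rewrite s2.
pose T (t : R) : nat := (Num.truncn t).+1.
have ltT (t : R) : t < (T t)%:R by exact: truncnS_gt.
have ll s : exists nu, 0 < s -> left_limit X s nu.
  have [J hJ] := agree (T s); have [[_ h _] e] := hJ J (leqnn J).
  exists (Xlj J s) => s0; apply: (@left_limit_ext _ (Xj J) X 0 s) => //.
    by move=> t t0 ts; rewrite e// ?ltW// (lt_trans ts).
  by apply: h => //; exact: ltW.
pose Xl s := projT1 (cid (ll s)).
have hXl s : 0 < s -> left_limit X s (Xl s) by exact: (projT2 (cid (ll s))).
have XlE T0 j : psol j T0%:R (Xj j) (Xlj j) -> (forall t, 0 <= t -> t <= T0%:R -> X t = Xj j t) ->
    forall s, 0 < s -> s <= T0%:R -> Xl s = Xlj j s.
  move=> [_ h _] e s s0 sT; apply: (@left_limit_unique _ X (Xj j) 0 s) => //.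
  - by move=> t t0 ts; rewrite e// ltW// (lt_le_trans ts).
  - exact: hXl.
  - exact: h.
exists Xl; split => //.
  move=> t t0; have [J hJ] := agree (T t); have [[h _ _] e] := hJ J (leqnn J).
  apply: (@weak_right_continuous_ext _ (Xj J) X t (T t)%:R) => //; last exact: h.
  by move=> s ts sT; rewrite e// ?(le_trans t0)// ltW.
move=> t x t0 x0.
have mr : measurable (region alpha p Xl `&` [set q | qs q <= t]).
  apply: (measurable_region h_alpha h_p) => z; apply: (@left_limit_measurable _ X).
  by move=> s s0 _; exact: hXl.
rewrite birth_integralE//.
pose A n := region alpha p Xl `&` [set q | qs q <= t] `&` box (N n).
have mA n : measurable (A n) by apply: measurableI => //; exact: measurable_box.
have ndA : nondecreasing_seq A.
  by move=> i j ij; apply/subsetPset => q [rq bq]; split => //; apply: box_le bq; exact: N_nd.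
have AE : \bigcup_n A n = region alpha p Xl `&` [set q | qs q <= t].
  apply/seteqP; split => q; first by move=> [n _ []].
  move=> [rq qt]; have : noise_dom q by exact: (region_noise_dom p_le1 rq).
  rewrite -bigcup_box => -[k _ bq]; have [j kj] := N_oo k.
  by exists j => //; split; [split|exact: box_le bq].
have be : births m (region alpha p Xl) t x = births m (\bigcup_n A n) t x.
  apply: births_upto; rewrite AE; apply/seteqP; split => q; first by move=> [rq qt]; split; [split|].
  by move=> [[rq qt] _]; split.
rewrite be; have [J hJ] := agree (T t).
have const : \forall n \near \oo, (X t x)%:E = ((X0 (x + t) - X0 t)%:E + births m (A n) t x)%E.
  exists J => // n Jn; have [s e] := hJ n Jn.
  have tT : t <= (T t)%:R by exact: ltW.
  rewrite (e t t0 tT) (sol_eq s t0 tT x0).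
  have bn : births m (region alpha p (Xlj n) `&` box (N n)) t x = births m (A n) t x.
    have XlE' := XlE _ _ s e.
    apply: births_upto; apply/seteqP; split => q /= [].
      move=> [[q0 mq aq] bq] qt; have e' := XlE' _ q0 (le_trans qt tT).
      by split; [split; [split; [split; [exact: q0|exact: mq|rewrite e'; exact: aq]|exact: qt]|exact: bq]|exact: qt].
    move=> [[[q0 mq aq] _] bq] qt; have e' := XlE' _ q0 (le_trans qt tT).
    by rewrite e' in aq; split; [split; [split; [exact: q0|exact: mq|exact: aq]|exact: bq]|exact: qt].
  exact: (f_equal (fun b => ((X0 (x + t) - X0 t)%:E + b)%E) bn).
have lim1 : ((X0 (x + t) - X0 t)%:E + births m (A n) t x)%E @[n --> \oo] -->
    ((X0 (x + t) - X0 t)%:E + births m (\bigcup_n A n) t x)%E.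
  apply: cvgeD; [by rewrite fin_num_adde_defr|exact: cvg_cst|exact: births_cvg].
have lim2 : ((X0 (x + t) - X0 t)%:E + births m (A n) t x)%E @[n --> \oo] --> (X t x)%:E.
  by apply: cvg_near_cst; apply: filterS const => n ->.
exact: (cvg_unique _ lim2 lim1).
Qed.

End pathwise_limit.

(** * Almost sure convergence of the schemes *)

Section construction.
Context {R : realType} (Ginf : probability (zseq R) R).
Context {d : measure_display} {Omega : measurableType d} (P : probability Omega R).
Variables (F : R -> set (set Omega)) (M : Omega -> {measure set (noise_pt R) -> \bar R}).
Variable X0 : Omega -> dist_fun R.
Hypothesis h_F : usual_filtration P F.
Hypothesis h_M : poisson_random_measure P F (intensity Ginf) M.
Hypothesis h_X0 : init_sigma X0 `<=` F 0.
Variables (alpha : R -> R) (p : R -> nat -> R).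
Hypotheses (h_alpha : C1_pos alpha) (h_p : offspring_law p).

Local Notation xi := (noise M).

Let h_p1 i : C1_pos (p ^~ i). Proof. by case: h_p. Qed.
Let p_le1 := p_ext_le1 h_p.
Let p_ge0 := p_ext_ge0 h_p.

(** The j-th scheme uses the atoms of the box of size 2^j, and a mesh so fine that
    two of them rarely share a cell. *)
Definition mesh (j : nat) : nat :=
  if pselect (exists K : nat, (P (crowded_cell M (2 ^ j) K) <= (1 / 2 ^+ j)%:E)%E) is left h
  then projT1 (cid h) else 0%N.

Lemma meshE j : (P (crowded_cell M (2 ^ j) (mesh j)) <= (1 / 2 ^+ j)%:E)%E.
Proof.
rewrite /mesh; case: pselect => [h|[]]; first exact: (projT2 (cid h)).
by apply: (crowded_cell_small h_F h_M h_X0); rewrite divr_gt0// exprn_gt0.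
Qed.

Definition scheme j w : R -> dist_fun R :=
  euler_path alpha p (xi w) (X0 w) (box (2 ^ j)) (mesh j).

Definition scheme_left j w : R -> dist_fun R :=
  euler_left alpha p (xi w) (X0 w) (box (2 ^ j)) (mesh j).

Definition scheme_births j w (T : nat) : \bar R :=
  brood (xi w) (accepted alpha p (xi w) (X0 w) (box (2 ^ j)) (mesh j) (T * (mesh j).+1)).

Lemma eventually_uncrowded :
  {ae P, forall w, \forall j \near \oo, ~ crowded_cell M (2 ^ j) (mesh j) w}.
Proof.
have mc j := measurable_crowded_cell h_F h_M h_X0 (2 ^ j) (mesh j).
have : {ae P, forall w, \forall j \near \oo,
    ((\1_(crowded_cell M (2 ^ j) (mesh j)) w : R)%:E < 1)%E}.
  apply: (@ae_eventually_lt1 _ _ _ P (fun j w => (\1_(crowded_cell M (2 ^ j) (mesh j)) w : R)%:E) 1).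
  - by move=> j; apply/measurable_EFinP; exact: measurable_indic.
  - by move=> j w; rewrite lee_fin.
  - by move=> j; rewrite integral_indic// setIT; exact: meshE.
apply: filterS => w; apply: filterS => j; rewrite indicE lte_fin => h cw; move: h.
by rewrite mem_set// ltxx.
Qed.

(** The mean number of births until T is bounded independently of the box, whereas
    the size of the box grows geometrically. *)
Lemma eventually_few_births (c : R) (k T : nat) : 0 <= c ->
  {ae P, forall w, \forall j \near \oo, small X0 k w ->
    (c%:E * scheme_births j w T < (2 ^+ j)%:E)%E}.
Proof.
move=> c0; have [C hC] := mean_offspring_bounded h_p.
have [Ca Ca0 hCa] := alpha_bounded h_alpha.
pose f j w : \bar R := ((c / 2 ^+ j)%:E * ((fun w => scheme_births j w T) \_ (small X0 k)) w)%E.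
have mf j : measurable_fun [set: Omega] ((fun w => scheme_births j w T) \_ (small X0 k)).
  exact: (measurable_mean_accepted h_F h_M h_X0 h_alpha h_p1).
have r0 j w : (0 <= ((fun w => scheme_births j w T) \_ (small X0 k)) w)%E.
  by rewrite patchE; case: ifPn => // _; exact: nneseries_ge0.
have c2 j : 0 <= c / 2 ^+ j by rewrite divr_ge0// exprn_ge0.
have := @ae_eventually_lt1 _ _ _ P f (c * (k%:R * expR (C * Ca * T%:R))) _ _ _.
move=> /(_ _ _ _) h; have {}h : {ae P, forall w, \forall j \near \oo, (f j w < 1)%E}.
  apply: h.
  - by move=> j; exact: measurable_funeM.
  - by move=> j w; apply: mule_ge0; [rewrite lee_fin|exact: r0].
  - move=> j.
    have -> : (\int[P]_w f j w = (c / 2 ^+ j)%:E * \int[P]_(w in small X0 k) scheme_births j w T)%E.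
      rewrite [in RHS]integral_mkcond; apply: ge0_integralZl => //.
      by rewrite lee_fin.
    rewrite mulrAC [X in (_ <= X)%E]EFinM.
    apply: lee_wpmul2l; first by rewrite lee_fin.
    exact: (mean_accepted_time h_F h_M h_X0 h_alpha h_p1 p_ge0 hC Ca0 hCa).
move: h; apply: filterS => w; apply: filterS => j; rewrite /f => fj sw; move: fj.
rewrite patchE mem_set// => fj.
have -> : (c%:E * scheme_births j w T = (2 ^+ j)%:E * ((c / 2 ^+ j)%:E * scheme_births j w T))%E.
  by rewrite muleA -EFinM; congr (_%:E * _)%E; field; rewrite expf_neq0.
by rewrite -[ltRHS]mule1 lte_pmul2l// lte_fin exprn_gt0.
Qed.

Let measurable_scheme_acc j w i :
  measurable (accepted alpha p (xi w) (X0 w) (box (2 ^ j)) (mesh j) i).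
Proof. exact: (measurable_accepted_noise h_F h_M h_X0 h_alpha h_p1). Qed.

Let box_lt1 w N B : measurable B -> B `<=` box N -> (xi w B < 1)%E -> xi w B = 0%E.
Proof. by move=> mB BN; apply: noise_lt1 => // q /BN/box_dom. Qed.

Let uncrowded_le1 j w : ~ crowded_cell M (2 ^ j) (mesh j) w ->
  forall i, (xi w (box (2 ^ j) `&` cell (mesh j) i) <= 1)%E.
Proof. by move=> nc i; rewrite leNgt; apply/negP => h; apply: nc; exists i. Qed.

Lemma scheme_own j w T : ~ crowded_cell M (2 ^ j) (mesh j) w ->
  path_solution alpha p (xi w) (box (2 ^ j)) (X0 w) T (scheme j w) (scheme_left j w).
Proof.
move=> nc; apply: (euler_solution h_alpha h_p1) => //.
- exact: measurable_box.
- exact: box_dom.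
- by move=> B; exact: box_lt1.
- exact: uncrowded_le1.
- exact: brood_box_fin.
Qed.

(** An accepted atom of the larger box has its second coordinate and its number of
    children bounded in terms of the initial mass and the number of births; for
    large j both are small compared with 2^j, so the atom is in the smaller box. *)
Lemma scheme_next w (Ca : R) : 0 <= Ca -> (forall x, 0 < x -> `|alpha x| <= Ca) ->
  (\forall j \near \oo, ~ crowded_cell M (2 ^ j) (mesh j) w) ->
  (forall k T, \forall j \near \oo, small X0 k w ->
    ((4 * (1 + Ca))%:E * scheme_births j w T < (2 ^+ j)%:E)%E) ->
  forall T : nat, \forall j \near \oo, path_solution alpha p (xi w) (box (2 ^ j)) (X0 w) T%:R
    (scheme j.+1 w) (scheme_left j.+1 w).
Proof.
move=> Ca0 hCa [J1 _ nc] few T.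
pose mu := fine (LS (X0 w) `]0%R, +oo[%classic).
have muE : LS (X0 w) `]0%R, +oo[%classic = mu%:E.
  by rewrite fineK// ge0_fin_numE// LS_0y_fin.
have mu0 : 0 <= mu by rewrite fine_ge0.
pose k := (Num.truncn mu).+1.
have sk : small X0 k w by rewrite /small/= muE lee_fin ltW// truncnS_gt.
have [J2 _ hJ2] := few k T.
pose J := maxn (maxn J1 J2) (maxn T (Num.truncn (2 * (Ca * mu))).+1).
exists J => // j /= Jj.
have jJ1 : (J1 <= j.+1)%N by rewrite (leq_trans _ (leqW Jj))// /J !leq_max leqnn.
have jJ2 : (J2 <= j.+1)%N by rewrite (leq_trans _ (leqW Jj))// /J !leq_max leqnn orbT.
have jT : (T <= 2 ^ j)%N.
  by apply: leq_trans (ltnW (ltn_expl j (ltnSn 1))); apply: leq_trans Jj; rewrite /J !leq_max leqnn !orbT.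
have jm : 2 * (Ca * mu) <= 2 ^+ j.
  apply/ltW/(lt_le_trans (truncnS_gt _)); rewrite -natrX ler_nat.
  by apply: leq_trans (ltnW (ltn_expl j (ltnSn 1))); apply: leq_trans Jj; rewrite /J !leq_max leqnn !orbT.
set b := scheme_births j.+1 w T.
have b0 : (0 <= b)%E by exact: nneseries_ge0.
have fb : (b < +oo)%E.
  apply: le_lt_trans (brood_box_fin M w (2 ^ j.+1)); apply: brood_le => //; first exact: measurable_box.
  by move=> q /accepted_sub[].
have bE : b = (fine b)%:E by rewrite fineK// ge0_fin_numE.
have rb0 : 0 <= fine b by exact: fine_ge0.
have hb : 4 * (1 + Ca) * fine b < 2 ^+ j.+1.
  by have := hJ2 _ jJ2 sk; rewrite -/b bE -EFinM lte_fin.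
(* The births take up half of the size of the smaller box; by jm the initial
   mass takes up the other half. *)
have h1 : (1 + Ca) * fine b <= 2 ^+ j / 2.
  by rewrite exprS in hb; set x := 2 ^+ j in hb *; lra.
have Cb : 0 <= Ca * fine b by rewrite mulr_ge0.
apply: (@euler_restrict _ alpha p h_alpha h_p1 (xi w) (X0 w) (box (2 ^ j.+1)) (mesh j.+1)
  _ _ _ _ _ _ (box (2 ^ j)) T%:R (T * (mesh j.+1).+1)%N Ca) => //.
- exact: measurable_box.
- exact: box_dom.
- by move=> B; exact: box_lt1.
- by apply: uncrowded_le1; exact: nc.
- exact: brood_box_fin.
- exact: measurable_box.
- by apply: box_le; rewrite leq_exp2l.
- by rewrite /grid natrM mulfK.
move=> q c Dq qT qc; rewrite -/(scheme_births j.+1 w T) -/b muE bE -EFinD -EFinM !lee_fin => cle nle.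
split; [split; [split|]|].
- exact: box_dom Dq.
- by rewrite /= (le_trans qT)// ler_nat.
- rewrite /= (le_trans qc)// (le_trans cle)// natrX; set x := 2 ^+ j in h1 jm *; lra.
- rewrite /= -(ler_nat R) (le_trans nle)// natrX.
  have : 0 <= 2 ^+ j :> R by rewrite exprn_ge0.
  by set x := 2 ^+ j in h1 *; lra.
Qed.

(** Pathwise conditions that hold almost surely and force the schemes to
    stabilize. *)
Definition convergent : set Omega := [set w | good M w /\
  ((\forall j \near \oo, ~ crowded_cell M (2 ^ j) (mesh j) w) /\
   exists Ca : R, [/\ 0 <= Ca, forall x, 0 < x -> `|alpha x| <= Ca &
     forall k T, \forall j \near \oo, small X0 k w ->
       ((4 * (1 + Ca))%:E * scheme_births j w T < (2 ^+ j)%:E)%E])].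

Lemma convergent_ae : P.-negligible (~` convergent).
Proof.
have [Ca Ca0 hCa] := alpha_bounded h_alpha.
have c0 : 0 <= 4 * (1 + Ca) by rewrite mulr_ge0// addr_ge0.
have few : {ae P, forall w, forall k T, \forall j \near \oo, small X0 k w ->
    ((4 * (1 + Ca))%:E * scheme_births j w T < (2 ^+ j)%:E)%E}.
  by apply: ae_foralln => k; apply: ae_foralln => T; exact: eventually_few_births.
have g : {ae P, forall w, good M w} by exact: good_ae h_F h_M h_X0.
have : {ae P, forall w, convergent w}.
  apply: filterS3 g eventually_uncrowded few => w gw uw fw; split => //; split => //.
  by exists Ca.
exact.
Qed.

Lemma convergent_own w : convergent w -> forall T : nat, \forall j \near \oo,
  path_solution alpha p (xi w) (box (2 ^ j)) (X0 w) T%:R (scheme j w) (scheme_left j w).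
Proof. by move=> [_ [nc _]] T; apply: filterS nc => j; exact: scheme_own. Qed.

Lemma convergent_next w : convergent w -> forall T : nat, \forall j \near \oo,
  path_solution alpha p (xi w) (box (2 ^ j)) (X0 w) T%:R (scheme j.+1 w) (scheme_left j.+1 w).
Proof. by move=> [_ [nc [Ca [Ca0 hCa few]]]]; exact: (scheme_next Ca0 hCa nc few). Qed.

Definition limit_path (t : R) (w : Omega) : dist_fun R :=
  if pselect (convergent w /\ exists mu, \forall j \near \oo, mu = scheme j w t) is left h
  then projT1 (cid (proj2 h)) else dist_fun_zero.

Lemma limit_pathE t w : convergent w -> 0 <= t ->
  \forall j \near \oo, limit_path t w = scheme j w t.
Proof.
move=> cw t0; rewrite /limit_path; case: pselect => [h|[]]; first exact: (projT2 (cid (proj2 h))).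
split; first exact: cw.
have N_nd i j : (i <= j)%N -> (2 ^ i <= 2 ^ j)%N by move=> ij; rewrite leq_exp2l.
have m1 B : measurable B -> B `<=` noise_dom (R := R) -> (xi w B < 1)%E -> xi w B = 0%E.
  exact: noise_lt1.
have [J hJ] := stabilize h_alpha h_p1 m1 (convergent_own cw) (convergent_next cw) (Num.truncn t).+1.
exists (scheme J w t); exists J; [exact: I|move=> j /= Jj].
have [_ e] := hJ j Jj; apply/esym/e => //; apply: ltW; exact: truncnS_gt.
Qed.

Lemma measurable_scheme t j x : 0 <= t ->
  measurable_fun [set: history P M X0 t] (fun w => scheme j w t x).
Proof.
move=> t0.
apply: (@measurable_euler_path _ _ (history P M X0 t) alpha p h_alpha h_p1 xi X0
  (box (2 ^ j)) (mesh j) t) => //.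
- exact: measurable_box.
- exact: box_dom.
- by move=> w; exact: noise_fin.
- by move=> w; exact: brood_box_fin.
- by move=> B mB; exact: (measurable_noise_cut h_F h_M h_X0).
- by move=> z; exact: history_init.
Qed.

(** The event of convergence refers to the whole future, but it has full measure,
    so it belongs to the completed filtration at every time. *)
Lemma measurable_limit_path t x : 0 <= t ->
  measurable_fun [set: history P M X0 t] (fun w => limit_path t w x).
Proof.
move=> t0.
have mc : measurable (convergent : set (history P M X0 t)).
  by rewrite -[convergent]setCK; apply: measurableC; apply: history_negligible; exact: convergent_ae.
apply: (@measurable_fun_cvg _ (history P M X0 t) _ _
  (fun j => (fun w => scheme j w t x) \_ convergent)).
  move=> j; apply: (proj1 (@measurable_restrictT _ _ (history P M X0 t) _ convergent (fun w => scheme j w t x) mc)).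
  exact: (@measurable_funTS _ _ (history P M X0 t) _ convergent _ (measurable_scheme j x t0)).
move=> w _; have [cw|ncw] := pselect (convergent w); last first.
  have -> : limit_path t w x = 0.
    by rewrite /limit_path; case: pselect => [[]//|_]; exact: dist_fun_zeroE.
  by apply: cvg_near_cst; apply: nearW => j; rewrite patchE memNset.
apply: cvg_near_cst; apply: filterS (limit_pathE cw t0) => j ->.
by rewrite patchE mem_set.
Qed.

Lemma limit_path_adapted t : 0 <= t ->
  init_sigma (limit_path t) `<=` natural_filtration P X0 M t.
Proof.
move=> t0; apply: smallest_sub; first exact: smallest_sigma_algebra.
move=> _ [x [C [mC ->]]].
by have := measurable_limit_path x t0 measurableT mC; rewrite setTI.
Qed.

Theorem limit_path_solution (H : R -> set (set Omega)) :
  (forall t, 0 <= t -> natural_filtration P X0 M t `<=` H t) ->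
  solution alpha p P H M X0 limit_path.
Proof.
move=> GH; split; first by move=> t t0; exact: (subset_trans (limit_path_adapted t0) (GH t t0)).
apply: negligibleS convergent_ae => w; apply: contra_not => cw.
have N_nd i j : (i <= j)%N -> (2 ^ i <= 2 ^ j)%N by move=> ij; rewrite leq_exp2l.
have N_oo k : exists j, (k <= 2 ^ j)%N by exists k; exact: ltnW (ltn_expl k (ltnSn 1)).
have m1 B : measurable B -> B `<=` noise_dom (R := R) -> (xi w B < 1)%E -> xi w B = 0%E.
  exact: noise_lt1.
have := pathwise_limit h_alpha h_p1 p_le1 m1 N_nd N_oo (convergent_own cw) (convergent_next cw)
  (fun t => @limit_pathE t w cw).
by rewrite noise_good//; case: cw.
Qed.

Theorem solution_unique (X Y : R -> Omega -> dist_fun R) :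
  solution alpha p P F M X0 X -> solution alpha p P F M X0 Y ->
  {ae P, forall w, forall t x : R, 0 <= t -> X t w x = Y t w x}.
Proof.
have sol (Z : R -> Omega -> dist_fun R) w (Zl : R -> dist_fun R) T : 
    (forall t : R, 0 <= t -> weak_right_continuous (Z ^~ w) t) ->
    (forall s : R, 0 < s -> left_limit (Z ^~ w) s (Zl s)) ->
    (forall t x : R, 0 <= t -> 0 < x -> (Z t w x)%:E =
      ((X0 w (x + t) - X0 w t)%R%:E + birth_integral alpha p (M w) Zl t x)%E) ->
    path_solution alpha p (M w) (noise_dom (R := R)) (X0 w) T (Z ^~ w) Zl.
  move=> rc ll eqn; split.
  - by move=> t t0 _; exact: rc.
  - by move=> s s0 _; exact: ll.
  move=> t x t0 _ x0; rewrite eqn//; congr (_ + _)%E; rewrite birth_integralE.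
    by rewrite setIidl//; exact: region_noise_dom.
  apply: (measurable_region h_alpha h_p1) => z; apply: (@left_limit_measurable _ (Z ^~ w)).
  by move=> s s0 _; exact: ll.
move=> [_ solX] [_ solY].
have g : {ae P, forall w, good M w} by exact: good_ae h_F h_M h_X0.
apply: filterS3 g solX solY => w gw [Xl [X1 X2 X3]] [Yl [Y1 Y2 Y3]] t x t0.
have m1 B : measurable B -> B `<=` noise_dom (R := R) -> (M w B < 1)%E -> M w B = 0%E.
  by rewrite -(noise_good gw); exact: noise_lt1.
have sX := sol X w Xl t X1 X2 X3; have sY := sol Y w Yl t Y1 Y2 Y3.
by rewrite (path_unique h_alpha h_p1 (measurable_noise_dom (R := R)) m1 sX sY t0 (lexx t)).
Qed.

End construction.

Theorem theorem3p6 (R : realType) (alpha : R -> R) (p : R -> nat -> R)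
    (G : probability R R) (Ginf : probability (zseq R) R)
    (d : measure_display) (Omega : measurableType d)
    (P : probability Omega R) (F : R -> set (set Omega))
    (M : Omega -> {measure set (noise_pt R) -> \bar R})
    (X0 : Omega -> dist_fun R)
    (h_alpha : C1_pos alpha)
    (h_p : offspring_law p)
    (h_G : continuous_law G)
    (h_Ginf : infinite_product G Ginf)
    (h_F : usual_filtration P F)
    (h_M : poisson_random_measure P F (intensity Ginf) M)
    (h_X0 : init_sigma X0 `<=` F 0) :
  (exists X : R -> Omega -> dist_fun R,
     solution alpha p P F M X0 X /\
     solution alpha p P (natural_filtration P X0 M) M X0 X) /\
  (forall X Y : R -> Omega -> dist_fun R,
     solution alpha p P F M X0 X -> solution alpha p P F M X0 Y ->
     {ae P, forall w, forall t x : R, 0 <= t -> X t w x = Y t w x}).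
Proof.
split; last exact: (solution_unique h_F h_M h_X0 h_alpha h_p).
exists (limit_path P M X0 alpha p).
split; apply: (limit_path_solution h_F h_M h_X0 h_alpha h_p) => t t0 A.
  exact: (history_filtration h_F h_M h_X0).
exact.
Qed.
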